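(* Let $\mathcal{X}$ be a separable complex Banach space and suppose that the linear operator $A:D(A)\rightarrow\mathcal{X}$ generates a strongly continuous semigroup $(K(t))_{t\ge 0}$ on $\mathcal{X}$, $K(t)=\exp(At)$, satisfying $\|K(t)\|\le M$ for all $t\ge 0$, where $M\ge 1$. Let $m\ge 2$ be an even integer, and let $\delta>0$, $h>0$, $N\in\mathbb{N}_{\ge 1}$, $t>0$. If $x\in D(A^m)$, then the approximation error $$E_{h,N}(t;\delta)=\exp(At)x-(2\delta-A)^m\left[\frac{h}{2\pi}\sum_{k=-N}^{N}\frac{e^{(\delta+ihk)t}}{(\delta-ihk)^m}R_A(\delta+ihk)\right]x$$ satisfies $\|E_{h,N}(t;\delta)\|\le E_{\rm D}+E_{\rm T}$, where the discretization error $E_{\rm D}$ and truncation error $E_{\rm T}$ (defined in the context) satisfy $$E_{\rm D}\le\frac{Me^{3\delta t/2}}{\delta^m(e^{\delta\pi/h}-1)}\left[\frac{2^{m+1}\Gamma\left(\frac32\right)\Gamma\left(\frac{m-1}{2}\right)}{\pi\,\Gamma\left(\frac m2\right)}\right]\|(2\delta-A)^mx\|$$ and $$E_{\rm T}\le\frac{Me^{\delta t}}{\delta^m}\left[\frac{\Gamma\left(\frac32\right)\Gamma\left(\frac{m-1}{2}\right)}{\pi\,\Gamma\left(\frac m2\right)}-\frac{hN}{\pi\delta}\,{}_2F_1\left(\frac12,\frac m2;\frac32;-\left(\frac{hN}{\delta}\right)^2\right)\right]\|(2\delta-A)^mx\|.$$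
   Context: $R_A(z)=(z-A)^{-1}$ denotes the resolvent of $A$, defined for $z$ in the resolvent set; under the stated growth bound it is defined for all $z$ with ${\rm Re}\,z>0$. $\|\cdot\|$ is the norm on $\mathcal{X}$ (and the induced operator norm). $\Gamma$ is the gamma function and ${}_2F_1(a,b;c;z)$ is the Gauss hypergeometric function (for arguments $z\le -1$, its standard analytic continuation to $\mathbb{C}\setminus[1,\infty)$). For $x\in D(A^m)$ define $$S_h(t;\delta)=\left[\frac{h}{2\pi}\sum_{k=-\infty}^{\infty}\frac{e^{(\delta+ihk)t}}{(\delta-ihk)^m}R_A(\delta+ihk)\right](2\delta-A)^mx,$$ and let $S_h^N(t;\delta)$ be the same expression with the sum restricted to $-N\le k\le N$. For $x\in D(A^m)$ the operator $(2\delta-A)^m$ commutes with the finite bracketed sum, so $S_h^N(t;\delta)$ equals the approximation $(2\delta-A)^m[\cdots]x$ in the claim. The discretization error is $E_{\rm D}=\|\exp(At)x-S_h(t;\delta)\|$ and the truncation error is $E_{\rm T}=\|S_h(t;\delta)-S_h^N(t;\delta)\|$. *)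

(* Defs.v *)
From Stdlib Require Import Reals ZArith ClassicalEpsilon.
From Coquelicot Require Import Coquelicot.

Open Scope R_scope.

Section Operators.
Context {X : CompleteNormedModule C_AbsRing}.

Definition separable_space : Prop :=
  exists u : nat -> X,
    forall (x : X) (eps : R), 0 < eps -> exists n, norm (minus (u n) x) < eps.

(* A possibly unbounded operator [dom -> X].  The values of [op_app] outside
   [dom] carry no meaning. *)
Record operator : Type := Operator {
  dom : X -> Prop;
  op_app :> X -> X
}.

Definition linear_operator (A : operator) : Prop :=
  dom A zero /\
  forall (c : C) (x y : X), dom A x -> dom A y ->
    dom A (plus (scal c x) y) /\
    A (plus (scal c x) y) = plus (scal c (A x)) (A y).

(* [z - A], on the domain of [A]. *)
Definition scalar_minus (z : C) (A : operator) : operator :=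
  Operator (dom A) (fun x => minus (scal z x) (A x)).

Fixpoint op_pow (A : operator) (n : nat) : operator :=
  match n with
  | O => Operator (fun _ => True) (fun x => x)
  | S n' => Operator (fun x => dom A x /\ dom (op_pow A n') (A x))
                     (fun x => op_pow A n' (A x))
  end.

Definition in_resolvent_set (A : operator) (z : C) : Prop :=
  exists T : X -> X,
    is_linear T /\
    (forall y, dom A (T y) /\ scalar_minus z A (T y) = y) /\
    (forall x, dom A x -> T (scalar_minus z A x) = x).

(* [(z - A)^-1 y]; meaningful when [z] is in the resolvent set. *)
Definition resolvent (A : operator) (z : C) (y : X) : X :=
  iota (fun x => dom A x /\ scalar_minus z A x = y).

Definition op_norm (T : X -> X) : Rbar :=
  Lub_Rbar (fun r => exists x, norm x <= 1 /\ r = norm (T x)).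

(* Only the values [K t] with [0 <= t] are relevant. *)
Definition C0_semigroup (K : R -> X -> X) : Prop :=
  (forall t, 0 <= t -> is_linear (K t)) /\
  (forall x, K 0 x = x) /\
  (forall s t x, 0 <= s -> 0 <= t -> K (s + t) x = K s (K t x)) /\
  (forall x, filterlim (fun t => K t x) (at_right 0) (locally x)).

Definition generates (A : operator) (K : R -> X -> X) : Prop :=
  C0_semigroup K /\
  forall x y : X,
    (dom A x /\ A x = y) <->
    filterlim (fun t => scal (RtoC (/ t)) (minus (K t x) x))
              (at_right 0) (locally y).

(* [sum_{k=-N}^{N} a k]. *)
Definition zsum (a : Z -> X) (N : nat) : X :=
  sum_n (fun j => a (Z.of_nat j - Z.of_nat N)%Z) (2 * N).

(* Convergence of a bilateral series: both one-sided series converge. *)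
Definition is_zseries (a : Z -> X) (l : X) : Prop :=
  exists l1 l2 : X,
    is_series (fun n => a (Z.of_nat n)) l1 /\
    is_series (fun n => a (- Z.of_nat (S n))%Z) l2 /\
    l = plus l1 l2.

Definition zseries (a : Z -> X) : X := iota (is_zseries a).

End Operators.

Arguments separable_space X : clear implicits.
Arguments operator X : clear implicits.

Definition Cexp (z : C) : C := (exp (Re z) * cos (Im z), exp (Re z) * sin (Im z)).

(* Euler's integral; only used at positive arguments. *)
Definition Gamma (s : R) : R :=
  RInt_gen (fun u => Rpower u (s - 1) * exp (- u))
           (at_right 0) (Rbar_locally p_infty).

Fixpoint pochhammer (a : C) (n : nat) : C :=
  match n with
  | O => RtoC 1
  | S n' => (pochhammer a n' * (a + RtoC (INR n')))%C
  end.

Definition hyp2F1_coeff (a b c : C) (n : nat) : C :=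
  (pochhammer a n * pochhammer b n / (pochhammer c n * RtoC (INR (fact n))))%C.

Definition analytic_at (F : C -> C) (z0 : C) : Prop :=
  exists (p : nat -> C) (r : R), 0 < r /\
    forall z : C, Cmod (z - z0) < r ->
      is_pseries (K := C_AbsRing) (V := C_NormedModule) p (z - z0)%C (F z).

(* [F] is analytic on [C \ [1,oo)] and is the sum of the Gauss series on the
   open unit disc.  Since [C \ [1,oo)] is connected this determines [F] there. *)
Definition is_hyp2F1 (a b c : C) (F : C -> C) : Prop :=
  (forall z : C, ~ (Im z = 0 /\ 1 <= Re z) -> analytic_at F z) /\
  (forall z : C, Cmod z < 1 ->
     is_pseries (K := C_AbsRing) (V := C_NormedModule)
       (hyp2F1_coeff a b c) z (F z)).

(* The values on the cut [[1,oo)] are unspecified. *)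
Definition hyp2F1 (a b c : C) : C -> C :=
  epsilon (inhabits (fun _ => RtoC 0)) (is_hyp2F1 a b c).

Section Approximation.
Context {X : CompleteNormedModule C_AbsRing}.
Variables (A : operator X) (m : nat) (h delta t : R).

Definition node (k : Z) : C := (RtoC delta + Ci * RtoC h * RtoC (IZR k))%C.

Definition weight (k : Z) : C :=
  (Cexp (node k * RtoC t) / (RtoC delta - Ci * RtoC h * RtoC (IZR k)) ^ m)%C.

Definition bracket_term (y : X) (k : Z) : X :=
  scal (weight k) (resolvent A (node k) y).

Definition bracket_N (N : nat) (y : X) : X :=
  scal (RtoC (h / (2 * PI))) (zsum (bracket_term y) N).

Definition bracket (y : X) : X :=
  scal (RtoC (h / (2 * PI))) (zseries (bracket_term y)).

(* [(2 delta - A)^m]. *)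
Definition reg_op : operator X := op_pow (scalar_minus (RtoC (2 * delta)) A) m.

Definition S_h (x : X) : X := bracket (reg_op x).

Definition S_hN (N : nat) (x : X) : X := bracket_N N (reg_op x).

Variable K : R -> X -> X.

Definition error_hN (N : nat) (x : X) : X :=
  minus (K t x) (reg_op (bracket_N N x)).

Definition E_D (x : X) : R := norm (minus (K t x) (S_h x)).

Definition E_T (N : nat) (x : X) : R := norm (minus (S_h x) (S_hN N x)).

End Approximation.

(* Main.v *)
Require Import Defs.
From Stdlib Require Import Reals ZArith Lra Lia ssreflect ClassicalEpsilon.
From Coquelicot Require Import Coquelicot.

Open Scope R_scope.

(** Write [y = (2 delta - A)^m x], [L = 2 pi / h] and [sigma = s - t]. The
    trapezoidal sum is evaluated exactly in the time domain; no contour is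
    moved.

    The resolvent is the Laplace transform of the semigroup
    ([resolvent_laplace]), so a truncated sum is the integral over [s >= 0] of
    [K s y] against [e^(- delta sigma) P_N(sigma)], where [P_N] is the
    symmetric partial sum of the Fourier series with coefficients
    [1 / (L (delta + i h k)^m)] ([bracket_N_integral]). On the other hand
    [K t x] is the integral of [K s y] against [e^(- delta sigma) g(sigma)],
    where [g v = v^(m-1) e^(- delta v) / (m-1)!] for [v > 0] and [g v = 0]
    otherwise: this is Taylor's formula at infinity along the orbit
    ([taylor_at_infinity], [semigroup_representation]).

    The Fourier transform of [g] at [w] is [1 / (delta + i w)^m]
    ([gamma_kernel_fourier]), so by Poisson summation [P_N(sigma)] tends to
    the sum of [g(sigma + r L)] over all integers [r], and the discretization
    error consists of the terms with [r <> 0]. Only an inequality is needed, for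
    which the convergence of the Fejer means of continuous functions suffices
    ([fejer_mean_limit]). Replacing [v^(m-1) e^(- c v)] by
    its maximum, with [c = delta / 2] for [r > 0] and [c = 3 delta / 2] for
    [r < 0], leaves geometric series of ratio [e^(- delta pi / h)]
    ([periodization_bound], [aliasing]). The quotient of gamma values in the
    claimed constant is [pi / 2] times a Wallis product ([Gamma_ratio]), and
    the maxima are smaller than that by an elementary Stirling estimate
    ([alias_constant]).

    The truncation error is at most the sum of the norms of the dropped terms.
    Since the resolvent at [z] has norm at most [M / Re z], that sum is compared
    with the integral of [(1 + u^2)^(- m/2)] over [u >= h N / delta]
    ([decay_tail]). The integral over [u >= 0] is the quotient of gamma values
    ([atan_int_limit]), and the integral over [0 <= u <= X] is
    [X] times [2F1(1/2, m/2; 3/2; - X^2)] by Euler's formula ([hyp2F1_value]).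
    The last step uses that Euler's integral is analytic off the cut
    ([hyp_integral_expansion]) and that two continuations of Gauss's series
    agree on the negative axis ([identity_principle]). *)

(** * Preliminaries on real functions *)

Local Notation RN := R_NormedModule.
Local Notation RC := R_CompleteNormedModule.

Lemma continuous_of_derive (f : R -> R) (x : R) : ex_derive f x -> continuous f x.
Proof. apply (ex_derive_continuous (V := RN)). Qed.

Ltac continuous_by_derive := apply continuous_of_derive; auto_derive; trivial.

Lemma continuity_pt_of_derive (f : R -> R) (x : R) : ex_derive f x -> continuity_pt f x.
Proof. intros H; apply continuity_pt_filterlim, (continuous_of_derive f x H). Qed.

Lemma continuous_translate (c : R) (phi : R -> R) : (forall x, continuous phi x) ->
  forall x, continuous (fun u => phi (c + u)) x.
Proof.
intros H x; apply (continuous_comp (fun u => c + u) phi); [ continuous_by_derive | apply H ].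
Qed.

Lemma ex_RInt_continuous_R (f : R -> R) (a b : R) : (forall x, continuous f x) -> ex_RInt f a b.
Proof. intros H; apply (ex_RInt_continuous (V := RC)); auto. Qed.

(** * Real scalars on a complex Banach space *)

Section RealScalars.
Variable X : CompleteNormedModule C_AbsRing.

Definition rscal (r : R) (x : X) : X := scal (RtoC r) x.

Lemma rscal_assoc (a b : R) (u : X) : rscal a (rscal b u) = rscal (mult a b) u.
Proof.
unfold rscal; rewrite scal_assoc; f_equal.
symmetry; apply (RtoC_mult a b).
Qed.

Lemma rscal_one (u : X) : rscal one u = u.
Proof. apply (scal_one u). Qed.

Lemma rscal_distr_l (a : R) (u v : X) :
  rscal a (plus u v) = plus (rscal a u) (rscal a v).
Proof. exact (@scal_distr_l C_Ring X (RtoC a) u v). Qed.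

Lemma rscal_distr_r (a b : R) (u : X) :
  rscal (plus a b) u = plus (rscal a u) (rscal b u).
Proof.
unfold rscal; change (RtoC (plus a b)) with (RtoC (a + b)).
rewrite RtoC_plus; exact (@scal_distr_r C_Ring X (RtoC a) (RtoC b) u).
Qed.

Lemma norm_rscal (a : R) (u : X) : norm (rscal a u) <= Rabs a * norm u.
Proof.
unfold rscal; rewrite <- Cmod_R. exact (@norm_scal C_AbsRing X (RtoC a) u).
Qed.

Definition real_module : ModuleSpace R_Ring :=
  ModuleSpace.Pack R_Ring X
    (ModuleSpace.Class R_Ring X (AbelianGroup.class X)
       (ModuleSpace.Mixin R_Ring X rscal
          rscal_assoc rscal_one rscal_distr_l rscal_distr_r)) X.

Definition real_normed_aux : NormedModuleAux R_AbsRing :=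
  NormedModuleAux.Pack R_AbsRing X
    (NormedModuleAux.Class R_AbsRing X
       (ModuleSpace.class R_Ring real_module) (UniformSpace.class X)) X.

Definition real_normed_mixin : NormedModule.mixin_of R_AbsRing real_normed_aux :=
  NormedModule.Mixin R_AbsRing real_normed_aux
    (@norm C_AbsRing X) (@norm_factor C_AbsRing X)
    (@norm_triangle C_AbsRing X) norm_rscal
    (@norm_compat1 C_AbsRing X) (@norm_compat2 C_AbsRing X)
    (@norm_eq_zero C_AbsRing X).

(** Integrals and derivatives of the orbits [s |-> K s x] are taken in this
    real module. Addition, norm and topology are those of [X] itself, so a
    statement about one structure is convertible to the same statement about
    the other. *)
Definition real_space : CompleteNormedModule R_AbsRing :=
  CompleteNormedModule.Pack R_AbsRing X
    (CompleteNormedModule.Class R_AbsRing X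
       (NormedModule.Class R_AbsRing X
          (NormedModuleAux.class R_AbsRing real_normed_aux) real_normed_mixin)
       (CompleteNormedModule.mixin C_AbsRing X (CompleteNormedModule.class C_AbsRing X))) X.

End RealScalars.

(** * Integrals over a half-line *)

Lemma minus_plus_l {G : AbelianGroup} (x y : G) : minus (plus x y) x = y.
Proof.
unfold minus; rewrite (plus_comm x) -plus_assoc plus_opp_r. apply plus_zero_r.
Qed.

Definition is_int_from {V : NormedModule R_AbsRing} (a : R) (f : R -> V) (l : V) :=
  is_RInt_gen f (at_point a) (Rbar_locally p_infty) l.

Section HalfLine.
Context {V : CompleteNormedModule R_AbsRing}.
Implicit Types f : R -> V.

Lemma is_int_from_lim (a : R) f (F : R -> V) (l : V) :
  (forall b, a <= b -> is_RInt f a b (F b)) ->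
  filterlim F (Rbar_locally p_infty) (locally l) -> is_int_from a f l.
Proof.
intros HF Hl P HP.
destruct (Hl P HP) as [B HB].
unfold filtermapi.
apply (Filter_prod _ _ _ (fun x => x = a) (fun b => Rmax a B < b)).
- reflexivity.
- now exists (Rmax a B).
- intros x b -> Hb; simpl.
  pose proof (Rmax_l a B); pose proof (Rmax_r a B).
  exists (F b); split; [ apply HF; lra | apply HB; lra ].
Qed.

Lemma is_int_from_RInt (a : R) f (F : R -> V) (l : V) :
  (forall b, a <= b -> is_RInt f a b (F b)) ->
  is_int_from a f l -> filterlim F (Rbar_locally p_infty) (locally l).
Proof.
intros HF Hl P HP.
destruct (Hl P HP) as [Q S HQ [B HB] HQS].
exists (Rmax a B); intros b Hb.
pose proof (Rmax_l a B); pose proof (Rmax_r a B).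
destruct (HQS a b) as [y [Hy1 Hy2]]; [ exact HQ | apply HB; lra | ].
simpl in Hy1.
assert (E : F b = y).
{ rewrite <- (is_RInt_unique f a b y Hy1).
  symmetry; apply is_RInt_unique, HF; lra. }
now rewrite E.
Qed.

Lemma is_int_from_ext (a : R) f g (l : V) :
  (forall s, a < s -> f s = g s) -> is_int_from a f l -> is_int_from a g l.
Proof.
intros H; apply is_RInt_gen_ext.
apply (Filter_prod _ _ _ (fun x => x = a) (fun b => a < b)).
- reflexivity.
- now exists a.
- intros x b -> Hb s; simpl; rewrite Rmin_left; [ intros [Hs _]; auto | lra ].
Qed.

Lemma is_int_from_norm (a : R) f (g : R -> R) (l : V) (lg : R) :
  (forall s, a <= s -> norm (f s) <= g s) ->
  is_int_from a f l -> is_int_from (V := RN) a g lg -> norm l <= lg.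
Proof.
intros H; apply RInt_gen_norm.
- apply (Filter_prod _ _ _ (fun x => x = a) (fun b => a < b)).
  + reflexivity.
  + now exists a.
  + intros x b -> Hb; simpl; lra.
- apply (Filter_prod _ _ _ (fun x => x = a) (fun b => a < b)).
  + reflexivity.
  + now exists a.
  + intros x b -> Hb s [Hs _]; apply H; exact Hs.
Qed.

Lemma is_int_from_plus (a : R) f g (l1 l2 : V) :
  is_int_from a f l1 -> is_int_from a g l2 -> is_int_from a (fun s => plus (f s) (g s)) (plus l1 l2).
Proof. apply (is_RInt_gen_plus (V := V)). Qed.

Lemma is_int_from_scal (a k : R) f (l : V) :
  is_int_from a f l -> is_int_from a (fun s => scal k (f s)) (scal k l).
Proof. apply (is_RInt_gen_scal (V := V)). Qed.

End HalfLine.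

Lemma is_lim_exp_decay (c C : R) : 0 < c -> is_lim (fun s => C * exp (- c * s)) p_infty 0.
Proof.
intros Hc.
replace (Finite 0) with (Rbar_mult (Finite C) (Finite 0)) by (simpl; f_equal; ring).
apply is_lim_scal_l.
apply (is_lim_comp exp (fun b => - c * b) p_infty 0 m_infty).
- apply is_lim_exp_m.
- replace m_infty with (Rbar_mult (Finite (- c)) p_infty).
  2:{ simpl; destruct (Rle_dec 0 (- c)) as [H|H]; [ exfalso; lra | reflexivity ]. }
  apply is_lim_scal_l, is_lim_id.
- exists 0; intros; discriminate.
Qed.

Lemma is_int_from_exp (a c : R) :
  0 < c -> is_int_from (V := RN) a (fun s => exp (- c * s)) (exp (- c * a) / c).
Proof.
intros Hc.
apply (is_int_from_lim (V := RC) a _ (fun b => - exp (- c * b) / c - (- exp (- c * a) / c))).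
- intros b Hb.
  apply (is_RInt_derive (V := RC) (fun s => - exp (- c * s) / c)).
  + intros s _; auto_derive; [ trivial | field; lra ].
  + intros s _; continuous_by_derive.
- replace (exp (- c * a) / c) with (0 - (- exp (- c * a) / c)) by (field; lra).
  apply (is_lim_minus' (fun b => - exp (- c * b) / c) (fun _ => - exp (- c * a) / c) p_infty 0).
  + apply (is_lim_ext (fun b => - / c * exp (- c * b))).
    { intros b; field; lra. }
    apply is_lim_exp_decay, Hc.
  + apply is_lim_const.
Qed.

(** Cauchy's criterion: the tails are dominated by those of the exponential. *)
Lemma ex_int_from_exp_bound {V : CompleteNormedModule R_AbsRing} (a c C : R) (f : R -> V) :
  0 < c -> (forall s, continuous f s) ->
  (forall s, a <= s -> norm (f s) <= C * exp (- c * s)) ->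
  exists l, is_int_from a f l /\ norm l <= C * exp (- c * a) / c.
Proof.
intros Hc Hf HC.
assert (HR : forall u v, is_RInt f u v (RInt f u v)).
{ intros u v; apply (RInt_correct f), ex_RInt_continuous; auto. }
set (G := fun b => C * exp (- c * a) / c - C * exp (- c * b) / c).
assert (HE : is_int_from (V := RN) a (fun s => C * exp (- c * s)) (C * exp (- c * a) / c)).
{ replace (C * exp (- c * a) / c) with (scal C (exp (- c * a) / c))
    by (unfold scal; simpl; unfold mult; simpl; field; lra).
  apply (is_int_from_scal (V := RC)), is_int_from_exp, Hc. }
assert (HGR : forall u v, is_RInt (V := RN) (fun s => C * exp (- c * s)) u v (G v - G u)).
{ intros u v.
  apply (is_RInt_derive (V := RC) G); unfold G.
  - intros s _; auto_derive; [ trivial | field; lra ].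
  - intros s _; continuous_by_derive. }
assert (HG : filterlim G (Rbar_locally p_infty) (locally (C * exp (- c * a) / c))).
{ apply (is_int_from_RInt (V := RC) a (fun s => C * exp (- c * s))); [ | exact HE ].
  intros b _. replace (G b) with (G b - G a) by (unfold G; ring). apply HGR. }
assert (Hex : exists l, filterlim (fun b => RInt f a b) (Rbar_locally p_infty) (locally l)).
{ apply (filterlim_locally_cauchy (U := V)). intros eps.
  assert (HG' := proj2 (filterlim_locally_cauchy (F := Rbar_locally p_infty) (U := R_CompleteSpace) G) (ex_intro (fun y : R => filterlim G (Rbar_locally p_infty) (locally y)) _ HG)).
  destruct (HG' eps) as [P [[B HB] HP]].
  exists (fun b => Rmax a B < b); split.
  { exists (Rmax a B); auto. }
  pose proof (Rmax_l a B); pose proof (Rmax_r a B).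
  assert (W : forall u v, Rmax a B < u -> Rmax a B < v -> u <= v -> norm (minus (RInt f a v) (RInt f a u)) < eps).
  { intros u v Hu Hv Huv.
    apply Rle_lt_trans with (G v - G u).
    - replace (minus (RInt f a v) (RInt f a u)) with (RInt f u v).
      + apply (norm_RInt_le f (fun s => C * exp (- c * s)) u v); auto.
        intros s Hs; apply HC; lra.
      + rewrite -(RInt_Chasles f a u v); [ | eexists; apply HR | eexists; apply HR ].
        symmetry; apply (minus_plus_l (G := V)).
    - apply Rle_lt_trans with (Rabs (G v - G u)); [ apply Rle_abs | ].
      apply (HP u v); apply HB; lra. }
  intros u v Hu Hv.
  apply (norm_compat1 (V := V)).
  destruct (Rle_dec u v) as [Huv|Huv].
  - apply W; auto.
  - rewrite -norm_opp opp_minus. apply W; auto; lra. }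
destruct Hex as [l Hl].
assert (Hi : is_int_from a f l) by (apply (is_int_from_lim a f (fun b => RInt f a b)); auto).
exists l; split; [ exact Hi | ].
apply (is_int_from_norm a f (fun s => C * exp (- c * s))); auto.
Qed.

Lemma is_RInt_linear {V W : NormedModule R_AbsRing} (T : V -> W) (f : R -> V) (a b : R) (l : V) :
  is_linear T -> is_RInt f a b l -> is_RInt (fun s => T (f s)) a b (T l).
Proof.
intros HT Hf.
unfold is_RInt.
apply (filterlim_ext (fun ptd => T (scal (sign (b - a)) (Riemann_sum f ptd)))).
- intros ptd; rewrite (linear_scal T HT); f_equal.
  pattern ptd; apply SF_cons_ind; clear ptd.
  + intros x0; unfold Riemann_sum; simpl. apply (linear_zero T HT).
  + intros h s IH. rewrite 2!Riemann_sum_cons (linear_plus T HT) (linear_scal T HT) IH. reflexivity.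
- apply (filterlim_comp _ _ _ _ T _ _ _ Hf). apply (linear_cont T l HT).
Qed.

Lemma is_int_from_linear {V W : NormedModule R_AbsRing} (T : V -> W) (a : R) (f : R -> V) (l : V) :
  is_linear T -> is_int_from a f l -> is_int_from a (fun s => T (f s)) (T l).
Proof.
intros HT Hf P HP.
destruct (Hf _ (linear_cont T l HT P HP)) as [Q S HQ HS HQS].
apply (Filter_prod _ _ _ Q S HQ HS).
intros x y Hx Hy. destruct (HQS x y Hx Hy) as [z [Hz1 Hz2]].
exists (T z); split; [ now apply is_RInt_linear | exact Hz2 ].
Qed.

(** Only continuity is asked at the left endpoint: an orbit of a semigroup
    has a two-sided derivative at positive times only. *)
Lemma is_RInt_derive_open {V : CompleteNormedModule R_AbsRing} (F f : R -> V) (a b : R) :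
  a <= b -> (forall s, continuous f s) -> continuous F a ->
  (forall s, a < s -> is_derive F s (f s)) -> is_RInt f a b (minus (F b) (F a)).
Proof.
intros Hab Hf HF HD.
assert (HR : forall u v, is_RInt f u v (RInt f u v)).
{ intros u v; apply (RInt_correct f), ex_RInt_continuous; auto. }
destruct (Rle_lt_or_eq_dec a b Hab) as [Hab'|<-].
2:{ unfold minus; rewrite plus_opp_r; exact (is_RInt_point (V := V) f a). }
replace (minus (F b) (F a)) with (RInt f a b); [ apply HR | ].
assert (H1 : forall e, a < e < b -> RInt f e b = minus (F b) (F e)).
{ intros e He. apply is_RInt_unique, is_RInt_derive; auto.
  intros s; rewrite Rmin_left; [ intros; apply HD; lra | lra ]. }
assert (L1 : filterlim (fun e => RInt f e b) (at_right a) (locally (RInt f a b))).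
{ apply (filterlim_filter_le_1 (F := locally a)); [ apply filter_le_within | ].
  apply (continuous_RInt_2 f a b). exists (mkposreal 1 Rlt_0_1); intros z _; apply HR. }
assert (L2 : filterlim (fun e => minus (F b) (F e)) (at_right a) (locally (minus (F b) (F a)))).
{ apply (filterlim_filter_le_1 (F := locally a)); [ apply filter_le_within | ].
  apply (continuous_minus (fun _ => F b) F a); [ apply continuous_const | exact HF ]. }
apply (filterlim_locally_unique (F := at_right a) (fun e => RInt f e b)); [ exact L1 | ].
apply filterlim_ext_loc with (2 := L2).
exists (mkposreal (b - a) ltac:(lra)); intros e He Hae.
symmetry; apply H1; split; [ exact Hae | ].
apply Rabs_lt_between' in He; simpl in He; lra.
Qed.

(** * Taylor's formula at infinity *)

Lemma pow_div_fact_le_exp (x : R) (n : nat) : 0 <= x -> x ^ n / INR (fact n) <= exp x.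
Proof.
intros Hx.
pose proof (exp_ge_taylor x n Hx) as H.
refine (Rle_trans _ _ _ _ H).
destruct n as [|n]; [ simpl; lra | rewrite tech5 ].
assert (0 <= sum_f_R0 (fun k => x ^ k / INR (fact k)) n); [ | lra ].
apply cond_pos_sum; intros k.
apply Rmult_le_pos; [ now apply pow_le | ].
apply Rlt_le, Rinv_0_lt_compat, INR_fact_lt_0.
Qed.

(** Half of the decay absorbs the power: [(c v / 2)^n / n! <= e^(c v / 2)]. *)
Lemma pow_div_fact_exp_le (c v : R) (n : nat) :
  0 < c -> 0 <= v -> v ^ n / INR (fact n) * exp (- c * v) <= (2 / c) ^ n * exp (- (c / 2) * v).
Proof.
intros Hc Hv.
pose proof (pow_div_fact_le_exp (c / 2 * v) n ltac:(nra)) as H.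
replace (exp (- c * v)) with (exp (- (c / 2) * v) * / exp (c / 2 * v)).
2:{ rewrite -exp_Ropp -exp_plus; f_equal; field. }
assert (Hp : 0 < exp (c / 2 * v)) by apply exp_pos.
assert (Hq : 0 < exp (- (c / 2) * v)) by apply exp_pos.
replace (v ^ n) with ((2 / c) ^ n * (c / 2 * v) ^ n).
2:{ rewrite -Rpow_mult_distr; f_equal; field; lra. }
assert (H2 : 0 < (2 / c) ^ n) by (apply pow_lt, Rdiv_lt_0_compat; lra).
replace (_ / _ * _) with ((2 / c) ^ n * exp (- (c / 2) * v) * ((c / 2 * v) ^ n / INR (fact n) * / exp (c / 2 * v))).
2:{ field; split; [ lra | apply INR_fact_neq_0 ]. }
rewrite -{2}(Rmult_1_r ((2 / c) ^ n * exp (- (c / 2) * v))).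
apply Rmult_le_compat_l; [ nra | ].
apply (Rmult_le_reg_r _ _ _ Hp). rewrite Rmult_assoc Rinv_l; lra.
Qed.

Lemma filterlim_zero_le {V : NormedModule R_AbsRing} (f : R -> V) (g : R -> R) (a : R) :
  (forall s, a <= s -> norm (f s) <= g s) -> is_lim g p_infty 0 ->
  filterlim f (Rbar_locally p_infty) (locally (zero : V)).
Proof.
intros H Hg.
apply filterlim_norm_zero.
apply (is_lim_le_le_loc (fun _ => 0) g (fun s => norm (f s)) p_infty 0).
- exists a; intros s Hs; split; [ apply norm_ge_0 | apply H; lra ].
- apply is_lim_const.
- exact Hg.
Qed.

Lemma is_derive_scal_fct {V : NormedModule R_AbsRing} (w : R -> R) (u : R -> V) (s dw : R) (du : V) :
  is_derive w s dw -> is_derive u s du ->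
  is_derive (fun r => scal (w r) (u r)) s (plus (scal dw (u s)) (scal (w s) du)).
Proof.
intros Hw Hu.
refine (filterdiff_ext_lin _ _ _ (filterdiff_scal_fct s w u _ _ _ Hw Hu) _).
- intros; apply Rmult_comm.
- intros y; simpl. rewrite scal_distr_l !scal_assoc. f_equal. f_equal. unfold mult; simpl; ring.
Qed.

(** Repeated integration by parts. The boundary terms vanish at [a] because
    of the power of [s - a], and at infinity because of the exponential decay.
    With [u j s = e^(- 2 delta (s - t)) K s ((2 delta - A)^j x)] it recovers
    [K t x] from [(2 delta - A)^m x]; with a damped oscillation it computes a
    Fourier transform. *)
Lemma taylor_at_infinity {V : CompleteNormedModule R_AbsRing} (m : nat) (u : nat -> R -> V) (a c C : R) :
  0 < c ->
  (forall j s, (j <= S m)%nat -> continuous (u j) s) ->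
  (forall j s, (j <= m)%nat -> a < s -> is_derive (u j) s (opp (u (S j) s))) ->
  (forall j s, (j <= S m)%nat -> a <= s -> norm (u j s) <= C * exp (- c * s)) ->
  is_int_from a (fun s => scal ((s - a) ^ m / INR (fact m)) (u (S m) s)) (u O a).
Proof.
intros Hc.
assert (Hlim : forall n v, (forall s, a <= s -> norm (v s) <= C * exp (- c * s)) ->
  filterlim (fun s => opp (scal ((s - a) ^ n / INR (fact n)) (v s)) : V)
    (Rbar_locally p_infty) (locally (zero : V))).
{ intros n v Hv.
  refine (filterlim_zero_le (V := V) _ (fun s => (C * exp (- c * a) * (2 / c) ^ n * exp (c / 2 * a)) * exp (- (c / 2) * s)) a _ _).
  2:{ apply is_lim_exp_decay; lra. }
  intros s Hs; rewrite norm_opp.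
  refine (Rle_trans _ _ _ (norm_scal _ _) _).
  assert (Hw : 0 <= (s - a) ^ n / INR (fact n)).
  { apply Rmult_le_pos; [ apply pow_le; lra | apply Rlt_le, Rinv_0_lt_compat, INR_fact_lt_0 ]. }
  unfold abs; simpl; rewrite Rabs_pos_eq; [ | exact Hw ].
  assert (HC0 : 0 <= C).
  { pose proof (norm_ge_0 (v a)); pose proof (Hv a (Rle_refl a)); pose proof (exp_pos (- c * a)); nra. }
  pose proof (pow_div_fact_exp_le c (s - a) n Hc ltac:(lra)) as H.
  apply Rle_trans with (((s - a) ^ n / INR (fact n)) * (C * exp (- c * s))).
  { apply Rmult_le_compat_l; auto. }
  replace (exp (- c * s)) with (exp (- c * (s - a)) * exp (- c * a)) by (rewrite -exp_plus; f_equal; ring).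
  replace (C * exp (- c * a) * (2 / c) ^ n * exp (c / 2 * a) * exp (- (c / 2) * s)) with
    (C * exp (- c * a) * ((2 / c) ^ n * exp (- (c / 2) * (s - a)))).
  2:{ replace (exp (- (c / 2) * (s - a))) with (exp (c / 2 * a) * exp (- (c / 2) * s))
        by (rewrite -exp_plus; f_equal; ring). ring. }
  replace (_ * (C * _)) with (C * exp (- c * a) * ((s - a) ^ n / INR (fact n) * exp (- c * (s - a)))) by ring.
  apply Rmult_le_compat_l; [ | exact H ].
  pose proof (exp_pos (- c * a)); nra. }
induction m as [|m IH]; intros Hcont Hder Hbd.
- apply (is_int_from_ext a (u 1%nat)).
  { intros s _; simpl. unfold Rdiv. rewrite Rinv_1 Rmult_1_l. symmetry; apply (scal_one (u 1%nat s)). }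
  apply (is_int_from_lim a _ (fun b => minus (opp (u O b)) (opp (u O a)))).
  + intros b Hb. apply (is_RInt_derive_open (fun s => opp (u O s)) (u 1%nat)); auto.
    * apply (continuous_opp (u O)); auto.
    * intros s Hs. rewrite -(opp_opp (u 1%nat s)). apply (is_derive_opp (u O)), Hder; auto.
  + assert (E : u O a = minus zero (opp (u O a))).
    { unfold minus; rewrite opp_opp. symmetry; apply plus_zero_l. }
    rewrite {2}E.
    refine (filterlim_comp_2 (H := locally (opp (opp (u O a)))) _ _ plus _ (filterlim_const _) _).
    2: exact (filterlim_plus (V := V) zero (opp (opp (u O a)))).
    refine (filterlim_ext _ _ _ (Hlim O (u O) _)); [ | auto ].
    intros b; simpl; unfold Rdiv; rewrite Rinv_1 Rmult_1_l. f_equal. apply (scal_one (u O b)).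
- set (w := fun s : R => (s - a) ^ S m / INR (fact (S m))).
  set (F := fun b : R => opp (scal (w b) (u (S m) b)) : V).
  set (f := fun s : R => minus (scal (w s) (u (S (S m)) s)) (scal ((s - a) ^ m / INR (fact m)) (u (S m) s)) : V).
  assert (Hpc : forall n s, continuous (fun s : R => (s - a) ^ n / INR (fact n)) s).
  { intros n s; continuous_by_derive. }
  assert (Hw : forall s, is_derive w s ((s - a) ^ m / INR (fact m))).
  { intros s; unfold w. rewrite fact_simpl mult_INR.
    pose proof (INR_fact_neq_0 m) as Hq; revert Hq; generalize (INR (fact m)); intros q Hq.
    assert (Hm : INR (S m) <> 0) by (apply not_0_INR; lia).
    replace ((s - a) ^ m / q) with (INR (S m) * 1 * (s - a) ^ m / (INR (S m) * q)) by (field; auto).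
    auto_derive; [ trivial | ]. change (match m with O => 1 | S _ => INR m + 1 end) with (INR (S m)).
    unfold Rminus, Rdiv; ring. }
  assert (H0 : is_int_from a f zero).
  { apply (is_int_from_lim a f (fun b => minus (F b) (F a))).
    - intros b Hb. apply (is_RInt_derive_open F f); auto.
      + intros s. apply (continuous_minus (V := V)).
        * apply (continuous_scal (V := V)); [ apply Hpc | apply Hcont; lia ].
        * apply (continuous_scal (V := V)); [ apply Hpc | apply Hcont; lia ].
      + apply (continuous_opp (V := V)), (continuous_scal (V := V)); [ apply Hpc | apply Hcont; lia ].
      + intros s Hs.
        replace (f s) with (opp (plus (scal ((s - a) ^ m / INR (fact m)) (u (S m) s)) (scal (w s) (opp (u (S (S m)) s))))).
        * apply (is_derive_opp (V := V)).
          refine (is_derive_scal_fct (V := V) w (u (S m)) s _ _ (Hw s) (Hder _ s _ Hs)); lia.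
        * unfold f, minus. rewrite opp_plus scal_opp_r opp_opp. apply plus_comm.
    - assert (E : F a = zero).
      { unfold F, w. rewrite Rminus_eq_0 pow_i; [ | lia ]. unfold Rdiv; rewrite Rmult_0_l.
        rewrite (scal_zero_l (u (S m) a)). exact (opp_zero (G := V)). }
      rewrite E.
      apply (filterlim_ext F).
      { intros b; unfold minus; rewrite opp_zero plus_zero_r. reflexivity. }
      unfold F, w; apply Hlim; intros; apply Hbd; [ lia | auto ]. }
  assert (IH' : is_int_from a (fun s => scal ((s - a) ^ m / INR (fact m)) (u (S m) s)) (u O a)).
  { apply IH; intros; [ apply Hcont | apply Hder | apply Hbd ]; auto with arith; lia. }
  rewrite -(plus_zero_l (u O a)).
  refine (is_int_from_ext a _ _ _ _ (is_int_from_plus _ _ _ _ _ H0 IH')).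
  intros s _; unfold f, minus. rewrite -plus_assoc plus_opp_l plus_zero_r. reflexivity.
Qed.

(** * Limits in norm and the complex exponential *)

Lemma filterlim_norm_iff {K : AbsRing} {V : NormedModule K} {T : Type}
  {F : (T -> Prop) -> Prop} {FF : Filter F} (f : T -> V) (l : V) :
  filterlim f F (locally l) <->
  forall eps : R, 0 < eps -> F (fun x => norm (minus (f x) l) < eps).
Proof.
split.
- intros H eps Heps.
  assert (Hf := norm_factor_gt_0 (V := V)).
  assert (Hd : 0 < eps / norm_factor (V := V)) by (apply Rdiv_lt_0_compat; auto).
  refine (filter_imp _ _ _ (proj1 (filterlim_locally f l) H (mkposreal _ Hd))).
  intros x Hx. pose proof (norm_compat2 _ _ _ Hx) as H2; simpl in H2.
  replace eps with (norm_factor (V := V) * (eps / norm_factor (V := V))) by (field; lra).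
  exact H2.
- intros H. apply filterlim_locally; intros eps.
  refine (filter_imp _ _ _ (H eps (cond_pos eps))).
  intros x; apply norm_compat1.
Qed.

Lemma is_derive_norm_iff {V : NormedModule R_AbsRing} (f : R -> V) (x : R) (l : V) :
  is_derive f x l <->
  forall eps : R, 0 < eps ->
    locally x (fun y => norm (minus (minus (f y) (f x)) (scal (y - x) l)) <= eps * Rabs (y - x)).
Proof.
split.
- intros [_ H] eps Heps.
  exact (H x (fun P HP => HP) (mkposreal eps Heps)).
- intros H; split; [ apply is_linear_scal_l | ].
  intros x' Hx'. rewrite -(is_filter_lim_locally_unique _ _ Hx').
  intros eps. exact (H eps (cond_pos eps)).
Qed.

Lemma is_derive_right_quotient {V : NormedModule R_AbsRing} (f : R -> V) (x : R) (l : V) :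
  is_derive f x l ->
  filterlim (fun h => scal (/ h) (minus (f (x + h)) (f x))) (at_right 0) (locally l).
Proof.
intros H; apply filterlim_norm_iff; intros eps Heps.
destruct (proj1 (is_derive_norm_iff f x l) H (eps / 2) ltac:(lra)) as [d Hd].
exists d; intros h Hh Hpos.
assert (Hh' : ball x d (x + h)).
{ assert (E : forall k : R, x + k - x = k - 0) by (intros; ring).
  change (Rabs (x + h - x) < d); rewrite E; exact Hh. }
specialize (Hd _ Hh').
assert (E : forall k : R, x + k - x = k) by (intros; ring). rewrite E in Hd.
assert (E2 : minus (scal (/ h) (minus (f (x + h)) (f x))) l
  = scal (/ h) (minus (minus (f (x + h)) (f x)) (scal h l))).
{ symmetry; unfold minus at 1; rewrite scal_distr_l scal_opp_r scal_assoc.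
    replace (mult (/ h) h) with (one : R).
    - rewrite (scal_one l). reflexivity.
    - unfold mult, one; simpl; field; lra. }
rewrite E2.
refine (Rle_lt_trans _ _ _ (norm_scal _ _) _).
unfold abs; simpl; rewrite Rabs_inv.
rewrite Rabs_pos_eq in Hd; [ | lra ]. rewrite Rabs_pos_eq; [ | lra ].
apply Rle_lt_trans with (/ h * (eps / 2 * h)).
- apply Rmult_le_compat_l; [ apply Rlt_le, Rinv_0_lt_compat; lra | exact Hd ].
- field_simplify; lra.
Qed.

Lemma Cmod_Cexp (z : C) : Cmod (Cexp z) = exp (Re z).
Proof.
unfold Cexp, Cmod; simpl fst; simpl snd.
replace ((exp (Re z) * cos (Im z)) ^ 2 + (exp (Re z) * sin (Im z)) ^ 2) with (exp (Re z) ^ 2).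
- rewrite sqrt_pow2; [ reflexivity | apply Rlt_le, exp_pos ].
- pose proof (sin2_cos2 (Im z)) as H; unfold Rsqr in H. nra.
Qed.

Lemma Cexp_plus (z w : C) : Cexp (z + w)%C = (Cexp z * Cexp w)%C.
Proof.
destruct z as [a b], w as [c d]; unfold Cexp, Cplus, Cmult, Re, Im; simpl.
rewrite exp_plus cos_plus sin_plus. f_equal; ring.
Qed.

Lemma Cexp_0 : Cexp 0 = RtoC 1.
Proof. unfold Cexp, RtoC, Re, Im; simpl. rewrite exp_0 cos_0 sin_0. f_equal; ring. Qed.

(** The neighbourhoods for the modulus are those of the product topology, so
    limits in [C] may be taken componentwise. *)
Lemma filterlim_C_components {T : Type} {F : (T -> Prop) -> Prop} {FF : Filter F} (f : T -> C) (l : C) :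
  filterlim (fun x => Re (f x)) F (locally (Re l)) ->
  filterlim (fun x => Im (f x)) F (locally (Im l)) ->
  filterlim f F (locally (T := AbsRing_UniformSpace C_AbsRing) l).
Proof.
intros Hr Hi P HP.
apply locally_C in HP.
destruct HP as [eps HP].
pose proof (proj1 (filterlim_locally (U := R_UniformSpace) _ _) Hr eps) as Hr'.
pose proof (proj1 (filterlim_locally (U := R_UniformSpace) _ _) Hi eps) as Hi'.
refine (filter_imp _ (fun x => P (f x)) _ (filter_and _ _ Hr' Hi')).
intros x [H1 H2]; apply HP; split; assumption.
Qed.

(** * Powers of an unbounded operator *)

Lemma minus_rearrange {G : AbelianGroup} (p v q w : G) :
  plus (opp (minus (minus p v) q)) (minus w q) = minus (minus v p) (opp w).
Proof.
unfold minus; rewrite !opp_plus !opp_opp.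
rewrite (plus_comm (opp p)) -!plus_assoc; do 2 f_equal.
rewrite (plus_comm q) -!plus_assoc plus_opp_l plus_zero_r. reflexivity.
Qed.

Lemma scal_C_assoc {X : NormedModule C_AbsRing} (a b : C) (x : X) :
  scal a (scal b x) = scal (a * b)%C x.
Proof. exact (scal_assoc (V := X) a b x). Qed.

Lemma scal_C_one {X : NormedModule C_AbsRing} (x : X) : scal (RtoC 1) x = x.
Proof. exact (scal_one (V := X) x). Qed.

Section Powers.
Context {X : CompleteNormedModule C_AbsRing}.

Lemma op_pow_dom_le (B : operator X) (n : nat) (x : X) :
  dom (op_pow B (S n)) x -> dom (op_pow B n) x /\ dom B (op_pow B n x).
Proof.
revert x; induction n as [|n IH]; intros x [H1 H2].
- split; [ exact I | exact H1 ].
- destruct (IH _ H2) as [H3 H4]. split; [ split; assumption | exact H4 ].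
Qed.

(** [op_pow] passes [B x] to the remaining powers; splitting off the last
    factor instead is what differentiating an orbit of [B^n x] calls for. *)
Lemma op_pow_succ_out (B : operator X) (n : nat) (x : X) :
  op_pow B (S n) x = B (op_pow B n x).
Proof.
revert x; induction n as [|n IH]; intros x; [ reflexivity | ].
exact (IH (B x)).
Qed.

Lemma op_pow_dom_mono (B : operator X) (n j : nat) (x : X) :
  (j <= n)%nat -> dom (op_pow B n) x -> dom (op_pow B j) x.
Proof.
intros H; induction H as [|n H IH]; auto.
intros Hx; apply IH, op_pow_dom_le, Hx.
Qed.

Lemma scal_C_opp_one (x : X) : scal (RtoC (-1)) x = opp x.
Proof.
replace (RtoC (-1)) with (opp (RtoC 1)) by (change (Copp (RtoC 1) = RtoC (-1)); rewrite -RtoC_opp; f_equal; ring).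
exact (scal_opp_one (V := X) x).
Qed.

Lemma linear_operator_zero (P : operator X) : linear_operator P -> P zero = zero.
Proof.
intros [H0 H]. destruct (H (RtoC (-1)) zero zero H0 H0) as [_ E].
rewrite (scal_zero_r (V := X)) plus_zero_r scal_C_opp_one plus_opp_l in E. exact E.
Qed.

Lemma linear_operator_scalar_minus (A : operator X) (z : C) :
  linear_operator A -> linear_operator (scalar_minus z A).
Proof.
intros [H0 H]; split; [ exact H0 | ].
intros c x y Hx Hy. destruct (H c x y Hx Hy) as [H1 H2]. split; [ exact H1 | ].
simpl; rewrite H2.
rewrite (scal_distr_l (V := X)) (scal_minus_distr_l (V := X)) !scal_C_assoc (Cmult_comm z c).
unfold minus; rewrite opp_plus -!plus_assoc; f_equal.
rewrite !plus_assoc; f_equal. apply plus_comm.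
Qed.

Lemma linear_operator_pow (A : operator X) (n : nat) :
  linear_operator A -> linear_operator (op_pow A n).
Proof.
intros HA; induction n as [|n [IH0 IH]].
- split; [ exact I | ]; intros; split; [ exact I | reflexivity ].
- pose proof (linear_operator_zero A HA) as Z.
  split.
  + split; [ apply HA | ]. simpl. rewrite Z; exact IH0.
  + intros c x y [Hx1 Hx2] [Hy1 Hy2].
    destruct (proj2 HA c x y Hx1 Hy1) as [H1 H2].
    destruct (IH c (A x) (A y) Hx2 Hy2) as [H3 H4].
    simpl; rewrite H2. split; [ split; assumption | exact H4 ].
Qed.

(** [D(A^(n+1))] is contained in [D(A^n)], so [z x - A x] lies in [D(A^n)]. *)
Lemma op_pow_scalar_minus_dom (A : operator X) (z : C) (n : nat) (x : X) :
  linear_operator A -> dom (op_pow A n) x -> dom (op_pow (scalar_minus z A) n) x.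
Proof.
intros HA; revert x; induction n as [|n IH]; intros x Hx; [ exact I | ].
destruct (op_pow_dom_le A n x Hx) as [Hn _]. destruct Hx as [Hx1 Hx2].
split; [ exact Hx1 | ]. apply IH. simpl.
replace (minus (scal z x) (A x)) with (plus (scal (RtoC (-1)) (A x)) (scal z x)).
- destruct (linear_operator_pow A n HA) as [P0 P].
  apply P; [ exact Hx2 | ].
  replace (scal z x) with (plus (scal z x) zero) by apply plus_zero_r.
  apply P; auto.
- rewrite plus_comm; unfold minus; f_equal.
  apply scal_C_opp_one.
Qed.

Lemma linear_operator_scal (P : operator X) (c : C) (x : X) : linear_operator P -> dom P x ->
  dom P (scal c x) /\ P (scal c x) = scal c (P x).
Proof.
intros HP Hx.
pose proof (linear_operator_zero P HP) as Z.
destruct (proj2 HP c x zero Hx (proj1 HP)) as [H1 H2].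
rewrite Z !plus_zero_r in H1 H2. auto.
Qed.

Lemma linear_operator_sum_n (P : operator X) (f : nat -> X) (n : nat) : linear_operator P ->
  (forall j, dom P (f j)) ->
  dom P (sum_n f n) /\ P (sum_n f n) = sum_n (fun j => P (f j)) n.
Proof.
intros HP Hf; induction n as [|n [IH1 IH2]].
- rewrite !sum_O; auto.
- rewrite !sum_Sn.
  destruct (proj2 HP (RtoC 1) (sum_n f n) (f (S n)) IH1 (Hf _)) as [H1 H2].
  rewrite !scal_C_one IH2 in H1 H2. auto.
Qed.

End Powers.

(** * The resolvent as Laplace transform of the semigroup *)

Section Semigroup.
Context {X : CompleteNormedModule C_AbsRing}.
Context (A : operator X) (HAlin : linear_operator A).
Context (K : R -> X -> X) (HA : generates A K).
Context (M : R) (HM : 1 <= M).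
Context (HK : forall s : R, 0 <= s -> Rbar_le (op_norm (K s)) (Finite M)).

Notation XR := (real_space X).

Lemma semigroup_linear (s : R) : 0 <= s -> is_linear (K s).
Proof. apply (proj1 (proj1 HA)). Qed.

Lemma semigroup_0 (x : X) : K 0 x = x.
Proof. apply (proj1 (proj2 (proj1 HA))). Qed.

Lemma semigroup_plus (s t : R) (x : X) : 0 <= s -> 0 <= t -> K (s + t) x = K s (K t x).
Proof. apply (proj1 (proj2 (proj2 (proj1 HA)))). Qed.

Lemma semigroup_comm (s t : R) (x : X) : 0 <= s -> 0 <= t -> K s (K t x) = K t (K s x).
Proof.
intros Hs Ht.
rewrite -(semigroup_plus s t x Hs Ht) -(semigroup_plus t s x Ht Hs) Rplus_comm. reflexivity.
Qed.

(** The operator norm only tests the unit ball, hence the rescaling of [x]. *)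
Lemma semigroup_norm (s : R) (x : X) : 0 <= s -> norm (K s x) <= M * norm x.
Proof.
intros Hs.
destruct (Req_dec (norm x) 0) as [H0|H0].
- apply norm_eq_zero in H0; subst x.
  rewrite (linear_zero _ (semigroup_linear s Hs)) norm_zero; lra.
- assert (Hp : 0 < norm x) by (pose proof (norm_ge_0 x); lra).
  set (c := RtoC (/ norm x)).
  assert (Hc : Cmod c = / norm x).
  { unfold c; rewrite Cmod_R Rabs_pos_eq; [ reflexivity | apply Rlt_le, Rinv_0_lt_compat, Hp ]. }
  assert (H1 : norm (scal c x) <= 1).
  { refine (Rle_trans _ _ _ (norm_scal c x) _). change (abs c) with (Cmod c).
    rewrite Hc Rinv_l; lra. }
  assert (H2 : norm (K s (scal c x)) <= M).
  { pose proof (HK s Hs) as H.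
    pose proof (proj1 (Lub_Rbar_correct (fun r => exists x, norm x <= 1 /\ r = norm (K s x)))
      (norm (K s (scal c x))) (ex_intro _ _ (conj H1 eq_refl))) as H'.
    exact (Rbar_le_trans _ _ _ H' H). }
  assert (E : K s x = scal (RtoC (norm x)) (K s (scal c x))).
  { rewrite (linear_scal _ (semigroup_linear s Hs)) scal_assoc.
    replace (mult (RtoC (norm x)) c) with (one : C).
    - symmetry; apply (scal_one (K s x)).
    - unfold c; change (RtoC 1 = (RtoC (norm x) * RtoC (/ norm x))%C).
      rewrite -RtoC_mult Rinv_r; [ reflexivity | exact H0 ]. }
  rewrite E. refine (Rle_trans _ _ _ (norm_scal _ _) _).
  change (abs (RtoC (norm x))) with (Cmod (RtoC (norm x))).
  rewrite Cmod_R Rabs_pos_eq; [ | lra ]. nra.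
Qed.

Lemma semigroup_right_continuous (x : X) (eps : R) : 0 < eps ->
  exists d, 0 < d /\ forall h, 0 <= h < d -> norm (minus (K h x) x) < eps.
Proof.
intros Heps.
destruct (proj1 (filterlim_norm_iff _ _) (proj2 (proj2 (proj2 (proj1 HA))) x) eps Heps) as [d Hd].
exists d; split; [ apply cond_pos | ].
intros h [Hh0 Hh].
destruct (Rle_lt_or_eq_dec 0 h Hh0) as [Hh1|<-].
- apply Hd; [ | exact Hh1 ].
  change (Rabs (h - 0) < d). rewrite Rminus_0_r Rabs_pos_eq; lra.
- rewrite semigroup_0 /minus plus_opp_r norm_zero. exact Heps.
Qed.

(** [K s x - K r x = K r (K (s - r) x - x)]: an orbit inherits, at every time
    and on both sides, its right continuity at 0. *)
Lemma semigroup_lipschitz (r s : R) (x : X) : 0 <= r -> r <= s ->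
  norm (minus (K s x) (K r x)) <= M * norm (minus (K (s - r) x) x).
Proof.
intros Hr Hrs.
replace (K s x) with (K r (K (s - r) x)).
- rewrite -(linear_minus _ _ _ (semigroup_linear r Hr)). apply semigroup_norm, Hr.
- rewrite -semigroup_plus; [ f_equal; ring | lra | lra ].
Qed.

(** The absolute value continues the orbit to negative times, where [K] is
    arbitrary. *)
Lemma orbit_continuous (x : X) (s : R) : continuous (U := XR) (fun r => K (Rabs r) x) s.
Proof.
apply (filterlim_norm_iff (V := XR)); intros eps Heps.
destruct (semigroup_right_continuous x (eps / M)) as [d [Hd H]].
{ apply Rdiv_lt_0_compat; lra. }
exists (mkposreal d Hd); intros r Hr.
assert (Hr' : Rabs (Rabs r - Rabs s) < d).
{ refine (Rle_lt_trans _ _ _ (Rabs_triang_inv2 r s) Hr). }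
change (norm (minus (K (Rabs r) x) (K (Rabs s) x)) < eps).
assert (W : forall a b, 0 <= a -> a <= b -> b - a < d -> norm (minus (K b x) (K a x)) < eps).
{ intros a b Ha Hab Hd'. apply (Rle_lt_trans _ _ _ (semigroup_lipschitz a b x Ha Hab)).
  replace eps with (M * (eps / M)) by (field; lra).
  apply Rmult_lt_compat_l; [ lra | apply H; lra ]. }
pose proof (Rabs_pos r); pose proof (Rabs_pos s).
destruct (Rle_dec (Rabs s) (Rabs r)) as [Hle|Hle].
- apply W; auto. rewrite Rabs_pos_eq in Hr'; lra.
- rewrite -norm_opp opp_minus. apply W; auto; [ lra | ].
  rewrite Rabs_left in Hr'; lra.
Qed.

Lemma is_linear_real (T : X -> X) : is_linear T -> is_linear (U := XR) (V := XR) T.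
Proof.
intros HT; split.
- exact (linear_plus T HT).
- intros k x; exact (linear_scal T HT (RtoC k) x).
- exact (linear_norm T HT).
Qed.

Lemma is_linear_scal_C (c : C) : is_linear (U := XR) (V := XR) (fun x => @scal C_AbsRing X c x).
Proof.
apply (is_linear_real (fun x => scal c x)).
exact (is_linear_scal_r (K := C_AbsRing) (V := X) c Cmult_comm).
Qed.

Definition laplace_integrand (z : C) (y : X) (s : R) : X := scal (Cexp (- (z * RtoC s))%C) (K (Rabs s) y).

Lemma laplace_integrand_continuous (z : C) (y : X) (s : R) : continuous (U := XR) (laplace_integrand z y) s.
Proof.
unfold laplace_integrand.
apply (continuous_scal (K := C_AbsRing) (V := X)); [ | apply (orbit_continuous y s) ].
destruct z as [a b].
apply filterlim_C_components; unfold Cexp, Re, Im; simpl;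
  match goal with |- filterlim ?f _ _ =>
    apply (ex_derive_continuous (V := RN) f s) end; auto_derive; trivial.
Qed.

Lemma laplace_integrand_norm (z : C) (y : X) (s : R) : 0 <= s ->
  norm (laplace_integrand z y s) <= M * norm y * exp (- Re z * s).
Proof.
intros Hs. unfold laplace_integrand. refine (Rle_trans _ _ _ (norm_scal _ _) _).
change (abs ?c) with (Cmod c). rewrite Cmod_Cexp Rabs_pos_eq; [ | exact Hs ].
replace (Re (- (z * RtoC s))%C) with (- Re z * s) by (destruct z; unfold Re; simpl; ring).
pose proof (semigroup_norm s y Hs); pose proof (exp_pos (- Re z * s)). nra.
Qed.

Definition laplace (z : C) (y : X) : X :=
  RInt_gen (V := XR) (laplace_integrand z y) (at_point 0) (Rbar_locally p_infty).

Lemma laplace_correct (z : C) (y : X) : 0 < Re z ->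
  is_int_from (V := XR) 0 (laplace_integrand z y) (laplace z y) /\
  norm (laplace z y) <= M / Re z * norm y.
Proof.
intros Hz.
destruct (ex_int_from_exp_bound (V := XR) 0 (Re z) (M * norm y) (laplace_integrand z y) Hz) as [l [Hl Hn]].
- apply laplace_integrand_continuous.
- apply laplace_integrand_norm.
- assert (E : laplace z y = l) by exact (is_RInt_gen_unique (V := XR) (laplace_integrand z y) l Hl).
  rewrite E; split; [ exact Hl | ].
  refine (Rle_trans _ _ _ Hn _). rewrite Rmult_0_r exp_0. right; field; lra.
Qed.

Lemma laplace_unique (z : C) (y l : X) :
  is_int_from (V := XR) 0 (laplace_integrand z y) l -> laplace z y = l.
Proof. intros H; exact (is_RInt_gen_unique (V := XR) (laplace_integrand z y) l H). Qed.

Lemma laplace_linear (z : C) : 0 < Re z -> is_linear (laplace z).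
Proof.
intros Hz; split.
- intros x y; apply laplace_unique.
  refine (is_int_from_ext (V := XR) 0 _ _ _ _
    (is_int_from_plus (V := XR) _ _ _ _ _ (proj1 (laplace_correct z x Hz)) (proj1 (laplace_correct z y Hz)))).
  intros s Hs; unfold laplace_integrand. rewrite (linear_plus _ (semigroup_linear _ (Rabs_pos s))).
  symmetry; exact (scal_distr_l (V := X) _ _ _).
- intros k x; apply laplace_unique.
  refine (is_int_from_ext (V := XR) 0 _ _ _ _
    (is_int_from_linear (V := XR) (W := XR) _ _ _ _ (is_linear_scal_C k) (proj1 (laplace_correct z x Hz)))).
  intros s Hs; unfold laplace_integrand. rewrite (linear_scal _ (semigroup_linear _ (Rabs_pos s))) !scal_assoc.
  f_equal. apply Cmult_comm.
- exists (M / Re z); split; [ apply Rdiv_lt_0_compat; lra | ].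
  intros x; apply laplace_correct, Hz.
Qed.

Lemma laplace_comm (z : C) (h : R) (y : X) : 0 < Re z -> 0 <= h ->
  laplace z (K h y) = K h (laplace z y).
Proof.
intros Hz Hh; apply laplace_unique.
refine (is_int_from_ext (V := XR) 0 _ _ _ _
    (is_int_from_linear (V := XR) (W := XR) _ _ _ _ (is_linear_real _ (semigroup_linear h Hh)) (proj1 (laplace_correct z y Hz)))).
intros s Hs; unfold laplace_integrand. rewrite (linear_scal _ (semigroup_linear h Hh)).
f_equal. apply semigroup_comm; [ exact Hh | apply Rabs_pos ].
Qed.

Lemma is_int_from_shift (f : R -> X) (h : R) (l : X) :
  (forall s, continuous (U := XR) f s) -> is_int_from (V := XR) 0 f l ->
  is_int_from (V := XR) 0 (fun s => f (s + h)) (minus l (RInt (V := XR) f 0 h)).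
Proof.
intros Hf Hl.
assert (HR : forall u v, is_RInt (V := XR) f u v (RInt (V := XR) f u v)).
{ intros u v; apply (RInt_correct (V := XR) f), (ex_RInt_continuous (V := XR)); auto. }
apply (is_int_from_lim (V := XR) 0 _ (fun b => minus (RInt (V := XR) f 0 (b + h)) (RInt (V := XR) f 0 h))).
- intros b Hb.
  assert (E : minus (RInt (V := XR) f 0 (b + h)) (RInt (V := XR) f 0 h) = RInt (V := XR) f h (b + h)).
  { rewrite -(RInt_Chasles (V := XR) f 0 h (b + h)); [ | eexists; apply HR | eexists; apply HR ].
    apply (minus_plus_l (G := XR)). }
  rewrite E.
  apply (is_RInt_ext (V := XR) (fun s => scal (V := XR) 1 (f (1 * s + h)))).
  { intros s _. rewrite (scal_one (V := XR) (f (1 * s + h))) Rmult_1_l. reflexivity. }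
  apply (is_RInt_comp_lin (V := XR) f 1 h 0 b).
  replace (1 * 0 + h) with h by ring. rewrite Rmult_1_l. apply HR.
- apply (filterlim_comp_2 (H := locally (T := XR) (opp (RInt (V := XR) f 0 h))) (G := locally (T := XR) l)
    (fun b => RInt (V := XR) f 0 (b + h)) (fun _ => opp (RInt (V := XR) f 0 h)) plus).
  + apply (filterlim_comp _ _ _ (fun b => b + h) (fun b => RInt (V := XR) f 0 b) _ (Rbar_locally p_infty)).
    * intros P [B HB]; exists (B - h); intros x Hx; apply HB; lra.
    * apply (is_int_from_RInt (V := XR) 0 f _ l); auto.
  + apply filterlim_const.
  + apply (filterlim_plus (V := XR)).
Qed.

(** [K h] translates the integrand by [h]: this costs a factor [e^(z h)] and
    the part of the integral below [h]. *)
Lemma laplace_shift (z : C) (h : R) (y : X) : 0 < Re z -> 0 <= h ->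
  K h (laplace z y) =
  scal (Cexp (z * RtoC h)%C) (minus (laplace z y) (RInt (V := XR) (laplace_integrand z y) 0 h)).
Proof.
intros Hz Hh.
rewrite -laplace_comm; auto. apply laplace_unique.
refine (is_int_from_ext (V := XR) 0 _ _ _ _
    (is_int_from_linear (V := XR) (W := XR) _ _ _ _ (is_linear_scal_C (Cexp (z * RtoC h)%C))
      (is_int_from_shift _ h _ (laplace_integrand_continuous z y) (proj1 (laplace_correct z y Hz))))).
intros s Hs; unfold laplace_integrand. rewrite scal_assoc.
change (mult ?a ?b) with (Cmult a b). rewrite -Cexp_plus.
f_equal.
- f_equal. rewrite RtoC_plus. ring.
- rewrite (Rabs_pos_eq s); [ | lra ]. rewrite (Rabs_pos_eq (s + h)); [ | lra ].
  apply semigroup_plus; lra.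
Qed.

Lemma Cexp_right_derivative (z : C) :
  filterlim (fun h : R => (RtoC (/ h) * (Cexp (z * RtoC h) - 1))%C) (at_right 0)
    (locally (T := AbsRing_UniformSpace C_AbsRing) z).
Proof.
destruct z as [a b].
assert (D1 : is_derive (fun s => exp (a * s) * cos (b * s)) 0 a).
{ auto_derive; [ trivial | ]. rewrite !Rmult_0_r exp_0 cos_0 sin_0; ring. }
assert (D2 : is_derive (fun s => exp (a * s) * sin (b * s)) 0 b).
{ auto_derive; [ trivial | ]. rewrite !Rmult_0_r exp_0 cos_0 sin_0; ring. }
apply is_derive_right_quotient in D1. apply is_derive_right_quotient in D2.
apply filterlim_C_components; unfold Re, Im.
- refine (filterlim_ext _ _ _ D1); intros h.
  rewrite Rplus_0_l !Rmult_0_r exp_0 cos_0. unfold scal, minus, plus, opp; simpl; unfold mult; simpl.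
  unfold Cexp, Re, Im; simpl. rewrite !Rmult_0_r.
  replace (a * h - 0) with (a * h) by ring. rewrite Rplus_0_l. ring.
- refine (filterlim_ext _ _ _ D2); intros h.
  rewrite Rplus_0_l !Rmult_0_r exp_0 sin_0. unfold scal, minus, plus, opp; simpl; unfold mult; simpl.
  unfold Cexp, Re, Im; simpl. rewrite !Rmult_0_r.
  replace (a * h - 0) with (a * h) by ring. rewrite Rplus_0_l. ring.
Qed.

Lemma Cexp_right_continuous (z : C) :
  filterlim (fun h : R => Cexp (z * RtoC h)) (at_right 0)
    (locally (T := AbsRing_UniformSpace C_AbsRing) (RtoC 1)).
Proof.
apply (filterlim_filter_le_1 (F := locally 0)); [ apply filter_le_within | ].
assert (W : forall f : R -> R, ex_derive f 0 -> forall v, f 0 = v -> filterlim f (locally 0) (locally v)).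
{ intros f Hf v <-. exact (ex_derive_continuous (V := RN) f 0 Hf). }
destruct z as [a b].
apply filterlim_C_components; unfold Cexp, Re, Im; simpl; apply W.
- auto_derive; trivial.
- rewrite !Rmult_0_r Rplus_0_l Rminus_0_r exp_0 cos_0; ring.
- auto_derive; trivial.
- rewrite !Rmult_0_r Rplus_0_l Rminus_0_r exp_0 sin_0; ring.
Qed.

(** By [laplace_shift] the difference quotient of the semigroup at
    [laplace z y] is [(e^(z h) - 1) / h] times [laplace z y], minus [e^(z h)]
    times the mean of the integrand over [0 <= s <= h], and that mean tends to
    [y]. *)
Lemma laplace_generator (z : C) (y : X) : 0 < Re z ->
  dom A (laplace z y) /\ A (laplace z y) = minus (scal z (laplace z y)) y.
Proof.
intros Hz. apply (proj2 HA).
set (l := laplace z y).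
set (I := fun h => RInt (V := XR) (laplace_integrand z y) 0 h).
assert (HI : filterlim (fun h => scal (RtoC (/ h)) (I h)) (at_right 0) (locally y)).
{ assert (D : is_derive (V := XR) I 0 (laplace_integrand z y 0)).
  { apply (is_derive_RInt (V := XR) (laplace_integrand z y) I 0 0).
    - exists (mkposreal 1 Rlt_0_1); intros b _.
      apply (RInt_correct (V := XR)), (ex_RInt_continuous (V := XR)); intros; apply laplace_integrand_continuous.
    - apply laplace_integrand_continuous. }
  apply is_derive_right_quotient in D.
  assert (E : laplace_integrand z y 0 = y).
  { unfold laplace_integrand. rewrite Rabs_R0 semigroup_0.
    replace (- (z * RtoC 0))%C with (RtoC 0) by ring. rewrite Cexp_0. apply (scal_one (V := X) y). }
  rewrite E in D. refine (filterlim_ext _ _ _ D); intros h.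
  unfold I at 2. rewrite (RInt_point (V := XR)). rewrite Rplus_0_l.
  unfold minus; rewrite opp_zero plus_zero_r. reflexivity. }
apply (filterlim_ext_loc
  (fun h => minus (scal (RtoC (/ h) * (Cexp (z * RtoC h) - 1))%C l)
     (scal (Cexp (z * RtoC h)%C) (scal (RtoC (/ h)) (I h))))).
{ exists (mkposreal 1 Rlt_0_1); intros h _ Hh.
  unfold l; rewrite laplace_shift; [ fold l | exact Hz | lra ].
  change (RInt (V := XR) (laplace_integrand z y) 0 h) with (I h).
  change ((RtoC (/ h) * (Cexp (z * RtoC h) - 1))%C) with (mult (RtoC (/ h)) (minus (Cexp (z * RtoC h)%C) one)).
  rewrite -scal_assoc.
  rewrite (scal_assoc (Cexp (z * RtoC h)%C)).
  replace (mult (Cexp (z * RtoC h)%C) (RtoC (/ h))) with (mult (RtoC (/ h)) (Cexp (z * RtoC h)%C)) by apply Cmult_comm.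
  rewrite -scal_assoc.
  rewrite -(scal_minus_distr_l (V := X)). f_equal.
  rewrite (scal_minus_distr_r (V := X)) (scal_minus_distr_l (V := X)) (scal_one (V := X)).
  unfold minus; rewrite -!plus_assoc; f_equal; apply plus_comm. }
replace (minus (scal z l) y) with (minus (scal z l) (scal (one : C) y)) by (rewrite (scal_one (V := X)); reflexivity).
refine (filterlim_comp_2 (G := locally (scal z l)) (H := locally (opp (scal (one : C) y))) _
   (fun h => opp (scal (Cexp (z * RtoC h)%C) (scal (RtoC (/ h)) (I h)))) plus _ _ _).
- refine (filterlim_comp_2 (G := locally (T := AbsRing_UniformSpace C_AbsRing) z) (H := locally l) _ (fun _ => l) scal
    (Cexp_right_derivative z) (filterlim_const _) _).
  apply (filterlim_scal (K := C_AbsRing) (V := X)).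
- apply (filterlim_comp _ _ _ _ opp _ (locally (scal (one : C) y))).
  2: apply (filterlim_opp (V := X)).
  refine (filterlim_comp_2 (G := locally (T := AbsRing_UniformSpace C_AbsRing) (one : C)) (H := locally y) _ _ scal _ HI _).
  2: apply (filterlim_scal (K := C_AbsRing) (V := X)).
  apply Cexp_right_continuous.
- apply (filterlim_plus (V := X)).
Qed.

Lemma generator_quotient (x : X) : dom A x ->
  filterlim (fun h => scal (RtoC (/ h)) (minus (K h x) x)) (at_right 0) (locally (A x)).
Proof. intros Hx; apply (proj2 HA); auto. Qed.

(** [laplace z] is bounded and commutes with the semigroup, hence with the
    difference quotients that define [A]. *)
Lemma laplace_generator_comm (z : C) (x : X) : 0 < Re z -> dom A x ->
  laplace z (A x) = A (laplace z x).
Proof.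
intros Hz Hx.
pose proof (laplace_linear z Hz) as HT.
apply (filterlim_locally_unique (F := at_right 0)
  (fun h => laplace z (scal (RtoC (/ h)) (minus (K h x) x)))).
- apply (filterlim_comp _ _ _ _ (laplace z) _ (locally (A x))).
  + apply generator_quotient, Hx.
  + apply (linear_cont _ (A x) HT).
- apply (filterlim_ext_loc (fun h => scal (RtoC (/ h)) (minus (K h (laplace z x)) (laplace z x)))).
  + exists (mkposreal 1 Rlt_0_1); intros h _ Hh.
    rewrite (linear_scal _ HT) (linear_minus _ _ _ HT) laplace_comm; [ reflexivity | exact Hz | lra ].
  + apply generator_quotient, laplace_generator, Hz.
Qed.

Lemma laplace_resolvent_left (z : C) (x : X) : 0 < Re z -> dom A x ->
  laplace z (scalar_minus z A x) = x.
Proof.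
intros Hz Hx; simpl.
pose proof (laplace_linear z Hz) as HT.
rewrite (linear_minus _ _ _ HT) (linear_scal _ HT) laplace_generator_comm; auto.
rewrite (proj2 (laplace_generator z x Hz)).
unfold minus. rewrite opp_plus opp_opp plus_assoc plus_opp_r plus_zero_l. reflexivity.
Qed.

Lemma laplace_resolvent_right (z : C) (y : X) : 0 < Re z ->
  scalar_minus z A (laplace z y) = y.
Proof.
intros Hz; simpl.
rewrite (proj2 (laplace_generator z y Hz)).
unfold minus. rewrite opp_plus opp_opp plus_assoc plus_opp_r plus_zero_l. reflexivity.
Qed.

Lemma right_half_plane_in_resolvent_set (z : C) : 0 < Re z -> in_resolvent_set A z.
Proof.
intros Hz; exists (laplace z); split; [ | split ].
- apply laplace_linear, Hz.
- intros y; split; [ apply laplace_generator, Hz | apply laplace_resolvent_right, Hz ].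
- intros x Hx; apply laplace_resolvent_left; auto.
Qed.

Lemma resolvent_laplace (z : C) (y : X) : 0 < Re z -> resolvent A z y = laplace z y.
Proof.
intros Hz; unfold resolvent.
apply (iota_unique (K := C_AbsRing)).
- intros x [Hx Hxy]. rewrite -Hxy. symmetry; apply laplace_resolvent_left; auto.
- split; [ apply laplace_generator, Hz | apply laplace_resolvent_right, Hz ].
Qed.

(** On the right, the difference quotient at [s] is [K s] applied to the one
    at 0. On the left it is [K (s - h)] applied to the one at 0, where the
    operator varies too: there the uniform bound [M] and the continuity of the
    orbit of [A v] are used. *)
Lemma orbit_derivative (v : X) (s : R) : dom A v -> 0 < s ->
  is_derive (V := XR) (fun r => K (Rabs r) v) s (K s (A v)).
Proof.
intros Hv Hs.
apply (is_derive_norm_iff (V := XR)); intros eps Heps.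
(* Each of the two error terms below is amplified by at most [M]. *)
set (e := eps / (2 * M)).
assert (He : 0 < e) by (apply Rdiv_lt_0_compat; lra).
destruct (proj1 (filterlim_norm_iff _ _) (generator_quotient v Hv) e He) as [d1 Hd1].
destruct (semigroup_right_continuous (A v) e He) as [d2 [Hd2 Hc]].
assert (Q : forall h, 0 < h < d1 -> norm (minus (minus (K h v) v) (scal (RtoC h) (A v))) <= h * e).
{ intros h [Hh Hh1].
  specialize (Hd1 h). assert (B : ball 0 d1 h).
  { change (Rabs (h - 0) < d1). rewrite Rminus_0_r Rabs_pos_eq; lra. }
  specialize (Hd1 B Hh).
  replace (minus (minus (K h v) v) (scal (RtoC h) (A v))) with
    (scal (RtoC h) (minus (scal (RtoC (/ h)) (minus (K h v) v)) (A v))).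
  - refine (Rle_trans _ _ _ (norm_scal _ _) _).
    change (abs (RtoC h)) with (Cmod (RtoC h)). rewrite Cmod_R Rabs_pos_eq; [ | lra ].
    apply Rmult_le_compat_l; [ lra | apply Rlt_le, Hd1 ].
  - rewrite (scal_minus_distr_l (V := X)) scal_C_assoc -RtoC_mult Rinv_r; [ | lra ].
    rewrite scal_C_one. reflexivity. }
assert (Hd : 0 < Rmin s (Rmin d1 d2)).
{ apply Rmin_pos; [ lra | apply Rmin_pos; [ apply cond_pos | lra ] ]. }
exists (mkposreal _ Hd); intros r Hr.
assert (Hr' : Rabs (r - s) < Rmin s (Rmin d1 d2)) by exact Hr.
pose proof (Rmin_l s (Rmin d1 d2)); pose proof (Rmin_r s (Rmin d1 d2)).
pose proof (Rmin_l d1 d2); pose proof (Rmin_r d1 d2).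
rewrite (Rabs_pos_eq s); [ | lra ].
assert (Hrs : 0 < r) by (apply Rabs_lt_between in Hr'; lra).
rewrite (Rabs_pos_eq r); [ | lra ].
change (norm (minus (minus (K r v) (K s v)) (scal (RtoC (r - s)) (K s (A v)))) <= eps * Rabs (r - s)).
assert (HM2 : M * (2 * e) = eps) by (unfold e; field; lra).
destruct (Rtotal_order r s) as [Hlt|[->|Hgt]].
- set (h := s - r). assert (Hh : Rabs (r - s) = h) by (rewrite Rabs_left; unfold h; lra).
  rewrite Hh in Hr' |- *. assert (Hh0 : 0 < h) by (unfold h; lra).
  pose proof (semigroup_linear r (Rlt_le _ _ Hrs)) as HL.
  replace (minus (minus (K r v) (K s v)) (scal (RtoC (r - s)) (K s (A v)))) with
    (K r (plus (opp (minus (minus (K h v) v) (scal (RtoC h) (A v))))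
               (scal (RtoC h) (minus (K h (A v)) (A v))))).
  + refine (Rle_trans _ _ _ (semigroup_norm r _ (Rlt_le _ _ Hrs)) _).
    rewrite -HM2 Rmult_assoc. apply Rmult_le_compat_l; [ lra | ].
    refine (Rle_trans _ _ _ (norm_triangle _ _) _).
    replace (2 * e * h) with (h * e + h * e) by ring.
    apply Rplus_le_compat.
    * rewrite norm_opp. apply Q; lra.
    * refine (Rle_trans _ _ _ (norm_scal _ _) _).
      change (abs (RtoC h)) with (Cmod (RtoC h)). rewrite Cmod_R Rabs_pos_eq; [ | lra ].
      apply Rmult_le_compat_l; [ lra | apply Rlt_le, Hc; lra ].
  + assert (Es : forall y, K s y = K r (K h y)).
    { intros y; rewrite -semigroup_plus; [ f_equal; unfold h; ring | lra | lra ]. }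
    rewrite !Es.
    replace (RtoC (r - s)) with (opp (RtoC h)).
    2:{ unfold h; change (opp ?x) with (Copp x). rewrite -RtoC_opp. f_equal; ring. }
    rewrite -(linear_scal _ HL) -!(linear_minus _ _ _ HL). f_equal.
    rewrite (scal_opp_l (V := X)) (scal_minus_distr_l (V := X)).
    exact (minus_rearrange (G := X) _ _ _ _).
- rewrite Rminus_eq_0 Rabs_R0.
  replace (scal (RtoC 0) (K s (A v))) with (zero : X) by (symmetry; apply (scal_zero_l (V := X))).
  unfold minus; rewrite plus_opp_r opp_zero plus_zero_r norm_zero; lra.
- set (h := r - s). assert (Hh : Rabs (r - s) = h) by (rewrite Rabs_pos_eq; unfold h; lra).
  rewrite Hh in Hr' |- *. assert (Hh0 : 0 < h) by (unfold h; lra).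
  pose proof (semigroup_linear s (Rlt_le _ _ Hs)) as HL.
  replace (K r v) with (K s (K h v)).
  2:{ rewrite -semigroup_plus; [ f_equal; unfold h; ring | lra | lra ]. }
  rewrite -(linear_scal _ HL) -!(linear_minus _ _ _ HL).
  refine (Rle_trans _ _ _ (semigroup_norm s _ (Rlt_le _ _ Hs)) _).
  rewrite -HM2 Rmult_assoc. apply Rmult_le_compat_l; [ lra | ].
  refine (Rle_trans _ _ _ (Q h _) _); [ lra | ]. nra.
Qed.

Lemma laplace_op_pow (z w : C) (n : nat) (x : X) : 0 < Re z ->
  dom (op_pow (scalar_minus w A) n) x ->
  dom (op_pow (scalar_minus w A) n) (laplace z x) /\
  op_pow (scalar_minus w A) n (laplace z x) = laplace z (op_pow (scalar_minus w A) n x).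
Proof.
intros Hz; revert x; induction n as [|n IH]; intros x Hx; [ split; [ exact I | reflexivity ] | ].
destruct Hx as [Hx1 Hx2].
pose proof (laplace_linear z Hz) as HT.
assert (E : scalar_minus w A (laplace z x) = laplace z (scalar_minus w A x)).
{ simpl. rewrite (linear_minus _ _ _ HT) (linear_scal _ HT) laplace_generator_comm; auto. }
destruct (IH _ Hx2) as [H1 H2].
split.
- split; [ apply laplace_generator, Hz | rewrite E; exact H1 ].
- change (op_pow (scalar_minus w A) n (scalar_minus w A (laplace z x)) =
    laplace z (op_pow (scalar_minus w A) n (scalar_minus w A x))).
  rewrite E; exact H2.
Qed.

(** Taylor's formula at infinity for
    [u j s = e^(- 2 delta (s - t)) K s ((2 delta - A)^j x)], whose derivative is
    [- u (j + 1)]. Starting at [t] rather than at 0 gives the kernel in the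
    variable [s - t], which is also the variable of the trapezoidal sum. *)
Lemma semigroup_representation (delta t : R) (n : nat) (x : X) : 0 < delta -> 0 <= t ->
  dom (op_pow (scalar_minus (RtoC (2 * delta)) A) (S n)) x ->
  is_int_from (V := XR) t
    (fun s => scal (RtoC ((s - t) ^ n / INR (fact n) * exp (- (2 * delta) * (s - t))))
      (K (Rabs s) (op_pow (scalar_minus (RtoC (2 * delta)) A) (S n) x)))
    (K t x).
Proof.
intros Hd Ht Hx.
set (B := scalar_minus (RtoC (2 * delta)) A) in *.
set (w := fun s => exp (- (2 * delta) * (s - t))).
set (u := fun j s => scal (V := XR) (w s) (K (Rabs s) (op_pow B j x))).
assert (Hw : forall s, is_derive w s (- (2 * delta) * w s)).
{ intros s; unfold w; auto_derive; [ trivial | unfold Rminus; ring ]. }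
assert (Hwp : forall s, 0 < w s) by (intros; apply exp_pos).
assert (HC : exists C, forall j, (j <= S n)%nat -> norm (op_pow B j x) <= C).
{ clear; induction (S n) as [|k [C IH]].
  - exists (norm (op_pow B 0 x)); intros j Hj. replace j with O by lia. apply Rle_refl.
  - exists (Rmax C (norm (op_pow B (S k) x))); intros j Hj.
    destruct (Nat.eq_dec j (S k)) as [->|Hjk]; [ apply Rmax_r | ].
    apply Rle_trans with C; [ apply IH; lia | apply Rmax_l ]. }
destruct HC as [C HC].
assert (E : K t x = u O t).
{ unfold u, w; simpl. rewrite Rminus_eq_0 Rmult_0_r exp_0 Rabs_pos_eq; [ | exact Ht ].
  symmetry; exact (scal_one (V := XR) (K t x)). }
rewrite E.
refine (is_int_from_ext (V := XR) t _ _ _ _ (taylor_at_infinity (V := XR) n u t (2 * delta) (M * C * exp (2 * delta * t)) _ _ _ _)).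
- intros s _; unfold u. rewrite (scal_assoc (V := XR)). reflexivity.
- lra.
- intros j s _. apply (continuous_scal (K := R_AbsRing) (V := XR)).
  + apply continuous_of_derive; eexists; apply Hw.
  + apply orbit_continuous.
- intros j s Hj Hs.
  destruct (op_pow_dom_le B j x (op_pow_dom_mono B (S n) (S j) x ltac:(lia) Hx)) as [_ HDj].
  refine (eq_ind (plus (scal (V := XR) (- (2 * delta) * w s) (K (Rabs s) (op_pow B j x)))
          (scal (V := XR) (w s) (K s (A (op_pow B j x))))) (fun l => is_derive (V := XR) (u j) s l) _ _ _).
  + refine (is_derive_scal_fct (V := XR) w (fun r => K (Rabs r) (op_pow B j x)) s _ _ (Hw s) _).
    apply orbit_derivative; [ exact HDj | lra ].
  + unfold u. rewrite op_pow_succ_out.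
    rewrite (Rabs_pos_eq s); [ | lra ].
    pose proof (semigroup_linear s ltac:(lra)) as HL.
    change (B (op_pow B j x)) with (minus (scal (RtoC (2 * delta)) (op_pow B j x)) (A (op_pow B j x))).
    rewrite (linear_minus _ _ _ HL) (linear_scal _ HL).
    rewrite (scal_minus_distr_l (V := XR)). unfold minus; rewrite (opp_plus (G := XR)) (opp_opp (G := XR)).
    f_equal.
    rewrite -(scal_opp_l (V := XR)).
    change (scal (V := X) (RtoC (2 * delta)) (K s (op_pow B j x))) with (scal (V := XR) (2 * delta) (K s (op_pow B j x))).
    rewrite (scal_assoc (V := XR)). f_equal.
    unfold mult, opp; simpl. ring.
- intros j s Hj Hs. unfold u.
  refine (Rle_trans _ _ _ (norm_scal (V := XR) _ _) _).
  change (abs (w s)) with (Rabs (w s)). rewrite Rabs_pos_eq; [ | apply Rlt_le, Hwp ].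
  rewrite (Rabs_pos_eq s); [ | lra ].
  assert (H1 : norm (K s (op_pow B j x)) <= M * C).
  { refine (Rle_trans _ _ _ (semigroup_norm s _ ltac:(lra)) _). apply Rmult_le_compat_l; [ lra | apply HC, Hj ]. }
  replace (M * C * exp (2 * delta * t) * exp (- (2 * delta) * s)) with (w s * (M * C)).
  + apply Rmult_le_compat_l; [ apply Rlt_le, Hwp | exact H1 ].
  + unfold w. replace (- (2 * delta) * (s - t)) with (2 * delta * t + - (2 * delta) * s) by ring.
    rewrite exp_plus; ring.
Qed.

End Semigroup.

(** * The Fejer kernel *)

(** A sum over [-N <= k <= N] of terms that are even in [k]. *)
Definition sym_sum (f : nat -> R) (N : nat) : R :=
  sum_f_R0 (fun k => match k with O => f O | S _ => 2 * f k end) N.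

Lemma sym_sum_S (f : nat -> R) (N : nat) : sym_sum f (S N) = sym_sum f N + 2 * f (S N).
Proof. reflexivity. Qed.

Section Fejer.
Context (h : R) (Hh : 0 < h).
Let L := 2 * PI / h.

Lemma period_pos : 0 < L.
Proof. apply Rdiv_lt_0_compat; [ pose proof PI_RGT_0; lra | exact Hh ]. Qed.

Definition dirichlet (N : nat) (x : R) : R := sym_sum (fun k => cos (INR k * h * x)) N.

Definition fejer (N : nat) (x : R) : R := sum_f_R0 (fun i => dirichlet i x) N / INR (S N).

Lemma dirichlet_sin (N : nat) (x : R) :
  dirichlet N x * sin (h * x / 2) = sin ((INR N + 1 / 2) * (h * x)).
Proof.
induction N as [|N IH].
- unfold dirichlet, sym_sum; simpl. rewrite !Rmult_0_l cos_0 Rmult_1_l. f_equal; field.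
- unfold dirichlet in *; rewrite sym_sum_S Rmult_plus_distr_r IH.
  rewrite S_INR.
  replace ((INR N + 1 + 1 / 2) * (h * x)) with ((INR N + 1) * h * x + h * x / 2) by field.
  replace ((INR N + 1 / 2) * (h * x)) with ((INR N + 1) * h * x - h * x / 2) by field.
  rewrite sin_plus sin_minus. ring.
Qed.

(** The sines of [dirichlet_sin] telescope into a square, which is where the
    positivity of the Fejer kernel comes from. *)
Lemma fejer_sin (N : nat) (x : R) :
  fejer N x * INR (S N) * (sin (h * x / 2)) ^ 2 = (sin (INR (S N) * (h * x) / 2)) ^ 2.
Proof.
assert (E : fejer N x * INR (S N) = sum_f_R0 (fun i => dirichlet i x) N).
{ unfold fejer; field; apply not_0_INR; lia. }
rewrite E; clear E. rewrite Rmult_comm.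
induction N as [|N IH].
- simpl sum_f_R0. replace (dirichlet 0 x) with 1.
  2:{ unfold dirichlet, sym_sum; simpl. rewrite !Rmult_0_l cos_0. reflexivity. }
  replace (INR 1 * (h * x) / 2) with (h * x / 2) by (simpl; field). ring.
- rewrite tech5 Rmult_plus_distr_l IH.
  replace (sin (h * x / 2) ^ 2 * dirichlet (S N) x) with
    (dirichlet (S N) x * sin (h * x / 2) * sin (h * x / 2)) by ring.
  rewrite dirichlet_sin.
  set (al := INR (S N) * (h * x) / 2).
  replace ((INR (S N) + 1 / 2) * (h * x)) with (al + (al + h * x / 2)) by (unfold al; field).
  replace (INR (S (S N)) * (h * x) / 2) with (al + h * x / 2) by (unfold al; rewrite (S_INR (S N)); field).
  rewrite (sin_plus al (al + h * x / 2)) !sin_plus cos_plus.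
  set (s := sin al); set (c := cos al); set (s' := sin (h * x / 2)); set (c' := cos (h * x / 2)).
  assert (E1 : s * s + c * c = 1) by (pose proof (sin2_cos2 al) as E; unfold Rsqr in E; exact E).
  assert (E2 : s' * s' + c' * c' = 1) by (pose proof (sin2_cos2 (h * x / 2)) as E; unfold Rsqr in E; exact E).
  replace (c * c) with (1 - s * s) by lra.
  transitivity (s ^ 2 * (s' * s' + c' * c') + ((s * (c * c' - s * s') + c * (s * c' + c * s')) * s') - s ^ 2 * (s' * s' + c' * c' - 1)).
  { ring. }
  replace (c' * c' ) with (1 - s' * s') by lra.
  ring_simplify. replace (c ^ 2) with (1 - s ^ 2) by (simpl; lra).
  replace (c' ^ 2) with (1 - s' ^ 2) by (simpl; lra). ring.
Qed.

Lemma fejer_nonneg (N : nat) (x : R) : Rabs x <= L / 2 -> 0 <= fejer N x.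
Proof.
intros Hx.
assert (HN : 0 < INR (S N)) by (apply lt_0_INR; lia).
destruct (Req_dec x 0) as [->|Hx0].
- unfold fejer. apply Rmult_le_pos; [ | apply Rlt_le, Rinv_0_lt_compat, HN ].
  apply cond_pos_sum; intros i; unfold dirichlet.
  induction i as [|i IH].
  + unfold sym_sum; simpl. rewrite Rmult_0_r cos_0; lra.
  + rewrite sym_sum_S Rmult_0_r cos_0; lra.
- assert (Hs : 0 < sin (h * x / 2) ^ 2).
  { apply pow2_gt_0. intros H0.
    assert (Hb : Rabs (h * x / 2) <= PI / 2).
    { replace (h * x / 2) with (h / 2 * x) by field. rewrite Rabs_mult Rabs_pos_eq; [ | lra ].
      replace (PI / 2) with (h / 2 * (L / 2)) by (unfold L; field; lra).
      apply Rmult_le_compat_l; lra. }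
    pose proof PI_RGT_0.
    apply Rabs_le_between in Hb.
    destruct (Rtotal_order (h * x / 2) 0) as [H1|[H1|H1]].
    - pose proof (sin_gt_0 (- (h * x / 2)) ltac:(lra) ltac:(lra)) as H2. rewrite sin_neg in H2; lra.
    - apply Hx0. nra.
    - pose proof (sin_gt_0 (h * x / 2) ltac:(lra) ltac:(lra)) as H2. lra. }
  pose proof (fejer_sin N x) as E.
  pose proof (pow2_ge_0 (sin (INR (S N) * (h * x) / 2))) as H.
  apply Rmult_le_reg_r with (INR (S N) * sin (h * x / 2) ^ 2); [ nra | ].
  rewrite Rmult_0_l -Rmult_assoc E; exact H.
Qed.

Lemma fejer_away (N : nat) (x d : R) : 0 < d -> d <= Rabs x <= L / 2 ->
  fejer N x <= / (sin (h * d / 2) ^ 2) * / INR (S N).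
Proof.
intros Hd [H1 H2].
assert (HN : 0 < INR (S N)) by (apply lt_0_INR; lia).
pose proof PI_RGT_0.
assert (Hb : forall y, 0 <= y <= L / 2 -> 0 <= h * y / 2 <= PI / 2).
{ intros y Hy. replace (PI / 2) with (h / 2 * (L / 2)) by (unfold L; field; lra).
  replace (h * y / 2) with (h / 2 * y) by field. split; [ apply Rmult_le_pos; lra | apply Rmult_le_compat_l; lra ]. }
pose proof (Hb d ltac:(lra)) as Bd. pose proof (Hb (Rabs x) ltac:(lra)) as Bx.
assert (Hsd : 0 < sin (h * d / 2)) by (apply sin_gt_0; [ apply Rdiv_lt_0_compat; nra | lra ]).
assert (Hle : sin (h * d / 2) <= sin (h * Rabs x / 2)).
{ apply sin_incr_1; try lra. apply Rmult_le_compat_r; [ lra | ]. apply Rmult_le_compat_l; lra. }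
assert (Hsx : sin (h * d / 2) ^ 2 <= sin (h * x / 2) ^ 2).
{ replace (sin (h * x / 2) ^ 2) with (sin (h * Rabs x / 2) ^ 2).
  - apply pow_incr; lra.
  - unfold Rabs; destruct (Rcase_abs x); [ | reflexivity ].
    replace (h * - x / 2) with (- (h * x / 2)) by field. rewrite sin_neg; ring. }
pose proof (fejer_sin N x) as E.
pose proof (fejer_nonneg N x H2) as F0.
assert (S1 : sin (INR (S N) * (h * x) / 2) ^ 2 <= 1).
{ pose proof (SIN_bound (INR (S N) * (h * x) / 2)). nra. }
assert (Hd2 : 0 < sin (h * d / 2) ^ 2) by (apply pow_lt, Hsd).
apply Rmult_le_reg_r with (INR (S N) * sin (h * d / 2) ^ 2); [ nra | ].
replace (/ sin (h * d / 2) ^ 2 * / INR (S N) * (INR (S N) * sin (h * d / 2) ^ 2)) with 1 by (field; split; apply Rgt_not_eq; [exact HN | exact Hsd]).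
apply Rle_trans with (fejer N x * INR (S N) * sin (h * x / 2) ^ 2); [ | rewrite E; exact S1 ].
rewrite -Rmult_assoc. apply Rmult_le_compat_l; [ apply Rmult_le_pos; lra | exact Hsx ].
Qed.

Lemma is_derive_sum_f (f : nat -> R -> R) (d : nat -> R) (N : nat) (x : R) :
  (forall k, is_derive (f k) x (d k)) ->
  is_derive (fun y => sum_f_R0 (fun k => f k y) N) x (sum_f_R0 d N).
Proof.
intros H; induction N as [|N IH]; [ apply H | ].
apply (is_derive_plus (V := RN) (fun y => sum_f_R0 (fun k => f k y) N)); auto.
Qed.

Lemma dirichlet_ex_derive (N : nat) (x : R) : ex_derive (dirichlet N) x.
Proof.
induction N as [|N IH].
- apply (ex_derive_ext (fun _ => cos (0 * h * 0))).
  + intros y; unfold dirichlet, sym_sum; simpl. f_equal; ring.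
  + apply ex_derive_const.
- unfold dirichlet.
  apply (ex_derive_ext (fun y => dirichlet N y + 2 * cos (INR (S N) * h * y))); [ reflexivity | ].
  apply (ex_derive_plus (V := RN) (dirichlet N)); [ exact IH | ]. auto_derive; trivial.
Qed.

Lemma fejer_continuous (N : nat) (x : R) : continuous (fejer N) x.
Proof.
apply continuous_of_derive. unfold fejer, Rdiv.
apply (ex_derive_mult (fun y => sum_f_R0 (fun i => dirichlet i y) N) (fun _ => / INR (S N))); [ | apply ex_derive_const ].
eexists; apply (is_derive_sum_f (fun k => dirichlet k) (fun k => Derive (dirichlet k) x)).
intros k; apply Derive_correct, dirichlet_ex_derive.
Qed.

Lemma cos_period_nat (k : nat) (x : R) : cos (INR k * h * (x + L)) = cos (INR k * h * x).
Proof.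
replace (INR k * h * (x + L)) with (INR k * h * x + 2 * INR k * PI) by (unfold L; field; lra).
apply cos_period.
Qed.

Lemma sym_sum_ext (f g : nat -> R) (N : nat) : (forall k, f k = g k) -> sym_sum f N = sym_sum g N.
Proof. intros H; apply sum_eq; intros [|k] _; rewrite H; reflexivity. Qed.

Lemma fejer_period (N : nat) (x : R) : fejer N (x + L) = fejer N x.
Proof.
unfold fejer; f_equal. apply sum_eq; intros i _. apply sym_sum_ext; intros k. apply cos_period_nat.
Qed.

Lemma cos_integral (k a b : R) : k <> 0 ->
  is_RInt (fun x => 2 * cos (k * h * x)) a b (2 * sin (k * h * b) / (k * h) - 2 * sin (k * h * a) / (k * h)).
Proof.
intros Hk.
apply (is_RInt_derive (V := RC) (fun x => 2 * sin (k * h * x) / (k * h))).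
- intros x _; auto_derive; [ trivial | field; split; [ lra | exact Hk ] ].
- intros x _; continuous_by_derive.
Qed.

Lemma dirichlet_integral (N : nat) : is_RInt (dirichlet N) (- (L / 2)) (L / 2) L.
Proof.
induction N as [|N IH].
- apply (is_RInt_ext (fun _ => 1)).
  + intros x _; unfold dirichlet, sym_sum; simpl. rewrite !Rmult_0_l cos_0; reflexivity.
  + assert (E : scal (L / 2 - - (L / 2)) 1 = L) by (change ((L / 2 - - (L / 2)) * 1 = L); lra).
    rewrite -{3}E. apply (is_RInt_const (V := RN)).
- assert (H : is_RInt (fun x => 2 * cos (INR (S N) * h * x)) (- (L / 2)) (L / 2) 0).
  { assert (Hk : INR (S N) <> 0) by (apply not_0_INR; lia).
    replace 0 with (2 * sin (INR (S N) * h * (L / 2)) / (INR (S N) * h) - 2 * sin (INR (S N) * h * - (L / 2)) / (INR (S N) * h)).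
    - exact (cos_integral _ _ _ Hk).
    - replace (INR (S N) * h * - (L / 2)) with (- (IZR (Z.of_nat (S N)) * PI)) by (rewrite -INR_IZR_INZ; unfold L; field; lra).
      replace (INR (S N) * h * (L / 2)) with (IZR (Z.of_nat (S N)) * PI) by (rewrite -INR_IZR_INZ; unfold L; field; lra).
      rewrite sin_neg. replace (sin (IZR (Z.of_nat (S N)) * PI)) with 0; [ field; split; [ lra | exact Hk ] | ].
      symmetry; apply sin_eq_0_1; eexists; reflexivity. }
  assert (E : L = plus L 0) by (unfold plus; simpl; ring).
  rewrite {3}E.
  exact (is_RInt_plus (V := RN) _ _ _ _ _ _ IH H).
Qed.

Lemma fejer_integral (N : nat) : is_RInt (fejer N) (- (L / 2)) (L / 2) L.
Proof.
assert (HN : INR (S N) <> 0) by (apply not_0_INR; lia).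
assert (H : is_RInt (fun x => sum_f_R0 (fun i => dirichlet i x) N) (- (L / 2)) (L / 2) (INR (S N) * L)).
{ clear HN. induction N as [|N IH].
  - simpl INR; rewrite Rmult_1_l; apply (dirichlet_integral 0).
  - replace (INR (S (S N)) * L) with (plus (INR (S N) * L) L).
    + exact (is_RInt_plus (V := RN) _ _ _ _ _ _ IH (dirichlet_integral (S N))).
    + rewrite (S_INR (S N)). unfold plus; simpl; ring. }
apply (is_RInt_ext (fun x => scal (/ INR (S N)) (sum_f_R0 (fun i => dirichlet i x) N))).
- intros x _; unfold fejer, scal; simpl; unfold mult; simpl; unfold Rdiv; ring.
- assert (E : L = scal (/ INR (S N)) (INR (S N) * L)).
  { change (L = / INR (S N) * (INR (S N) * L)). field; exact HN. }
  rewrite {3}E. apply (is_RInt_scal (V := RN)), H.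
Qed.

Definition fejer_mean (f : R -> R) (N : nat) : R :=
  RInt (fun x => f x * fejer N x) (- (L / 2)) (L / 2) / L.

Lemma fejer_mean_le (f g : R -> R) (N : nat) :
  (forall x, continuous f x) -> (forall x, continuous g x) ->
  (forall x, Rabs x <= L / 2 -> f x <= g x) -> fejer_mean f N <= fejer_mean g N.
Proof.
intros Hf Hg H. pose proof period_pos as HL.
unfold fejer_mean. apply Rmult_le_compat_r; [ apply Rlt_le, Rinv_0_lt_compat, HL | ].
apply RInt_le; [ lra | | | ].
- apply ex_RInt_continuous_R; intros x; apply (continuous_mult f); [ apply Hf | apply fejer_continuous ].
- apply ex_RInt_continuous_R; intros x; apply (continuous_mult g); [ apply Hg | apply fejer_continuous ].
- intros x Hx. assert (Hx' : Rabs x <= L / 2) by (apply Rabs_le; lra).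
  apply Rmult_le_compat_r; [ apply fejer_nonneg | apply H ]; exact Hx'.
Qed.

Lemma fejer_mean_minus (f g : R -> R) (N : nat) :
  (forall x, continuous f x) -> (forall x, continuous g x) ->
  fejer_mean (fun x => f x - g x) N = fejer_mean f N - fejer_mean g N.
Proof.
intros Hf Hg. unfold fejer_mean, Rdiv. rewrite -Rmult_minus_distr_r; f_equal.
rewrite (RInt_ext _ (fun x => minus (f x * fejer N x) (g x * fejer N x))).
2:{ intros x _. unfold minus, plus, opp; simpl; ring. }
apply (RInt_minus (V := RC)).
- apply ex_RInt_continuous_R; intros x; apply (continuous_mult f); [ apply Hf | apply fejer_continuous ].
- apply ex_RInt_continuous_R; intros x; apply (continuous_mult g); [ apply Hg | apply fejer_continuous ].
Qed.

Lemma fejer_mean_const (c : R) (N : nat) : fejer_mean (fun _ => c) N = c.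
Proof.
pose proof period_pos as HL. unfold fejer_mean.
rewrite (is_RInt_unique _ _ _ (scal c L)).
- unfold scal; simpl; unfold mult; simpl; field; lra.
- apply (is_RInt_scal (V := RN)), fejer_integral.
Qed.

(** The Fejer kernel is an approximate identity: it is nonnegative, has
    integral [L] over a period, and is [O(1/N)] away from 0. The integrand has
    a single majorant valid both near 0 and away from it, so the integral need
    not be cut. *)
Lemma fejer_mean_limit (f : R -> R) : (forall x, continuous f x) ->
  is_lim_seq (fejer_mean f) (f 0).
Proof.
intros Hf. pose proof period_pos as HL.
destruct (bounded_continuity (V := RN) (fun x => f x - f 0) (- (L / 2)) (L / 2)) as [Bd HBd].
{ intros x _. apply (continuous_minus (V := RN) f (fun _ => f 0)); [ apply Hf | apply continuous_const ]. }
assert (HBd0 : 0 <= Bd).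
{ apply Rle_trans with (norm (f 0 - f 0)); [ apply norm_ge_0 | apply Rlt_le, HBd; lra ]. }
apply is_lim_seq_spec; intros eps.
destruct (proj1 (filterlim_locally _ _) (Hf 0) (pos_div_2 eps)) as [d Hd].
set (d' := Rmin d (L / 2)).
assert (Hd' : 0 < d') by (apply Rmin_pos; [ apply cond_pos | lra ]).
pose proof (Rmin_l d (L / 2)) as Hm1; pose proof (Rmin_r d (L / 2)) as Hm2; fold d' in Hm1, Hm2.
set (q := Bd * / (sin (h * d' / 2) ^ 2)).
assert (Hq : forall N, Rabs (fejer_mean f N - f 0) <= eps / 2 + q * / INR (S N)).
{ intros N.
  assert (Hc : forall x, continuous (fun x => f x - f 0) x).
  { intros x; apply (continuous_minus (V := RN) f (fun _ => f 0)); [ apply Hf | apply continuous_const ]. }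
  rewrite -{1}(fejer_mean_const (f 0) N) -fejer_mean_minus; [ | exact Hf | intros; apply continuous_const ].
  unfold fejer_mean. unfold Rdiv at 1. rewrite Rabs_mult (Rabs_pos_eq (/ L)); [ | apply Rlt_le, Rinv_0_lt_compat, HL ].
  apply Rmult_le_reg_r with L; [ exact HL | ].
  rewrite Rmult_assoc Rinv_l; [ | lra ]. rewrite Rmult_1_r.
  set (G := fun x => eps / 2 * fejer N x + q * / INR (S N)).
  assert (HG : is_RInt G (- (L / 2)) (L / 2) ((eps / 2 + q * / INR (S N)) * L)).
  { replace ((eps / 2 + q * / INR (S N)) * L) with (plus (scal (eps / 2) L) (scal (L / 2 - - (L / 2)) (q * / INR (S N)))).
    - apply (is_RInt_plus (V := RN)).
      + apply (is_RInt_scal (V := RN)), fejer_integral.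
      + apply (is_RInt_const (V := RN)).
    - generalize (q * / INR (S N)); intros r.
      change (eps / 2 * L + (L / 2 - - (L / 2)) * r = (eps / 2 + r) * L). field. }
  refine (norm_RInt_le (V := RN) (fun x => (f x - f 0) * fejer N x) G (- (L / 2)) (L / 2) _ _ _ _ _ HG).
  - lra.
  - intros x Hx. assert (Hx' : Rabs x <= L / 2) by (apply Rabs_le; lra).
    change (Rabs ((f x - f 0) * fejer N x) <= G x).
    pose proof (fejer_nonneg N x Hx') as F0.
    rewrite Rabs_mult (Rabs_pos_eq (fejer N x)); [ | exact F0 ].
    unfold G.
    assert (HN : 0 < INR (S N)) by (apply lt_0_INR; lia).
    destruct (Rlt_dec (Rabs x) d') as [Hxd|Hxd].
    + assert (B : Rabs (f x - f 0) < eps / 2).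
      { apply (Hd x). change (Rabs (x - 0) < d). rewrite Rminus_0_r; lra. }
      assert (0 <= q * / INR (S N)).
      { unfold q. apply Rmult_le_pos; [ apply Rmult_le_pos; [ exact HBd0 | ] | apply Rlt_le, Rinv_0_lt_compat, HN ].
        apply Rlt_le, Rinv_0_lt_compat, pow_lt, sin_gt_0; [ apply Rdiv_lt_0_compat; nra | ].
        apply Rle_lt_trans with (PI / 2); [ | pose proof PI_RGT_0; lra ].
        replace (PI / 2) with (h * (L / 2) / 2) by (unfold L; field; lra).
        apply Rmult_le_compat_r; [ lra | apply Rmult_le_compat_l; lra ]. }
      nra.
    + assert (B : Rabs (f x - f 0) <= Bd) by (apply Rlt_le, (HBd x Hx)).
      pose proof (fejer_away N x d' Hd' ltac:(lra)) as FA.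
      pose proof (cond_pos eps).
      apply Rle_trans with (Bd * (/ sin (h * d' / 2) ^ 2 * / INR (S N))).
      * apply Rmult_le_compat; auto; apply Rabs_pos.
      * unfold q. rewrite Rmult_assoc. nra.
  - apply (RInt_correct (V := RC)), ex_RInt_continuous_R; intros x.
    apply (continuous_mult (fun x => f x - f 0)); [ apply Hc | apply fejer_continuous ]. }
assert (Hl : is_lim_seq (fun N => q * / INR (S N)) 0).
{ replace (Finite 0) with (Rbar_mult (Finite q) (Rbar_inv p_infty)) by (simpl; f_equal; ring).
  apply is_lim_seq_scal_l, is_lim_seq_inv; [ | discriminate ].
  apply -> (is_lim_seq_incr_1 INR). apply is_lim_seq_INR. }
apply is_lim_seq_spec in Hl. destruct (Hl (pos_div_2 eps)) as [N0 HN0].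
exists N0; intros N HN.
specialize (HN0 N HN); simpl in HN0. rewrite Rminus_0_r in HN0.
apply Rle_lt_trans with (1 := Hq N).
pose proof (Rle_abs (q * / INR (S N))). change (INR (S N)) with (match N with O => 1 | S _ => INR N + 1 end) in *. lra.
Qed.

End Fejer.

(** * Periodization of the gamma kernel *)

(** The inverse Fourier transform of [1 / (c + i w)^(n+1)], see
    [gamma_kernel_fourier]. *)
Definition gamma_kernel (n : nat) (c v : R) : R := Rmax 0 v ^ n / INR (fact n) * exp (- c * v).

(** The maximum over [v >= 0] of [v^n e^(- c v) / n!], attained at [v = n / c]. *)
Definition peak (n : nat) (c : R) : R := (INR n / c) ^ n * exp (- INR n) / INR (fact n).

Lemma gamma_kernel_nonpos (n : nat) (c v : R) : (1 <= n)%nat -> v <= 0 -> gamma_kernel n c v = 0.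
Proof.
intros Hn Hv; unfold gamma_kernel. rewrite Rmax_left; [ | exact Hv ].
rewrite pow_i; [ | lia ]. unfold Rdiv; ring.
Qed.

Lemma gamma_kernel_nonneg (n : nat) (c v : R) : 0 <= gamma_kernel n c v.
Proof.
unfold gamma_kernel. apply Rmult_le_pos; [ | apply Rlt_le, exp_pos ].
apply Rmult_le_pos; [ apply pow_le, Rmax_l | apply Rlt_le, Rinv_0_lt_compat, INR_fact_lt_0 ].
Qed.

Lemma gamma_kernel_shift (n : nat) (c d v : R) :
  gamma_kernel n c v = gamma_kernel n d v * exp ((d - c) * v).
Proof.
unfold gamma_kernel. rewrite Rmult_assoc -exp_plus. f_equal; f_equal; ring.
Qed.

Lemma exp_ge_tangent (x : R) : x <= exp (x - 1).
Proof. pose proof (exp_ineq1_le (x - 1)); lra. Qed.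

(** With [x = c v / n] this is the [n]-th power of [x <= e^(x - 1)]. *)
Lemma gamma_kernel_le_peak (n : nat) (c v : R) : (1 <= n)%nat -> 0 < c ->
  gamma_kernel n c v <= peak n c.
Proof.
intros Hn Hc.
assert (Hn' : 0 < INR n) by (apply lt_0_INR; lia).
assert (Hp : 0 < peak n c).
{ unfold peak. apply Rdiv_lt_0_compat; [ | apply INR_fact_lt_0 ].
  apply Rmult_lt_0_compat; [ apply pow_lt, Rdiv_lt_0_compat; lra | apply exp_pos ]. }
destruct (Rle_dec v 0) as [Hv|Hv].
{ rewrite gamma_kernel_nonpos; auto; lra. }
unfold gamma_kernel, peak. rewrite Rmax_right; [ | lra ].
unfold Rdiv at 1 3. rewrite Rmult_assoc (Rmult_comm (/ _)) -Rmult_assoc.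
apply Rmult_le_compat_r; [ apply Rlt_le, Rinv_0_lt_compat, INR_fact_lt_0 | ].
set (x := c * v / INR n).
assert (Hx : 0 <= x) by (unfold x; apply Rlt_le, Rdiv_lt_0_compat; nra).
replace (v ^ n) with ((INR n / c) ^ n * x ^ n).
2:{ rewrite -Rpow_mult_distr; f_equal; unfold x; field; lra. }
rewrite Rmult_assoc; apply Rmult_le_compat_l; [ apply pow_le, Rlt_le, Rdiv_lt_0_compat; lra | ].
replace (exp (- INR n)) with (exp (INR n * (x - 1)) * exp (- c * v)).
2:{ rewrite -exp_plus; f_equal; unfold x; field; lra. }
apply Rmult_le_compat_r; [ apply Rlt_le, exp_pos | ].
replace (exp (INR n * (x - 1))) with (exp (x - 1) ^ n).
- apply pow_incr; split; [ exact Hx | apply exp_ge_tangent ].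
- generalize (x - 1); clear; intros y. induction n as [|n IH]; [ simpl; rewrite Rmult_0_l exp_0; reflexivity | ].
  rewrite S_INR -tech_pow_Rmult IH -exp_plus. f_equal; ring.
Qed.

Lemma gamma_kernel_continuous (n : nat) (c v : R) : continuous (gamma_kernel n c) v.
Proof.
unfold gamma_kernel.
apply (continuous_mult (fun v => Rmax 0 v ^ n / INR (fact n))).
- apply (continuous_mult (fun v => Rmax 0 v ^ n)); [ | apply continuous_const ].
  apply (continuous_comp (Rmax 0) (fun y => y ^ n)).
  + apply (continuous_ext (fun v => (v + Rabs v) / 2)).
    * intros y; unfold Rmax, Rabs; destruct (Rle_dec 0 y), (Rcase_abs y); simpl; lra.
    * apply (continuous_mult (fun v => v + Rabs v)); [ | apply continuous_const ].
      apply (continuous_plus (V := RN) (fun v => v)); [ apply continuous_id | apply continuous_Rabs ].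
  + continuous_by_derive.
- continuous_by_derive.
Qed.

Section Periodization.
Context (h : R) (Hh : 0 < h) (delta : R) (Hd : 0 < delta) (n : nat) (Hn : (1 <= n)%nat).
Let L := 2 * PI / h.
Let g := gamma_kernel n delta.

(** The sum over [r >= 1] of majorants of [g (v + r L)] and [g (v - r L)]. *)
Definition alias_bound (v : R) : R :=
  (peak n (delta / 2) * exp (- (delta / 2) * v) + peak n (3 * delta / 2) * exp (delta / 2 * v))
  / (exp (delta * PI / h) - 1).

Definition periodization (v : R) (N : nat) : R :=
  sum_f_R0 (fun r => match r with O => g v | S _ => g (v + INR r * L) + g (v - INR r * L) end) N.

Lemma periodization_S (v : R) (N : nat) :
  periodization v (S N) = periodization v N + (g (v + INR (S N) * L) + g (v - INR (S N) * L)).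
Proof. reflexivity. Qed.

Lemma alias_ratio_pos : 0 < exp (delta * PI / h) - 1.
Proof.
pose proof PI_RGT_0. pose proof (exp_increasing 0 (delta * PI / h)).
rewrite exp_0 in H0. enough (0 < delta * PI / h) by lra. apply Rdiv_lt_0_compat; nra.
Qed.

Lemma peak_pos (c : R) : 0 < c -> 0 < peak n c.
Proof.
intros Hc. unfold peak. apply Rdiv_lt_0_compat; [ | apply INR_fact_lt_0 ].
apply Rmult_lt_0_compat; [ apply pow_lt, Rdiv_lt_0_compat; auto; apply lt_0_INR; lia | apply exp_pos ].
Qed.

(** Comparing the kernel of rate [delta] with the one of rate [delta / 2] for
    the translates to the right, and with the one of rate [3 delta / 2] for
    those to the left, leaves in both cases a factor [e^(- r delta L / 2)],
    where [delta L / 2 = delta pi / h]. *)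
Lemma periodization_bound (v : R) (N : nat) : 0 <= periodization v N - g v <= alias_bound v.
Proof.
set (q := exp (- (delta * PI / h))).
set (a := peak n (delta / 2) * exp (- (delta / 2) * v)).
set (b := peak n (3 * delta / 2) * exp (delta / 2 * v)).
pose proof (peak_pos (delta / 2) ltac:(lra)); pose proof (peak_pos (3 * delta / 2) ltac:(lra)).
pose proof (exp_pos (- (delta / 2) * v)); pose proof (exp_pos (delta / 2 * v)).
assert (Ha : 0 < a) by (apply Rmult_lt_0_compat; auto).
assert (Hb : 0 < b) by (apply Rmult_lt_0_compat; auto).
pose proof alias_ratio_pos as Hr.
assert (Hq : 0 < q) by apply exp_pos.
assert (Eq : q = / exp (delta * PI / h)) by (unfold q; rewrite exp_Ropp; reflexivity).
assert (Hq1 : q < 1).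
{ rewrite Eq -Rinv_1. apply Rinv_lt_contravar; lra. }
assert (HS : forall r, exp (- (delta / 2) * (INR r * L)) = q ^ r).
{ intros r. replace (- (delta / 2) * (INR r * L)) with (INR r * (- (delta * PI / h))) by (unfold L; field; lra).
  unfold q; induction r as [|r IH]; [ simpl; rewrite Rmult_0_l exp_0; reflexivity | ].
  rewrite S_INR -tech_pow_Rmult -IH -exp_plus. f_equal; ring. }
assert (T : forall r, g (v + INR r * L) + g (v - INR r * L) <= (a + b) * q ^ r).
{ intros r; unfold g.
  rewrite (gamma_kernel_shift n delta (delta / 2) (v + INR r * L)).
  rewrite (gamma_kernel_shift n delta (3 * delta / 2) (v - INR r * L)).
  rewrite -(HS r) Rmult_plus_distr_r. apply Rplus_le_compat.
  - apply Rle_trans with (peak n (delta / 2) * exp ((delta / 2 - delta) * (v + INR r * L))).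
    + apply Rmult_le_compat_r; [ apply Rlt_le, exp_pos | apply gamma_kernel_le_peak; auto; lra ].
    + right; unfold a. rewrite Rmult_assoc -exp_plus. f_equal; f_equal; field.
  - apply Rle_trans with (peak n (3 * delta / 2) * exp ((3 * delta / 2 - delta) * (v - INR r * L))).
    + apply Rmult_le_compat_r; [ apply Rlt_le, exp_pos | apply gamma_kernel_le_peak; auto; lra ].
    + right; unfold b. rewrite Rmult_assoc -exp_plus. f_equal; f_equal; field. }
assert (G : 0 <= periodization v N - g v <= (a + b) * (q * (1 - q ^ N) / (1 - q))).
{ induction N as [|N IH].
  - replace ((a + b) * (q * (1 - q ^ 0) / (1 - q))) with 0 by (simpl; field; lra).
    unfold periodization; simpl; lra.
  - rewrite periodization_S. pose proof (T (S N)) as HT.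
    pose proof (gamma_kernel_nonneg n delta (v + INR (S N) * L)) as G1.
    pose proof (gamma_kernel_nonneg n delta (v - INR (S N) * L)) as G2. fold g in G1, G2.
    split; [ lra | ].
    replace ((a + b) * (q * (1 - q ^ S N) / (1 - q))) with ((a + b) * (q * (1 - q ^ N) / (1 - q)) + (a + b) * q ^ S N).
    + lra.
    + simpl; field; lra. }
split; [ lra | ].
apply Rle_trans with (1 := proj2 G).
unfold alias_bound; fold a b. unfold Rdiv at 2; apply Rmult_le_compat_l; [ lra | ].
replace (/ (exp (delta * PI / h) - 1)) with (q / (1 - q)).
- unfold Rdiv; apply Rmult_le_compat_r; [ apply Rlt_le, Rinv_0_lt_compat; lra | ].
  pose proof (pow_lt q N Hq). nra.
- rewrite Eq. field. split; lra.
Qed.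

Lemma periodization_continuous (N : nat) (v : R) : continuous (fun u => periodization u N) v.
Proof.
assert (Hg : forall c v, continuous (fun u => g (u + c)) v).
{ intros c w. apply (continuous_comp (fun u => u + c) g); [ | apply gamma_kernel_continuous ].
  continuous_by_derive. }
induction N as [|N IH]; [ apply gamma_kernel_continuous | ].
apply (continuous_ext (fun u => periodization u N + (g (u + INR (S N) * L) + g (u + - (INR (S N) * L))))); [ reflexivity | ].
apply (continuous_plus (V := RN) (fun u => periodization u N)); [ exact IH | ].
apply (continuous_plus (V := RN) (fun u => g (u + INR (S N) * L))); apply Hg.
Qed.

(** Integrating a sum of translates against an [L]-periodic function over one
    period is integrating a single function over many periods. *)
Lemma periodization_integral (phi : R -> R) (sigma : R) (N : nat) :
  (forall x, continuous phi x) -> (forall x, phi (x + L) = phi x) ->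
  RInt (fun u => periodization (sigma + u) N * phi u) (- (L / 2)) (L / 2) =
  RInt (fun v => g v * phi (v - sigma)) (sigma - (INR N + 1 / 2) * L) (sigma + (INR N + 1 / 2) * L).
Proof.
intros Hphi Hper.
set (f := fun v => g v * phi (v - sigma)).
assert (Hf : forall v, continuous f v).
{ intros v; apply (continuous_mult g (fun v => phi (v - sigma))); [ apply gamma_kernel_continuous | ].
  apply (continuous_comp (fun v => v - sigma) phi); [ | apply Hphi ].
  continuous_by_derive. }
assert (Hex : forall a b, ex_RInt f a b) by (intros; apply ex_RInt_continuous_R, Hf).
assert (Hk : forall k x, phi (x + INR k * L) = phi x).
{ induction k as [|k IH]; intros x.
  - simpl; f_equal; ring.
  - rewrite S_INR. replace (x + (INR k + 1) * L) with (x + INR k * L + L) by ring. rewrite Hper; apply IH. }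
assert (Hshift : forall c, (forall x, phi (x + c) = phi x) ->
  RInt (fun u => g (sigma + u + c) * phi u) (- (L / 2)) (L / 2) = RInt f (sigma + c - L / 2) (sigma + c + L / 2)).
{ intros c Hc.
  rewrite (RInt_ext _ (fun u => scal 1 (f (1 * u + (sigma + c))))).
  - rewrite (RInt_comp_lin (V := RC) f 1 (sigma + c)); [ | apply Hex ].
    f_equal; ring.
  - intros u _. change (g (sigma + u + c) * phi u = 1 * (g (1 * u + (sigma + c)) * phi (1 * u + (sigma + c) - sigma))).
    replace (1 * u + (sigma + c) - sigma) with (u + c) by ring. rewrite Hc.
    replace (1 * u + (sigma + c)) with (sigma + u + c) by ring. ring. }
assert (Hc2 : forall c x, continuous (fun u => g (sigma + u + c) * phi u) x).
{ intros c x; apply (continuous_mult (fun u => g (sigma + u + c)) phi); [ | apply Hphi ].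
  apply (continuous_comp (fun u => sigma + u + c) g); [ | apply gamma_kernel_continuous ].
  continuous_by_derive. }
induction N as [|N IH].
- unfold periodization; simpl sum_f_R0.
  rewrite (RInt_ext _ (fun u => g (sigma + u + 0) * phi u)).
  + rewrite Hshift; [ simpl INR; f_equal; field | intros; f_equal; ring ].
  + intros u _; rewrite Rplus_0_r; reflexivity.
- set (s := INR (S N) * L).
  rewrite (RInt_ext _ (fun u => plus (periodization (sigma + u) N * phi u)
     (plus (g (sigma + u + s) * phi u) (g (sigma + u + - s) * phi u)))).
  2:{ intros u _; rewrite periodization_S; unfold plus, s; simpl. unfold Rminus; ring. }
  rewrite RInt_plus.
  2:{ apply ex_RInt_continuous_R; intros x; apply (continuous_mult (fun u => periodization (sigma + u) N) phi); [ | apply Hphi ].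
      apply (continuous_translate sigma (fun v => periodization v N)), periodization_continuous. }
  2:{ apply ex_RInt_continuous_R; intros x.
      apply (continuous_plus (V := RN) (fun u => g (sigma + u + s) * phi u)); apply Hc2. }
  rewrite RInt_plus; [ | apply ex_RInt_continuous_R, Hc2 | apply ex_RInt_continuous_R, Hc2 ].
  rewrite IH (Hshift s); [ | intros; apply Hk ].
  rewrite (Hshift (- s)).
  2:{ intros x. rewrite -(Hk (S N) (x + - s)). f_equal. unfold s; ring. }
  replace (sigma + s - L / 2) with (sigma + (INR N + 1 / 2) * L) by (unfold s; rewrite S_INR; field).
  replace (sigma + s + L / 2) with (sigma + (INR (S N) + 1 / 2) * L) by (unfold s; field).
  replace (sigma + - s - L / 2) with (sigma - (INR (S N) + 1 / 2) * L) by (unfold s; field).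
  replace (sigma + - s + L / 2) with (sigma - (INR N + 1 / 2) * L) by (unfold s; rewrite S_INR; field).
  set (x1 := sigma - (INR (S N) + 1 / 2) * L); set (x2 := sigma - (INR N + 1 / 2) * L).
  set (x3 := sigma + (INR N + 1 / 2) * L); set (x4 := sigma + (INR (S N) + 1 / 2) * L).
  rewrite -(RInt_Chasles f x1 x2 x4); [ | apply Hex | apply Hex ].
  rewrite -(RInt_Chasles f x2 x3 x4); [ | apply Hex | apply Hex ].
  change (RInt f x2 x3 + (RInt f x3 x4 + RInt f x1 x2) = RInt f x1 x2 + (RInt f x2 x3 + RInt f x3 x4)).
  ring.
Qed.

Lemma alias_bound_continuous (v : R) : continuous alias_bound v.
Proof. apply continuous_of_derive; unfold alias_bound; auto_derive; pose proof alias_ratio_pos; lra. Qed.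

(** The half-line integral is a limit of integrals, over one period, of
    periodizations that all lie within [alias_bound] of [g]. *)
Lemma fejer_alias_bound (sigma mean : R) (N : nat) :
  is_int_from (V := RN) 0 (fun v => g v * fejer h N (v - sigma)) (L * mean) ->
  Rabs (mean - fejer_mean h (fun u => g (sigma + u)) N)
    <= fejer_mean h (fun u => alias_bound (sigma + u)) N.
Proof.
intros Hint.
pose proof (period_pos h Hh) as HL; fold L in HL.
set (f := fun v => g v * fejer h N (v - sigma)).
assert (Hg : forall x, continuous g x) by (intros; apply gamma_kernel_continuous).
assert (Hf : forall v, continuous f v).
{ intros v; apply (continuous_mult g (fun v => fejer h N (v - sigma))); [ apply Hg | ].
  apply (continuous_comp (fun v => v - sigma) (fejer h N)); [ | apply fejer_continuous ].
  continuous_by_derive. }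
assert (Hex : forall a b, ex_RInt f a b) by (intros; apply ex_RInt_continuous_R, Hf).
(* Unfold each mean to a long interval; below 0 the kernel vanishes. *)
assert (Hlim : is_lim_seq (fun R => fejer_mean h (fun u => periodization (sigma + u) R) N) mean).
{ assert (H1 : filterlim (fun b => RInt f 0 b) (Rbar_locally p_infty) (locally (L * mean))).
  { apply (is_int_from_RInt (V := RC) 0 f); [ | exact Hint ].
    intros b _; apply (RInt_correct (V := RC)), Hex. }
  assert (H2 : is_lim_seq (fun R => RInt f 0 (sigma + (INR R + 1 / 2) * L)) (L * mean)).
  { apply (filterlim_comp _ _ _ (fun R => sigma + (INR R + 1 / 2) * L) (fun b => RInt f 0 b) _ (Rbar_locally p_infty) _); [ | exact H1 ].
    assert (E : is_lim_seq (fun R => sigma + (INR R + 1 / 2) * L) p_infty); [ | exact E ].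
    apply (is_lim_seq_ext (fun R => INR R * L + (sigma + L / 2))); [ intros; field | ].
    refine (is_lim_seq_plus _ _ p_infty (sigma + L / 2) p_infty _ (is_lim_seq_const _) _); [ | reflexivity ].
    replace p_infty with (Rbar_mult p_infty L).
    - apply is_lim_seq_scal_r, is_lim_seq_INR.
    - simpl; destruct (Rle_dec 0 L) as [H|H]; [ destruct (Rle_lt_or_eq_dec 0 L H); [ reflexivity | exfalso; lra ] | exfalso; lra ]. }
  replace (Finite mean) with (Rbar_mult (L * mean) (/ L)) by (simpl; f_equal; field; lra).
  refine (is_lim_seq_ext_loc _ _ _ _ (is_lim_seq_scal_r _ (/ L) _ H2)).
  destruct (INR_unbounded (sigma / L)) as [R0 HR0].
  exists R0; intros R HR.
  enough (E : RInt (fun u => periodization (sigma + u) R * fejer h N u) (- (L / 2)) (L / 2) = RInt f 0 (sigma + (INR R + 1 / 2) * L)).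
  { unfold fejer_mean; fold L; rewrite E; reflexivity. }
  rewrite (periodization_integral (fejer h N) sigma R); [ | apply fejer_continuous | apply fejer_period, Hh ].
  fold f.
  assert (HR' : INR R0 <= INR R) by (apply le_INR, HR).
  assert (Hs : sigma - (INR R + 1 / 2) * L <= 0).
  { apply Rmult_gt_compat_r with (r := L) in HR0; [ | exact HL ].
    replace (sigma / L * L) with sigma in HR0 by (field; lra). nra. }
  rewrite -(RInt_Chasles f (sigma - (INR R + 1 / 2) * L) 0); [ | apply Hex | apply Hex ].
  rewrite (RInt_ext f (fun _ => 0) (sigma - (INR R + 1 / 2) * L) 0).
  - rewrite RInt_const.
    change ((0 - (sigma - (INR R + 1 / 2) * L)) * 0 + RInt f 0 (sigma + (INR R + 1 / 2) * L) =
      RInt f 0 (sigma + (INR R + 1 / 2) * L)).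
    rewrite Rmult_0_r Rplus_0_l; reflexivity.
  - intros x. rewrite Rmin_left; [ | exact Hs ]. rewrite Rmax_right; [ | exact Hs ]. intros [_ Hx].
    unfold f, g. rewrite gamma_kernel_nonpos; [ apply Rmult_0_l | exact Hn | lra ]. }
assert (Hb : forall R, 0 <= fejer_mean h (fun u => periodization (sigma + u) R) N - fejer_mean h (fun u => g (sigma + u)) N
   <= fejer_mean h (fun u => alias_bound (sigma + u)) N).
{ intros R.
  rewrite -fejer_mean_minus; [ | apply (continuous_translate sigma (fun v => periodization v R)), periodization_continuous | apply (continuous_translate sigma g), Hg ].
  assert (Hc : forall x, continuous (fun u => periodization (sigma + u) R - g (sigma + u)) x).
  { intros x; apply (continuous_minus (V := RN) (fun u => periodization (sigma + u) R) (fun u => g (sigma + u)));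
      [ apply (continuous_translate sigma (fun v => periodization v R)), periodization_continuous | apply (continuous_translate sigma g), Hg ]. }
  split.
  - rewrite -(fejer_mean_const h Hh 0 N).
    apply fejer_mean_le; auto; [ intros; apply continuous_const | intros; apply periodization_bound ].
  - apply fejer_mean_le; auto; [ apply (continuous_translate sigma alias_bound), alias_bound_continuous | intros; apply periodization_bound ]. }
set (c := fejer_mean h (fun u => g (sigma + u)) N) in *.
assert (Hl : is_lim_seq (fun R => fejer_mean h (fun u => periodization (sigma + u) R) N - c) (mean - c)).
{ apply is_lim_seq_minus'; [ exact Hlim | apply is_lim_seq_const ]. }
pose proof (is_lim_seq_le _ _ _ _ (fun R => proj1 (Hb R)) (is_lim_seq_const 0) Hl) as B1.
pose proof (is_lim_seq_le _ _ _ _ (fun R => proj2 (Hb R)) Hl (is_lim_seq_const _)) as B2.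
simpl in B1, B2. apply Rabs_le; lra.
Qed.

End Periodization.

(** * Poisson summation for the gamma kernel *)

(** The real part of [c e^(i omega sigma) e^(- (delta + i omega) s)]. *)
Definition damped_wave (delta omega sigma : R) (c : C) (s : R) : R :=
  exp (- delta * s) * (Re c * cos (omega * (sigma - s)) - Im c * sin (omega * (sigma - s))).

Lemma damped_wave_derive (delta omega sigma : R) (c : C) (s : R) :
  is_derive (damped_wave delta omega sigma c) s (- damped_wave delta omega sigma (c * (delta, omega))%C s).
Proof.
destruct c as [p q]; unfold damped_wave, Re, Im; simpl.
auto_derive; [ trivial | unfold Rminus; ring ].
Qed.

Lemma damped_wave_bound (delta omega sigma : R) (c : C) (s : R) :
  Rabs (damped_wave delta omega sigma c s) <= (Rabs (Re c) + Rabs (Im c)) * exp (- delta * s).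
Proof.
unfold damped_wave. rewrite Rabs_mult (Rabs_pos_eq (exp _)); [ | apply Rlt_le, exp_pos ].
rewrite Rmult_comm. apply Rmult_le_compat_r; [ apply Rlt_le, exp_pos | ].
refine (Rle_trans _ _ _ (Rabs_triang _ _) _). rewrite Rabs_Ropp !Rabs_mult.
set (y := omega * (sigma - s)).
assert (Rabs (cos y) <= 1) by (apply Rabs_le; pose proof (COS_bound y); lra).
assert (Rabs (sin y) <= 1) by (apply Rabs_le; pose proof (SIN_bound y); lra).
pose proof (Rabs_pos (Re c)); pose proof (Rabs_pos (Im c)). nra.
Qed.

Lemma right_half_plane_neq_0 (delta omega : R) : 0 < delta -> (delta, omega) <> RtoC 0.
Proof. intros H E; injection E; lra. Qed.

(** Differentiation multiplies the coefficient of a damped wave by [- z],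
    [z = delta + i omega]; so Taylor's formula at infinity applies to the waves
    with coefficients [z^j / z^(n+1)], [0 <= j <= n+1]. *)
Lemma gamma_kernel_fourier (n : nat) (delta omega sigma : R) : 0 < delta ->
  is_int_from (V := RN) 0 (fun s => gamma_kernel n delta s * cos (omega * (sigma - s)))
    (Re (Cexp (Ci * RtoC (omega * sigma)) / (delta, omega) ^ (S n))%C).
Proof.
intros Hd.
set (z := (delta, omega) : C).
assert (Hz : z <> RtoC 0) by (apply right_half_plane_neq_0, Hd).
set (c := fun j => (z ^ j / z ^ (S n))%C).
set (u := fun j => damped_wave delta omega sigma (c j)).
assert (HC : exists B, forall j, (j <= S n)%nat -> Rabs (Re (c j)) + Rabs (Im (c j)) <= B).
{ clearbody c; clear. induction (S n) as [|k [B IH]].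
  - eexists; intros j Hj. replace j with O by lia. apply Rle_refl.
  - exists (Rmax B (Rabs (Re (c (S k))) + Rabs (Im (c (S k))))); intros j Hj.
    destruct (Nat.eq_dec j (S k)) as [->|Hjk]; [ apply Rmax_r | ].
    apply Rle_trans with B; [ apply IH; lia | apply Rmax_l ]. }
destruct HC as [B HC].
assert (E : Re (Cexp (Ci * RtoC (omega * sigma)) / z ^ (S n))%C = u O 0).
{ unfold u, damped_wave. rewrite Rmult_0_r exp_0 Rmult_1_l Rminus_0_r.
  assert (Ec : c O = (/ z ^ S n)%C) by (unfold c, Cdiv; simpl; ring).
  rewrite Ec. destruct (/ z ^ S n)%C as [p q] eqn:Ep. unfold Cdiv; rewrite Ep.
  unfold Cexp, Ci, RtoC, Re, Im; simpl.
  replace (0 * (omega * sigma) - 1 * 0) with 0 by ring.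
  replace (0 * 0 + 1 * (omega * sigma)) with (omega * sigma) by ring.
  rewrite exp_0; ring. }
rewrite E.
refine (is_int_from_ext (V := RC) 0 _ _ _ _
  (taylor_at_infinity (V := RC) n u 0 delta B Hd _ _ _)).
- intros s Hs.
  change ((s - 0) ^ n / INR (fact n) * u (S n) s = gamma_kernel n delta s * cos (omega * (sigma - s))).
  unfold u, damped_wave, gamma_kernel. rewrite Rminus_0_r Rmax_right; [ | lra ].
  replace (c (S n)) with (RtoC 1).
  + unfold Re, Im; simpl. ring.
  + unfold c; symmetry; apply Cinv_r, Cpow_nz, Hz.
- intros j s _. apply continuous_of_derive; eexists; apply damped_wave_derive.
- intros j s Hj Hs. unfold u.
  replace (c (S j)) with (c j * z)%C; [ apply damped_wave_derive | ].
  unfold c; simpl; unfold Cdiv; ring.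
- intros j s Hj Hs. refine (Rle_trans _ _ _ (damped_wave_bound _ _ _ _ _) _).
  apply Rmult_le_compat_r; [ apply Rlt_le, exp_pos | apply HC, Hj ].
Qed.

Section Poisson.
Context (h : R) (Hh : 0 < h) (delta : R) (Hd : 0 < delta) (n : nat) (Hn : (1 <= n)%nat).
Let L := 2 * PI / h.
Let g := gamma_kernel n delta.

(** Up to the factor [1 / L], the terms of index [k] and [- k] in the Fourier
    series of the periodized kernel are conjugate; this is their real part. *)
Definition fourier_mode (sigma : R) (k : nat) : R :=
  Re (Cexp (Ci * RtoC (INR k * h * sigma)) / (delta, (INR k * h)%R) ^ (S n))%C.

Lemma dirichlet_transform (sigma : R) (N : nat) :
  is_int_from (V := RN) 0 (fun v => g v * dirichlet h N (v - sigma)) (sym_sum (fourier_mode sigma) N).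
Proof.
assert (H : forall k, is_int_from (V := RN) 0 (fun v => g v * cos (INR k * h * (v - sigma))) (fourier_mode sigma k)).
{ intros k.
  refine (is_int_from_ext (V := RC) 0 _ _ _ _ (gamma_kernel_fourier n delta (INR k * h) sigma Hd)).
  intros v _. unfold g; f_equal. rewrite -cos_neg; f_equal; ring. }
induction N as [|N IH].
- apply H.
- rewrite sym_sum_S.
  refine (is_int_from_ext (V := RC) 0 _ _ _ _
   (is_int_from_plus (V := RC) _ _ _ _ _ IH (is_int_from_scal (V := RC) _ 2 _ _ (H (S N))))).
  intros v _.
  change (g v * dirichlet h N (v - sigma) + 2 * (g v * cos (INR (S N) * h * (v - sigma))) = g v * dirichlet h (S N) (v - sigma)).
  unfold dirichlet. rewrite sym_sum_S. ring.
Qed.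

Lemma fejer_transform (sigma : R) (N : nat) :
  is_int_from (V := RN) 0 (fun v => g v * fejer h N (v - sigma))
    (sum_f_R0 (fun i => sym_sum (fourier_mode sigma) i) N / INR (S N)).
Proof.
assert (H : is_int_from (V := RN) 0 (fun v => g v * sum_f_R0 (fun i => dirichlet h i (v - sigma)) N)
    (sum_f_R0 (fun i => sym_sum (fourier_mode sigma) i) N)).
{ induction N as [|N IH]; [ apply dirichlet_transform | ].
  refine (is_int_from_ext (V := RC) 0 _ _ _ _
   (is_int_from_plus (V := RC) _ _ _ _ _ IH (dirichlet_transform sigma (S N)))).
  intros v _. symmetry; apply Rmult_plus_distr_l. }
refine (is_int_from_ext (V := RC) 0 _ _ _ _
  (eq_rect _ (is_int_from (V := RN) 0 _) (is_int_from_scal (V := RC) _ (/ INR (S N)) _ _ H) _ _)).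
- intros v _. unfold fejer, Rdiv.
  change (/ INR (S N) * (g v * sum_f_R0 (fun i => dirichlet h i (v - sigma)) N) =
     g v * (sum_f_R0 (fun i => dirichlet h i (v - sigma)) N * / INR (S N))). ring.
- apply Rmult_comm.
Qed.

(** Poisson summation, as an inequality. Averaging the partial Fourier sums
    does not change their limit [H] and turns them into Fejer means of the
    kernel, which [fejer_alias_bound] compares with [g] over a single period. *)
Lemma aliasing (sigma H : R) :
  is_lim_seq (fun N => sym_sum (fourier_mode sigma) N / L) H -> Rabs (H - g sigma) <= alias_bound h delta n sigma.
Proof.
intros HH.
pose proof (period_pos h Hh) as HL; fold L in HL.
set (mean := fun N => sum_f_R0 (fun i => sym_sum (fourier_mode sigma) i / L) N / INR (S N)).
assert (Hmean : is_lim_seq mean H).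
{ apply is_lim_seq_Reals in HH. apply Cesaro_1 in HH. apply is_lim_seq_Reals in HH.
  apply is_lim_seq_incr_1 in HH. exact HH. }
assert (Hb : forall N, Rabs (mean N - fejer_mean h (fun u => g (sigma + u)) N)
   <= fejer_mean h (fun u => alias_bound h delta n (sigma + u)) N).
{ intros N. apply (fejer_alias_bound h Hh delta Hd n Hn).
  fold L g. replace (L * mean N) with (sum_f_R0 (fun i => sym_sum (fourier_mode sigma) i) N / INR (S N)).
  - apply fejer_transform.
  - unfold mean. rewrite -(scal_sum (fun i => sym_sum (fourier_mode sigma) i) N (/ L)).
    field. split; [ lra | apply not_0_INR; lia ]. }
pose proof (fejer_mean_limit h Hh _ (continuous_translate sigma g (gamma_kernel_continuous n delta))) as L1.
pose proof (fejer_mean_limit h Hh _ (continuous_translate sigma _ (alias_bound_continuous h Hh delta Hd n))) as L2.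
rewrite Rplus_0_r in L1. rewrite Rplus_0_r in L2.
refine (is_lim_seq_le _ _ (Rabs (H - g sigma)) (alias_bound h delta n sigma) Hb _ L2).
apply (is_lim_seq_abs _ (H - g sigma)). apply is_lim_seq_minus'; [ exact Hmean | exact L1 ].
Qed.

End Poisson.

(** * The integrals of (1 + u^2)^-j *)

Lemma one_plus_sq_pos (u : R) : 0 < 1 + u ^ 2.
Proof. pose proof (pow2_ge_0 u); lra. Qed.

(** The arc tangent for [j = 1]. For [j = m / 2] the tail of this integral
    bounds the truncation error. *)
Definition atan_int (j : nat) (x : R) : R := RInt (fun u => / (1 + u ^ 2) ^ j) 0 x.

Lemma atan_int_integrand_continuous (j : nat) (u : R) : continuous (fun u => / (1 + u ^ 2) ^ j) u.
Proof.
apply continuous_of_derive; auto_derive.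
apply pow_nonzero, Rgt_not_eq. pose proof (one_plus_sq_pos u); lra.
Qed.

Lemma atan_int_is_RInt (j : nat) (a b : R) : is_RInt (fun u => / (1 + u ^ 2) ^ j) a b (atan_int j b - atan_int j a).
Proof.
assert (H : forall a b, ex_RInt (fun u => / (1 + u ^ 2) ^ j) a b) by (intros; apply ex_RInt_continuous_R, atan_int_integrand_continuous).
replace (atan_int j b - atan_int j a) with (RInt (fun u => / (1 + u ^ 2) ^ j) a b).
- apply (RInt_correct (V := RC)), H.
- unfold atan_int. rewrite -(RInt_Chasles _ 0 a b); auto.
  symmetry; apply (minus_plus_l (G := R_AbelianGroup)).
Qed.

Lemma atan_int_mono (j : nat) (a b : R) : a <= b -> atan_int j a <= atan_int j b.
Proof.
intros Hab. enough (0 <= atan_int j b - atan_int j a) by lra.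
rewrite -(is_RInt_unique _ _ _ _ (atan_int_is_RInt j a b)).
apply RInt_ge_0; [ exact Hab | eexists; apply atan_int_is_RInt | ].
intros x _; apply Rlt_le, Rinv_0_lt_compat, pow_lt, one_plus_sq_pos.
Qed.

Lemma atan_int_0 (j : nat) : atan_int j 0 = 0.
Proof. unfold atan_int; apply (RInt_point (V := RC)). Qed.

Lemma atan_int_rectangle (j : nat) (a b : R) : 0 <= a -> a <= b -> (b - a) * / (1 + b ^ 2) ^ j <= atan_int j b - atan_int j a.
Proof.
intros Ha Hab.
refine (is_RInt_le (fun _ => / (1 + b ^ 2) ^ j) _ a b _ _ Hab _ (atan_int_is_RInt j a b) _).
- apply (is_RInt_const (V := RN)).
- intros x Hx. apply Rinv_le_contravar; [ apply pow_lt, one_plus_sq_pos | ].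
  apply pow_incr; pose proof (one_plus_sq_pos x); split; [ lra | ].
  apply Rplus_le_compat_l, pow_incr; lra.
Qed.

Lemma atan_int_1 (x : R) : atan_int 1 x = atan x.
Proof.
assert (H : is_RInt (fun u => / (1 + u ^ 2) ^ 1) 0 x (atan x - atan 0)).
{ apply (is_RInt_derive (V := RC) atan).
  - intros u _. rewrite pow_1. replace (1 + u ^ 2) with (1 + u²) by (unfold Rsqr; ring).
    apply is_derive_atan.
  - intros u _; apply atan_int_integrand_continuous. }
unfold atan_int. rewrite (is_RInt_unique _ _ _ _ H) atan_0; ring.
Qed.

(** Integrate the derivative of [u / (1 + u^2)^j]. *)
Lemma atan_int_succ (j : nat) (x : R) : (1 <= j)%nat ->
  atan_int (S j) x = (2 * INR j - 1) / (2 * INR j) * atan_int j x + x / (2 * INR j * (1 + x ^ 2) ^ j).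
Proof.
intros Hj. assert (Hj' : 0 < INR j) by (apply lt_0_INR; lia).
set (F := fun u => u / (2 * INR j * (1 + u ^ 2) ^ j)).
assert (H : is_RInt (fun u => plus (/ (1 + u ^ 2) ^ S j) (scal (- ((2 * INR j - 1) / (2 * INR j))) (/ (1 + u ^ 2) ^ j)))
   0 x (F x - F 0)).
{ apply (is_RInt_derive (V := RC) F).
  - intros u _. pose proof (one_plus_sq_pos u) as Hu.
    assert (Hu' : (1 + u ^ 2) ^ j <> 0) by (apply pow_nonzero; lra).
    unfold F. auto_derive.
    + apply Rmult_integral_contrapositive; split; [ lra | exact Hu' ].
    + change (match j with O => 0 | _ => INR j end) with (INR j).
      unfold plus, scal; simpl; unfold mult; simpl.
      replace (u * (u * 1)) with (u ^ 2) by ring.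
      destruct j as [|j]; [ lia | ]. simpl Nat.pred. simpl pow in Hu' |- *.
      replace (u * (u * 1)) with (u ^ 2) in * by ring.
      set (q := (1 + u ^ 2) ^ j) in *. assert (q <> 0) by (intros Hq; apply Hu'; rewrite Hq; ring).
      field_simplify_eq; [ ring | ]. repeat split; try lra; auto.
  - intros u _. apply (continuous_plus (V := RN)); [ apply atan_int_integrand_continuous | ].
    apply (continuous_scal_r (V := RN)), atan_int_integrand_continuous. }
assert (H2 : is_RInt (fun u => plus (/ (1 + u ^ 2) ^ S j) (scal (- ((2 * INR j - 1) / (2 * INR j))) (/ (1 + u ^ 2) ^ j)))
   0 x (plus (atan_int (S j) x - atan_int (S j) 0) (scal (- ((2 * INR j - 1) / (2 * INR j))) (atan_int j x - atan_int j 0)))).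
{ apply (is_RInt_plus (V := RN)); [ apply atan_int_is_RInt | ].
  apply (is_RInt_scal (V := RN)), atan_int_is_RInt. }
pose proof (is_RInt_unique _ _ _ _ H) as E1. rewrite (is_RInt_unique _ _ _ _ H2) in E1.
change (atan_int (S j) x - atan_int (S j) 0 + - ((2 * INR j - 1) / (2 * INR j)) * (atan_int j x - atan_int j 0) = F x - F 0) in E1.
assert (F0 : F 0 = 0) by (unfold F, Rdiv; apply Rmult_0_l).
rewrite !atan_int_0 F0 in E1. change (x / (2 * INR j * (1 + x ^ 2) ^ j)) with (F x).
lra.
Qed.

(** [(2 i - 1)!! / (2 i)!!]. *)
Fixpoint wallis (i : nat) : R :=
  match i with O => 1 | S i' => (2 * INR i' + 1) / (2 * INR i' + 2) * wallis i' end.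

Lemma wallis_pos (i : nat) : 0 < wallis i.
Proof.
induction i as [|i IH]; simpl; [ lra | ]. pose proof (pos_INR i).
apply Rmult_lt_0_compat; [ apply Rdiv_lt_0_compat; lra | exact IH ].
Qed.

Lemma is_lim_atan_p : is_lim atan p_infty (PI / 2).
Proof.
apply (is_lim_ext_loc (fun x => PI / 2 - atan (/ x))).
- exists 0; intros x Hx. rewrite atan_inv; [ ring | exact Hx ].
- replace (PI / 2) with (PI / 2 - atan 0) by (rewrite atan_0; ring).
  apply is_lim_minus'; [ rewrite atan_0 Rminus_0_r; apply is_lim_const | ].
  apply (filterlim_comp _ _ _ Rinv atan _ (locally 0)).
  + apply (is_lim_inv (fun x => x) p_infty p_infty); [ apply is_lim_id | discriminate ].
  + apply (continuous_of_derive atan 0); eexists; apply is_derive_atan.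
Qed.

Lemma atan_int_limit (i : nat) : is_lim (atan_int (S i)) p_infty (PI / 2 * wallis i).
Proof.
induction i as [|i IH].
- simpl wallis; rewrite Rmult_1_r.
  apply (is_lim_ext atan); [ intros; symmetry; apply atan_int_1 | apply is_lim_atan_p ].
- set (k := 2 * INR (S i)).
  assert (Hk : 2 <= k) by (unfold k; rewrite S_INR; pose proof (pos_INR i); lra).
  apply (is_lim_ext (fun x => (k - 1) / k * atan_int (S i) x + x / (k * (1 + x ^ 2) ^ S i))).
  { intros x; rewrite (atan_int_succ (S i)); [ reflexivity | lia ]. }
  replace (PI / 2 * wallis (S i)) with ((k - 1) / k * (PI / 2 * wallis i) + 0).
  2:{ unfold k. simpl wallis. rewrite (S_INR i). pose proof (pos_INR i). field. lra. }
  apply is_lim_plus'; [ exact (is_lim_scal_l _ ((k - 1) / k) _ _ IH) | ].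
  apply (is_lim_le_le_loc (fun _ => 0) (fun x => / x)).
  + exists 0; intros x Hx. pose proof (one_plus_sq_pos x) as Hu.
    assert (H1 : 1 + x ^ 2 <= (1 + x ^ 2) ^ S i).
    { rewrite -{1}(pow_1 (1 + x ^ 2)). apply Rle_pow; [ pose proof (pow2_ge_0 x); lra | lia ]. }
    split; [ apply Rlt_le, Rdiv_lt_0_compat; [ lra | apply Rmult_lt_0_compat; [ lra | apply pow_lt, Hu ] ] | ].
    replace (/ x) with (x / x ^ 2) by (field; lra).
    apply Rmult_le_compat_l; [ lra | ].
    apply Rinv_le_contravar; [ apply pow_lt, Hx | ]. pose proof (pow2_ge_0 x). nra.
  + apply is_lim_const.
  + replace (Finite 0) with (Rbar_inv p_infty) by reflexivity.
    apply is_lim_inv; [ apply is_lim_id | discriminate ].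
Qed.

Lemma atan_int_le_limit (i : nat) (x : R) : atan_int (S i) x <= PI / 2 * wallis i.
Proof.
refine (is_lim_le_loc (fun _ => atan_int (S i) x) (atan_int (S i)) p_infty (atan_int (S i) x) (PI / 2 * wallis i) _ (is_lim_const _ _) (atan_int_limit i)).
exists x; intros y Hy; apply atan_int_mono; lra.
Qed.

(** * The Gaussian integral and the gamma function *)

Definition gauss_int (x : R) : R := RInt (fun w => exp (- w ^ 2)) 0 x.

Lemma gauss_int_derive (x : R) : is_derive gauss_int x (exp (- x ^ 2)).
Proof.
apply (is_derive_RInt (V := RC) (fun w => exp (- w ^ 2)) gauss_int 0 x).
- exists (mkposreal 1 Rlt_0_1); intros y _. apply (RInt_correct (V := RC)), ex_RInt_continuous_R.
  intros; continuous_by_derive.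
- continuous_by_derive.
Qed.

Lemma gauss_int_nonneg (x : R) : 0 <= x -> 0 <= gauss_int x.
Proof.
intros Hx; unfold gauss_int. apply RInt_ge_0; [ exact Hx | | intros; apply Rlt_le, exp_pos ].
apply ex_RInt_continuous_R; intros; continuous_by_derive.
Qed.

(** A companion whose derivative cancels that of [gauss_int x ^ 2]. *)
Definition gauss_aux (x : R) : R := RInt (fun t => exp (- x ^ 2 * (1 + t ^ 2)) / (1 + t ^ 2)) 0 1.

Lemma gauss_aux_ex (x a b : R) : ex_RInt (fun t => exp (- x ^ 2 * (1 + t ^ 2)) / (1 + t ^ 2)) a b.
Proof.
apply ex_RInt_continuous_R; intros t; apply continuous_of_derive; auto_derive.
pose proof (one_plus_sq_pos t); simpl in *; lra.
Qed.

Lemma gauss_aux_derive (x : R) : is_derive gauss_aux x (- (2 * gauss_int x * exp (- x ^ 2))).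
Proof.
assert (D : forall t y, is_derive (fun u => exp (- u ^ 2 * (1 + t ^ 2)) / (1 + t ^ 2)) y (- 2 * y * exp (- y ^ 2 * (1 + t ^ 2)))).
{ intros t y. pose proof (one_plus_sq_pos t) as Hc. revert Hc; generalize (1 + t ^ 2); intros c Hc.
  auto_derive; [ lra | ]. replace (y * (y * 1)) with (y ^ 2) by ring. field; lra. }
replace (- (2 * gauss_int x * exp (- x ^ 2))) with (RInt (fun t => Derive (fun u => exp (- u ^ 2 * (1 + t ^ 2)) / (1 + t ^ 2)) x) 0 1).
- apply (is_derive_RInt_param (fun x t => exp (- x ^ 2 * (1 + t ^ 2)) / (1 + t ^ 2)) 0 1 x).
  + apply filter_forall; intros y t _; eexists; apply D.
  + intros t _.
    apply (continuity_2d_pt_ext (fun u v => - 2 * u * exp (- u ^ 2 * (1 + v ^ 2)))).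
    { intros u v; symmetry; apply is_derive_unique, D. }
    apply continuity_2d_pt_mult.
    * apply continuity_1d_2d_pt_comp with (f := fun u => - 2 * u) (g := fun u v => u).
      -- apply continuity_pt_of_derive; auto_derive; trivial.
      -- apply continuity_2d_pt_id1.
    * apply (continuity_1d_2d_pt_comp exp (fun u v => - u ^ 2 * (1 + v ^ 2))).
      -- apply continuity_pt_of_derive; auto_derive; trivial.
      -- apply continuity_2d_pt_mult.
         ++ apply (continuity_1d_2d_pt_comp (fun u => - u ^ 2) (fun u v => u)); [ | apply continuity_2d_pt_id1 ].
            apply continuity_pt_of_derive; auto_derive; trivial.
         ++ apply (continuity_1d_2d_pt_comp (fun v => 1 + v ^ 2) (fun u v => v)); [ | apply continuity_2d_pt_id2 ].
            apply continuity_pt_of_derive; auto_derive; trivial.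
  + apply filter_forall; intros y; apply gauss_aux_ex.
- rewrite (RInt_ext _ (fun t => scal (- 2 * exp (- x ^ 2)) (scal x (exp (- (x * t + 0) ^ 2))))).
  + rewrite (RInt_scal (V := RC)).
    * rewrite (RInt_comp_lin (V := RC) (fun w => exp (- w ^ 2)) x 0 0 1).
      -- replace (x * 0 + 0) with 0 by ring. replace (x * 1 + 0) with x by ring. fold (gauss_int x).
         unfold scal; simpl; unfold mult; simpl. ring.
      -- apply ex_RInt_continuous_R; intros; continuous_by_derive.
    * apply ex_RInt_continuous_R; intros; apply continuous_of_derive; unfold scal; simpl; unfold mult; simpl. auto_derive; trivial.
  + intros t _. rewrite (is_derive_unique _ _ _ (D t x)).
    change (- 2 * x * exp (- x ^ 2 * (1 + t ^ 2)) = - 2 * exp (- x ^ 2) * (x * exp (- (x * t + 0) ^ 2))).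
    replace (- x ^ 2 * (1 + t ^ 2)) with (- x ^ 2 + - (x * t + 0) ^ 2) by ring.
    rewrite exp_plus; ring.
Qed.

Lemma gauss_aux_bound (x : R) : 0 <= gauss_aux x <= exp (- x ^ 2).
Proof.
unfold gauss_aux; split.
- apply RInt_ge_0; [ lra | apply gauss_aux_ex | ].
  intros t _; apply Rlt_le, Rdiv_lt_0_compat; [ apply exp_pos | apply one_plus_sq_pos ].
- assert (H : RInt (fun _ => exp (- x ^ 2)) 0 1 = exp (- x ^ 2)).
  { rewrite RInt_const. unfold scal; simpl; unfold mult; simpl. ring. }
  rewrite -H. apply RInt_le; [ lra | apply gauss_aux_ex | apply ex_RInt_continuous_R; intros; apply continuous_const | ].
  intros t _. pose proof (one_plus_sq_pos t); pose proof (pow2_ge_0 t); pose proof (pow2_ge_0 x).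
  apply Rle_trans with (exp (- x ^ 2 * (1 + t ^ 2))).
  + rewrite -{2}(Rmult_1_r (exp _)). apply Rmult_le_compat_l; [ apply Rlt_le, exp_pos | ].
    rewrite -Rinv_1. apply Rinv_le_contravar; lra.
  + destruct (Req_dec (- x ^ 2 * (1 + t ^ 2)) (- x ^ 2)) as [->|Hne]; [ apply Rle_refl | ].
    apply Rlt_le, exp_increasing. nra.
Qed.

Lemma gauss_identity (x : R) : gauss_int x ^ 2 + gauss_aux x = PI / 4.
Proof.
set (f := fun y => gauss_int y ^ 2 + gauss_aux y).
assert (D : forall y, is_derive f y 0).
{ intros y.
  refine (eq_ind (plus (2 * exp (- y ^ 2) * gauss_int y) (- (2 * gauss_int y * exp (- y ^ 2)))) (fun l => is_derive f y l) _ 0 _).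
  2:{ change (2 * exp (- y ^ 2) * gauss_int y + - (2 * gauss_int y * exp (- y ^ 2)) = 0). ring. }
  apply (is_derive_plus (V := RN) (fun y => gauss_int y ^ 2) gauss_aux); [ | apply gauss_aux_derive ].
  refine (eq_ind _ (fun l => is_derive (fun y => gauss_int y ^ 2) y l) (is_derive_pow gauss_int 2 y _ (gauss_int_derive y)) _ _).
  simpl; ring. }
assert (E0 : f 0 = PI / 4).
{ unfold f. replace (gauss_int 0) with 0 by (symmetry; apply (RInt_point (V := RC))).
  rewrite pow_i; [ | lia ]. rewrite Rplus_0_l. unfold gauss_aux.
  rewrite (RInt_ext _ (fun u => / (1 + u ^ 2) ^ 1)).
  - fold (atan_int 1 1). rewrite atan_int_1 atan_1. reflexivity.
  - intros t _. rewrite pow_1. replace (- 0 ^ 2 * (1 + t ^ 2)) with 0 by ring. rewrite exp_0. unfold Rdiv; apply Rmult_1_l. }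
rewrite -E0. change (f x = f 0).
destruct (MVT_gen f 0 x (fun _ => 0)) as [c [_ Hc]].
- intros; apply D.
- intros y _. apply continuity_pt_of_derive; eexists; apply D.
- lra.
Qed.

Lemma gauss_int_limit : is_lim gauss_int p_infty (sqrt PI / 2).
Proof.
assert (H : is_lim (fun x => PI / 4 - gauss_aux x) p_infty (PI / 4 - 0)).
{ apply is_lim_minus'; [ apply is_lim_const | ].
  apply (is_lim_le_le_loc (fun _ => 0) (fun x => 1 * exp (- 1 * x))).
  - exists 1; intros x Hx. pose proof (gauss_aux_bound x) as [B1 B2]. split; [ exact B1 | ].
    apply Rle_trans with (1 := B2). rewrite Rmult_1_l. apply Rlt_le, exp_increasing; nra.
  - apply is_lim_const.
  - apply (is_lim_exp_decay 1 1), Rlt_0_1. }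
rewrite Rminus_0_r in H.
replace (sqrt PI / 2) with (sqrt (PI / 4)).
- apply (is_lim_ext_loc (fun x => sqrt (PI / 4 - gauss_aux x))).
  + exists 0; intros x Hx. rewrite -(gauss_identity x).
    replace (gauss_int x ^ 2 + gauss_aux x - gauss_aux x) with (gauss_int x ^ 2) by ring. apply sqrt_pow2, gauss_int_nonneg; lra.
  + apply (filterlim_comp _ _ _ (fun x => PI / 4 - gauss_aux x) sqrt _ (locally (PI / 4))); [ exact H | ].
    apply continuity_pt_filterlim, continuity_pt_sqrt. pose proof PI_RGT_0; lra.
- unfold Rdiv; rewrite sqrt_mult_alt; [ | apply Rlt_le, PI_RGT_0 ].
  f_equal. replace (/ 4) with ((/ 2) ^ 2) by (simpl; field). apply sqrt_pow2; lra.
Qed.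

Definition is_Gamma (s l : R) : Prop :=
  is_RInt_gen (fun u => Rpower u (s - 1) * exp (- u)) (at_right 0) (Rbar_locally p_infty) l.

Lemma is_Gamma_unique (s l : R) : is_Gamma s l -> Gamma s = l.
Proof. intros H; exact (is_RInt_gen_unique (V := RC) _ l H). Qed.

Lemma is_RInt_gen_half_line (F f : R -> R) (l0 l1 : R) :
  (forall u, 0 < u -> is_derive F u (f u)) -> (forall u, 0 < u -> continuous f u) ->
  filterlim F (at_right 0) (locally l0) -> is_lim F p_infty l1 ->
  is_RInt_gen f (at_right 0) (Rbar_locally p_infty) (l1 - l0).
Proof.
intros HD Hc H0 H1.
assert (HP : filter_prod (at_right 0) (Rbar_locally p_infty) (fun ab => 0 < fst ab /\ 0 < snd ab)).
{ apply (Filter_prod _ _ _ (fun a => 0 < a) (fun b => 0 < b)).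
  - exists (mkposreal 1 Rlt_0_1); auto.
  - exists 0; auto.
  - auto. }
assert (W : forall a b x, 0 < a -> 0 < b -> Rmin a b <= x -> 0 < x).
{ intros a b x Ha Hb. unfold Rmin; destruct (Rle_dec a b); lra. }
apply (is_RInt_gen_ext (Derive F)).
- refine (filter_imp _ _ _ HP). intros [a b] [Ha Hb] x Hx; simpl in *.
  apply is_derive_unique, HD, (W a b); auto; lra.
- apply is_RInt_gen_Derive; try assumption.
  + refine (filter_imp _ _ _ HP). intros [a b] [Ha Hb] x Hx; simpl in *.
    eexists; apply HD, (W a b); auto; lra.
  + refine (filter_imp _ _ _ HP). intros [a b] [Ha Hb] x Hx; simpl in *.
    assert (Hx0 : 0 < x) by (apply (W a b); auto; lra).
    apply (continuous_ext_loc _ f); [ | apply Hc, Hx0 ].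
    exists (mkposreal x Hx0); intros y Hy. symmetry; apply is_derive_unique, HD.
    apply Rabs_lt_between' in Hy; simpl in Hy; lra.
Qed.

Lemma Rpower_at_0 (s : R) : 0 < s -> filterlim (fun u => Rpower u s) (at_right 0) (locally 0).
Proof.
intros Hs. unfold Rpower.
apply (filterlim_comp _ _ _ (fun u => s * ln u) exp _ (Rbar_locally m_infty)).
- apply (filterlim_comp _ _ _ ln (fun y => s * y) _ (Rbar_locally m_infty)); [ apply is_lim_ln_0 | ].
  intros P [B HB]. exists (B / s); intros x Hx. apply HB.
  apply Rmult_lt_reg_l with (/ s); [ apply Rinv_0_lt_compat, Hs | ].
  rewrite -Rmult_assoc Rinv_l; [ | lra ]. rewrite Rmult_1_l Rmult_comm; exact Hx.
- apply is_lim_exp_m.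
Qed.

Lemma Rpower_exp_at_infinity (s : R) : is_lim (fun u => Rpower u s * exp (- u)) p_infty 0.
Proof.
destruct (INR_unbounded s) as [n Hn].
apply (is_lim_le_le_loc (fun _ => 0) (fun u => INR (fact n) * 2 ^ n * exp (- (1 / 2) * u))).
- exists 1; intros u Hu. split; [ apply Rlt_le, Rmult_lt_0_compat; apply exp_pos | ].
  pose proof (pow_div_fact_exp_le 1 u n ltac:(lra) ltac:(lra)) as H.
  apply Rle_trans with (u ^ n * exp (- 1 * u)).
  + replace (- 1 * u) with (- u) by ring. apply Rmult_le_compat_r; [ apply Rlt_le, exp_pos | ].
    rewrite -Rpower_pow; [ | lra ]. apply Rle_Rpower; lra.
  + pose proof (INR_fact_lt_0 n) as Hf.
    apply Rmult_le_reg_l with (/ INR (fact n)); [ apply Rinv_0_lt_compat, Hf | ].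
    replace (/ INR (fact n) * (u ^ n * exp (- 1 * u))) with (u ^ n / INR (fact n) * exp (- 1 * u)) by (field; lra).
    apply Rle_trans with (1 := H). right. rewrite -!Rmult_assoc Rinv_l; [ | lra ].
    rewrite Rmult_1_l. f_equal; f_equal; field.
- apply is_lim_const.
- apply is_lim_exp_decay; lra.
Qed.

Lemma Rpower_derive (s u : R) : 0 < u -> is_derive (fun u => Rpower u s) u (s * Rpower u (s - 1)).
Proof. intros Hu. apply is_derive_Reals, derivable_pt_lim_power, Hu. Qed.

(** Integration by parts, with antiderivative [- u^s e^(- u)]. *)
Lemma is_Gamma_succ (s l : R) : 0 < s -> is_Gamma s l -> is_Gamma (s + 1) (s * l).
Proof.
intros Hs Hl. unfold is_Gamma.
assert (H : is_RInt_gen (fun u => Rpower u s * exp (- u) - s * (Rpower u (s - 1) * exp (- u)))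
   (at_right 0) (Rbar_locally p_infty) (-0 - -0)).
{ apply (is_RInt_gen_half_line (fun u => - (Rpower u s * exp (- u)))).
  - intros u Hu.
    replace (Rpower u s * exp (- u) - s * (Rpower u (s - 1) * exp (- u))) with
      (opp (plus (mult (s * Rpower u (s - 1)) (exp (- u))) (mult (Rpower u s) (- exp (- u)))))
      by (unfold opp, plus, mult; simpl; ring).
    apply (is_derive_opp (V := RN)).
    apply (is_derive_mult (fun u => Rpower u s) (fun u => exp (- u))); [ apply Rpower_derive, Hu | | intros; apply Rmult_comm ].
    auto_derive; [ trivial | ring ].
  - intros u Hu.
    assert (Hp : forall r, continuous (fun u => Rpower u r * exp (- u)) u).
    { intros r. apply (continuous_mult (fun u => Rpower u r)).
      - apply continuous_of_derive; eexists; apply Rpower_derive, Hu.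
      - continuous_by_derive. }
    apply (continuous_minus (V := RN)); [ apply Hp | ].
    apply (continuous_scal_r (V := RN) s), Hp.
  - apply (filterlim_comp _ _ _ (fun u => Rpower u s * exp (- u)) Ropp _ (locally 0)); [ | apply (filterlim_opp (V := RN)) ].
    replace (locally 0) with (locally (mult 0 (exp (- 0)))) by (f_equal; apply Rmult_0_l).
    refine (filterlim_comp_2 (G := locally 0) (H := locally (exp (- 0))) (fun u => Rpower u s) (fun u => exp (- u)) mult _ _ _).
    + apply Rpower_at_0, Hs.
    + apply (filterlim_filter_le_1 (F := locally 0)); [ apply filter_le_within | ].
      apply (continuous_of_derive (fun u => exp (- u)) 0); auto_derive; trivial.
    + apply (filterlim_mult (K := R_AbsRing)).
  - apply (is_lim_opp _ p_infty 0), Rpower_exp_at_infinity. }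
replace (s * l) with (plus (-0 - -0) (scal s l)) by (unfold plus, scal; simpl; unfold mult; simpl; ring).
refine (is_RInt_gen_ext _ _ _ _ (is_RInt_gen_plus (V := RN) _ _ _ _ H (is_RInt_gen_scal (V := RN) _ s _ Hl))).
apply filter_forall; intros ab u _.
replace (s + 1 - 1) with s by ring. unfold plus, scal; simpl; unfold mult; simpl. ring.
Qed.

Lemma is_Gamma_1 : is_Gamma 1 1.
Proof.
refine (eq_ind (-0 - -1) (is_Gamma 1) _ 1 _); [ unfold is_Gamma | ring ].
apply (is_RInt_gen_half_line (fun u => - exp (- u))).
- intros u Hu. rewrite Rminus_eq_0 Rpower_O; [ | exact Hu ]. auto_derive; [ trivial | ring ].
- intros u Hu. apply (continuous_mult (fun u => Rpower u (1 - 1))).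
  + apply continuous_of_derive; eexists; apply Rpower_derive, Hu.
  + continuous_by_derive.
- apply (filterlim_filter_le_1 (F := locally 0)); [ apply filter_le_within | ].
  replace (-1) with (- exp (- 0)) by (rewrite Ropp_0 exp_0; ring).
  apply (continuous_of_derive (fun u => - exp (- u)) 0); auto_derive; trivial.
- apply (is_lim_opp _ p_infty 0).
  apply (is_lim_ext (fun u => 1 * exp (- 1 * u))); [ | apply (is_lim_exp_decay 1 1), Rlt_0_1 ].
  intros u; rewrite Rmult_1_l; f_equal; ring.
Qed.

(** The substitution [u = w^2]: an antiderivative is [2 gauss_int (sqrt u)]. *)
Lemma is_Gamma_half : is_Gamma (1 / 2) (sqrt PI).
Proof.
unfold is_Gamma. replace (sqrt PI) with (2 * (sqrt PI / 2) - 2 * 0) by field.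
apply (is_RInt_gen_half_line (fun u => 2 * gauss_int (sqrt u))).
- intros u Hu.
  replace (Rpower u (1 / 2 - 1) * exp (- u)) with (2 * (/ (2 * sqrt u) * exp (- (sqrt u) ^ 2))).
  + apply is_derive_scal. apply (is_derive_comp gauss_int sqrt); [ apply gauss_int_derive | ].
    apply is_derive_Reals, derivable_pt_lim_sqrt, Hu.
  + rewrite pow2_sqrt; [ | lra ].
    replace (1 / 2 - 1) with (- / 2) by field. rewrite Rpower_Ropp Rpower_sqrt; [ | exact Hu ].
    field. apply Rgt_not_eq, sqrt_lt_R0, Hu.
- intros u Hu. apply (continuous_mult (fun u => Rpower u (1 / 2 - 1))).
  + apply continuous_of_derive; eexists; apply Rpower_derive, Hu.
  + continuous_by_derive.
- apply (filterlim_filter_le_1 (F := locally 0)); [ apply filter_le_within | ].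
  assert (E0 : gauss_int (sqrt 0) = 0) by (rewrite sqrt_0; apply (RInt_point (V := RC))).
  rewrite -{2}E0.
  apply (continuous_scal_r (V := RN) 2 (fun u => gauss_int (sqrt u))).
  apply (continuous_comp sqrt gauss_int).
  + apply continuity_pt_filterlim, continuity_pt_sqrt, Rle_refl.
  + apply continuous_of_derive; eexists; apply gauss_int_derive.
- apply (is_lim_scal_l (fun u => gauss_int (sqrt u)) 2 p_infty (sqrt PI / 2)).
  apply (filterlim_comp _ _ _ sqrt gauss_int _ (Rbar_locally p_infty)); [ apply filterlim_sqrt_p | apply gauss_int_limit ].
Qed.

(** Both gamma values obey the functional equation, so the quotient is
    [Gamma (1/2)^2 = pi] times a rational number. *)
Lemma Gamma_ratio (i : nat) :
  Gamma (3 / 2) * Gamma ((INR (2 * S i) - 1) / 2) / Gamma (INR (2 * S i) / 2) = PI / 2 * wallis i.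
Proof.
assert (H3 : Gamma (3 / 2) = 1 / 2 * sqrt PI).
{ apply is_Gamma_unique. replace (3 / 2) with (1 / 2 + 1) by field. apply is_Gamma_succ; [ lra | apply is_Gamma_half ]. }
assert (H : exists p q, is_Gamma (INR i + 1 / 2) (p * sqrt PI) /\ is_Gamma (INR i + 1) q /\ 0 < q /\ p = wallis i * q).
{ induction i as [|i [p [q [IH1 [IH2 [IH3 IH4]]]]]].
  - exists 1, 1. simpl INR. rewrite !Rplus_0_l Rmult_1_l.
    split; [ apply is_Gamma_half | split; [ apply is_Gamma_1 | split; [ lra | simpl; ring ] ] ].
  - pose proof (pos_INR i).
    exists ((INR i + 1 / 2) * p), ((INR i + 1) * q). rewrite S_INR. split; [ | split; [ | split ] ].
    + replace (INR i + 1 + 1 / 2) with (INR i + 1 / 2 + 1) by ring.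
      rewrite Rmult_assoc. apply is_Gamma_succ; [ lra | exact IH1 ].
    + apply is_Gamma_succ; [ lra | exact IH2 ].
    + apply Rmult_lt_0_compat; lra.
    + simpl wallis. rewrite IH4. field. lra. }
destruct H as [p [q [H1 [H2 [H4 H5]]]]].
rewrite H3 mult_INR (S_INR i); change (INR 2) with 2.
replace ((2 * (INR i + 1) - 1) / 2) with (INR i + 1 / 2) by field.
replace (2 * (INR i + 1) / 2) with (INR i + 1) by field.
rewrite (is_Gamma_unique _ _ H1) (is_Gamma_unique _ _ H2) H5.
replace (1 / 2 * sqrt PI * (wallis i * q * sqrt PI) / q) with (1 / 2 * (sqrt PI * sqrt PI) * wallis i) by (field; lra).
rewrite sqrt_sqrt; [ | apply Rlt_le, PI_RGT_0 ]. field.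
Qed.

(** * The binomial series with negative integer exponent *)

Fixpoint rising (a : R) (n : nat) : R :=
  match n with O => 1 | S n' => rising a n' * (a + INR n') end.

(** The coefficient of [v^n] in [(1 - v)^(-j)]. *)
Definition binom_coeff (j n : nat) : R := rising (INR j) n / INR (fact n).

Lemma rising_shift (a : R) (n : nat) : rising a (S n) = a * rising (a + 1) n.
Proof.
induction n as [|n IH]; [ simpl; ring | ].
change (rising a (S (S n))) with (rising a (S n) * (a + INR (S n))). rewrite IH.
simpl rising. rewrite S_INR; ring.
Qed.

Lemma rising_nonneg (a : R) (n : nat) : 0 <= a -> 0 <= rising a n.
Proof.
intros Ha; induction n as [|n IH]; simpl; [ lra | ].
apply Rmult_le_pos; [ exact IH | pose proof (pos_INR n); lra ].
Qed.

Lemma binom_coeff_nonneg (j n : nat) : 0 <= binom_coeff j n.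
Proof.
apply Rmult_le_pos; [ apply rising_nonneg, pos_INR | apply Rlt_le, Rinv_0_lt_compat, INR_fact_lt_0 ].
Qed.

Lemma binom_coeff_0_S (n : nat) : binom_coeff 0 (S n) = 0.
Proof. unfold binom_coeff. rewrite rising_shift. simpl INR at 1. unfold Rdiv; ring. Qed.

Lemma binom_coeff_pascal (j n : nat) :
  binom_coeff (S j) (S n) = binom_coeff (S j) n + binom_coeff j (S n).
Proof.
unfold binom_coeff. rewrite (rising_shift (INR j)) -(S_INR j).
change (rising (INR (S j)) (S n)) with (rising (INR (S j)) n * (INR (S j) + INR n)).
rewrite fact_simpl mult_INR !S_INR.
field. split; [ apply INR_fact_neq_0 | pose proof (pos_INR n); lra ].
Qed.

Lemma binom_coeff_0_r (j : nat) : binom_coeff j 0 = 1.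
Proof. unfold binom_coeff; simpl; field. Qed.

Lemma binom_coeff_le (j n : nat) : binom_coeff j n <= INR (S n) ^ j.
Proof.
revert n; induction j as [|j IH]; intros n.
- destruct n as [|n]; [ rewrite binom_coeff_0_r; simpl; lra | rewrite binom_coeff_0_S; simpl; lra ].
- induction n as [|n IHn].
  + rewrite binom_coeff_0_r. simpl INR; rewrite pow1; lra.
  + rewrite binom_coeff_pascal.
    apply Rle_trans with (INR (S n) ^ S j + INR (S (S n)) ^ j); [ apply Rplus_le_compat; auto | ].
    rewrite -!tech_pow_Rmult.
    assert (INR (S n) ^ j <= INR (S (S n)) ^ j).
    { apply pow_incr; split; [ apply pos_INR | apply le_INR; lia ]. }
    set (B := INR (S (S n)) ^ j) in *. rewrite (S_INR (S n)). pose proof (pos_INR (S n)). nra.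
Qed.

(** The coefficients grow polynomially in [n]. *)
Lemma binom_coeff_pow_limit (j : nat) (rho : R) : 0 < rho < 1 ->
  is_lim_seq (fun n => binom_coeff j n * rho ^ S n) 0.
Proof.
intros Hr. set (c := - ln rho).
assert (Hc : 0 < c) by (unfold c; pose proof (ln_increasing rho 1 ltac:(lra) ltac:(lra)) as H; rewrite ln_1 in H; lra).
apply (is_lim_seq_le_le (fun _ => 0) _ (fun n => INR (fact j) * (2 / c) ^ j * exp (- (c / 2)) ^ S n)).
- intros n; split.
  + apply Rmult_le_pos; [ apply binom_coeff_nonneg | apply pow_le; lra ].
  + apply Rle_trans with (INR (S n) ^ j * rho ^ S n).
    * apply Rmult_le_compat_r; [ apply pow_le; lra | apply binom_coeff_le ].
    * pose proof (pow_div_fact_exp_le c (INR (S n)) j Hc (pos_INR _)) as H.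
      assert (Ex : forall y k, exp (- y * INR k) = exp (- y) ^ k).
      { intros y k; induction k as [|k IH]; [ simpl; rewrite Rmult_0_r exp_0; reflexivity | ].
        rewrite S_INR -tech_pow_Rmult -IH -exp_plus; f_equal; ring. }
      rewrite !Ex in H.
      replace (exp (- c)) with rho in H by (unfold c; rewrite Ropp_involutive exp_ln; [ reflexivity | lra ]).
      pose proof (INR_fact_lt_0 j) as Hf.
      apply Rmult_le_compat_l with (r := INR (fact j)) in H; [ | lra ].
      replace (INR (fact j) * (INR (S n) ^ j / INR (fact j) * rho ^ S n)) with (INR (S n) ^ j * rho ^ S n) in H by (field; lra).
      rewrite Rmult_assoc; exact H.
- apply is_lim_seq_const.
- replace (Finite 0) with (Rbar_mult (INR (fact j) * (2 / c) ^ j) 0) by (simpl; f_equal; ring).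
  apply is_lim_seq_scal_l. apply (is_lim_seq_incr_1 (fun n => exp (- (c / 2)) ^ n)), is_lim_seq_geom.
  rewrite Rabs_pos_eq; [ | apply Rlt_le, exp_pos ].
  rewrite -exp_0; apply exp_increasing; lra.
Qed.

Definition binom_sum (j P : nat) (v : C) : C := sum_n (fun n => (RtoC (binom_coeff j n) * v ^ n)%C) P.

Lemma binom_sum_S (j P : nat) (v : C) :
  binom_sum j (S P) v = (binom_sum j P v + RtoC (binom_coeff j (S P)) * v ^ S P)%C.
Proof. unfold binom_sum; rewrite sum_Sn; reflexivity. Qed.

Lemma binom_sum_pascal (j P : nat) (v : C) :
  ((1 - v) * binom_sum (S j) P v = binom_sum j P v - RtoC (binom_coeff (S j) P) * v ^ S P)%C.
Proof.
induction P as [|P IH].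
- unfold binom_sum; rewrite !sum_O !binom_coeff_0_r. simpl. ring.
- rewrite !binom_sum_S Cmult_plus_distr_l IH binom_coeff_pascal RtoC_plus.
  change (v ^ S (S P))%C with (v * v ^ S P)%C. ring.
Qed.

(** A bound for the remainder of the series of [(1 - v)^(-j)], uniform on the
    disc of radius [rho]. The recursion follows [binom_sum_pascal], in which a
    factor [1 - v] lowers [j]. *)
Fixpoint binom_rem (j P : nat) (rho : R) : R :=
  match j with
  | O => 0
  | S j' => (binom_rem j' P rho + binom_coeff (S j') P * rho ^ S P) / (1 - rho)
  end.

Lemma one_minus_neq_0 (v : C) (rho : R) : rho < 1 -> Cmod v <= rho -> (1 - v)%C <> RtoC 0.
Proof.
intros Hr Hv E. assert (Ev : v = RtoC 1).
{ replace v with (1 - (1 - v))%C by ring. rewrite E. ring. }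
rewrite Ev Cmod_1 in Hv; lra.
Qed.

Lemma binom_rem_correct (j P : nat) (rho : R) (v : C) : rho < 1 -> Cmod v <= rho ->
  Cmod (/ (1 - v) ^ j - binom_sum j P v)%C <= binom_rem j P rho.
Proof.
intros Hr Hv. pose proof (one_minus_neq_0 v rho Hr Hv) as Hnz.
assert (H1v : 1 - rho <= Cmod (1 - v)%C).
{ pose proof (Cmod_triangle (1 - v)%C v) as H. replace (1 - v + v)%C with (RtoC 1) in H by ring.
  rewrite Cmod_1 in H. lra. }
induction j as [|j IH].
- change (binom_rem 0 P rho) with 0. assert (E : binom_sum 0 P v = RtoC 1).
  { induction P as [|P IHP].
    - unfold binom_sum; rewrite sum_O binom_coeff_0_r; simpl; ring.
    - rewrite binom_sum_S IHP binom_coeff_0_S; ring. }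
  rewrite E; simpl. replace (/ 1 - 1)%C with (RtoC 0) by field. rewrite Cmod_0; lra.
- change (binom_rem (S j) P rho) with ((binom_rem j P rho + binom_coeff (S j) P * rho ^ S P) / (1 - rho)).
  set (R := (/ (1 - v) ^ S j - binom_sum (S j) P v)%C).
  assert (E : ((1 - v) * R = (/ (1 - v) ^ j - binom_sum j P v) + RtoC (binom_coeff (S j) P) * v ^ S P)%C).
  { unfold R. replace ((1 - v) * (/ (1 - v) ^ S j - binom_sum (S j) P v))%C with
      (/ (1 - v) ^ j - (1 - v) * binom_sum (S j) P v)%C.
    - rewrite binom_sum_pascal; ring.
    - simpl. field. split; [ apply Cpow_nz, Hnz | exact Hnz ]. }
  apply Rmult_le_reg_l with (1 - rho); [ lra | ].
  apply Rle_trans with (Cmod (1 - v)%C * Cmod R).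
  { apply Rmult_le_compat_r; [ apply Cmod_ge_0 | exact H1v ]. }
  rewrite -Cmod_mult E.
  replace ((1 - rho) * ((binom_rem j P rho + binom_coeff (S j) P * rho ^ S P) / (1 - rho)))
    with (binom_rem j P rho + binom_coeff (S j) P * rho ^ S P) by (field; lra).
  refine (Rle_trans _ _ _ (Cmod_triangle _ _) _).
  apply Rplus_le_compat; [ exact IH | ].
  rewrite Cmod_mult Cmod_R Cmod_pow Rabs_pos_eq; [ | apply binom_coeff_nonneg ].
  apply Rmult_le_compat_l; [ apply binom_coeff_nonneg | ].
  apply pow_incr; split; [ apply Cmod_ge_0 | exact Hv ].
Qed.

Lemma binom_rem_limit (j : nat) (rho : R) : 0 < rho < 1 -> is_lim_seq (fun P => binom_rem j P rho) 0.
Proof.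
intros Hr; induction j as [|j IH]; [ apply is_lim_seq_const | ].
simpl binom_rem. replace (Finite 0) with (Rbar_mult (0 + 0) (/ (1 - rho))) by (simpl; f_equal; ring).
apply is_lim_seq_scal_r, is_lim_seq_plus'; [ exact IH | apply (binom_coeff_pow_limit (S j)), Hr ].
Qed.

(** * Euler's integral for the hypergeometric function *)

Local Notation CR := (real_space C_CompleteNormedModule).

(** Working in components reduces products and inverses of complex functions
    to real ones. *)
Definition C_continuous (f : R -> C) (s : R) : Prop :=
  continuous (fun r => Re (f r)) s /\ continuous (fun r => Im (f r)) s.

Lemma C_continuous_CR (f : R -> C) (s : R) : C_continuous f s -> continuous (U := CR) f s.
Proof.
intros [H1 H2] P HP.
exact (filterlim_C_components f (f s) H1 H2 P (proj1 (locally_C (f s) P) HP)).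
Qed.

Lemma C_continuous_mult (f g : R -> C) (s : R) :
  C_continuous f s -> C_continuous g s -> C_continuous (fun r => (f r * g r)%C) s.
Proof.
intros [H1 H2] [H3 H4]; split.
- apply (continuous_minus (V := RN) (fun r => Re (f r) * Re (g r)) (fun r => Im (f r) * Im (g r)));
    apply (continuous_mult (K := R_AbsRing)); assumption.
- apply (continuous_plus (V := RN) (fun r => Re (f r) * Im (g r)) (fun r => Im (f r) * Re (g r)));
    apply (continuous_mult (K := R_AbsRing)); assumption.
Qed.

Lemma C_continuous_minus (f g : R -> C) (s : R) :
  C_continuous f s -> C_continuous g s -> C_continuous (fun r => (f r - g r)%C) s.
Proof.
intros [H1 H2] [H3 H4]; split.
- apply (continuous_minus (V := RN) (fun r => Re (f r)) (fun r => Re (g r))); assumption.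
- apply (continuous_minus (V := RN) (fun r => Im (f r)) (fun r => Im (g r))); assumption.
Qed.

Lemma C_continuous_const (c : C) (s : R) : C_continuous (fun _ => c) s.
Proof. split; apply continuous_const. Qed.

Lemma C_continuous_real (f : R -> R) (s : R) : continuous f s -> C_continuous (fun r => RtoC (f r)) s.
Proof. intros H; split; [ exact H | apply continuous_const ]. Qed.

Lemma C_continuous_pow (f : R -> C) (n : nat) (s : R) :
  C_continuous f s -> C_continuous (fun r => (f r ^ n)%C) s.
Proof.
intros H; induction n as [|n IH]; [ apply C_continuous_const | ].
apply (C_continuous_mult f); assumption.
Qed.

Lemma C_neq_0_sq (z : C) : z <> RtoC 0 -> Re z ^ 2 + Im z ^ 2 <> 0.
Proof.
intros H E. apply H. destruct z as [a b]; unfold Re, Im in E; simpl fst in E; simpl snd in E.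
pose proof (pow2_ge_0 a); pose proof (pow2_ge_0 b).
assert (a = 0) by nra. assert (b = 0) by nra. subst; reflexivity.
Qed.

Lemma C_continuous_inv (f : R -> C) (s : R) :
  f s <> RtoC 0 -> C_continuous f s -> C_continuous (fun r => (/ f r)%C) s.
Proof.
intros Hs [H1 H2].
pose proof (C_neq_0_sq (f s) Hs) as Hn.
assert (D : continuous (fun r => / (Re (f r) ^ 2 + Im (f r) ^ 2)) s).
{ apply (continuous_comp (fun r => Re (f r) ^ 2 + Im (f r) ^ 2) Rinv).
  - apply (continuous_plus (V := RN) (fun r => Re (f r) ^ 2) (fun r => Im (f r) ^ 2)).
    + apply (continuous_comp (fun r => Re (f r)) (fun y => y ^ 2)); [ exact H1 | ].
      continuous_by_derive.
    + apply (continuous_comp (fun r => Im (f r)) (fun y => y ^ 2)); [ exact H2 | ].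
      continuous_by_derive.
  - apply continuous_of_derive; auto_derive; exact Hn. }
split.
- apply (continuous_mult (K := R_AbsRing) (fun r => Re (f r))); assumption.
- apply (continuous_mult (K := R_AbsRing) (fun r => - Im (f r))); [ | exact D ].
  apply (continuous_opp (V := RN)), H2.
Qed.

Definition euler_base (z : C) (s : R) : C := (1 - z * RtoC (s ^ 2))%C.

(** Euler's integral for [2F1(1/2, j; 3/2; z)]; the usual variable of
    integration is [s^2]. *)
Definition hyp_integral (j : nat) (z : C) : C := RInt (V := CR) (fun s => (/ euler_base z s ^ j)%C) 0 1.

Lemma euler_base_continuous (z : C) (s : R) : C_continuous (euler_base z) s.
Proof.
apply (C_continuous_minus (fun _ => RtoC 1)); [ apply C_continuous_const | ].
apply (C_continuous_mult (fun _ => z)); [ apply C_continuous_const | ].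
apply C_continuous_real, continuous_of_derive; auto_derive; trivial.
Qed.

(** Off the cut [1 - z s^2] has no zero for [0 <= s <= 1], and this interval is
    compact. *)
Lemma euler_base_bound (z : C) : ~ (Im z = 0 /\ 1 <= Re z) ->
  exists d, 0 < d /\ forall s, 0 <= s <= 1 -> d <= Cmod (euler_base z s).
Proof.
intros Hz.
set (phi := fun s => (1 - Re z * s ^ 2) ^ 2 + (Im z * s ^ 2) ^ 2).
assert (Hphi : forall s, Cmod (euler_base z s) = sqrt (phi s)).
{ intros s; unfold Cmod, euler_base, phi; destruct z as [a b]; unfold Re, Im; simpl. f_equal; ring. }
destruct (continuity_ab_min phi 0 1) as [s0 [H1 H2]]; [ lra | | ].
{ intros c _; apply continuity_pt_of_derive; unfold phi; auto_derive; trivial. }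
exists (sqrt (phi s0)); split.
- apply sqrt_lt_R0. unfold phi.
  pose proof (pow2_ge_0 (1 - Re z * s0 ^ 2)); pose proof (pow2_ge_0 (Im z * s0 ^ 2)).
  destruct (Rle_lt_or_eq_dec 0 ((1 - Re z * s0 ^ 2) ^ 2 + (Im z * s0 ^ 2) ^ 2)) as [Hlt|Heq]; [ lra | exact Hlt | ].
  exfalso; apply Hz.
  assert (E1 : 1 - Re z * s0 ^ 2 = 0) by nra.
  assert (E2 : Im z * s0 ^ 2 = 0) by nra.
  assert (Hs : 0 < s0 ^ 2 <= 1).
  { split; [ | nra ]. pose proof (pow2_ge_0 s0). destruct (Req_dec (s0 ^ 2) 0) as [E|E]; [ rewrite E in E1; lra | lra ]. }
  split; [ apply Rmult_integral in E2; destruct E2; lra | nra ].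
- intros s Hs. rewrite Hphi. apply sqrt_le_1_alt, H1, Hs.
Qed.

Lemma Cmod_pos_neq_0 (z : C) (d : R) : 0 < d -> d <= Cmod z -> z <> RtoC 0.
Proof. intros Hd H E; rewrite E Cmod_0 in H; lra. Qed.

Lemma C_norm_limit (u : nat -> C) (l : C) :
  is_lim_seq (fun n => Cmod (u n - l)%C) 0 -> filterlim u eventually (locally (T := C_UniformSpace) l).
Proof.
intros H. apply (filterlim_norm_iff (K := C_AbsRing) (V := C_NormedModule)).
intros eps Heps. apply is_lim_seq_spec in H. destruct (H (mkposreal eps Heps)) as [N HN].
exists N; intros n Hn. specialize (HN n Hn); simpl in HN.
rewrite Rminus_0_r Rabs_pos_eq in HN; [ exact HN | apply Cmod_ge_0 ].
Qed.

Definition euler_coeff (j : nat) (z0 : C) (n : nat) : C :=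
  (RtoC (binom_coeff j n) * RInt (V := CR) (fun s => RtoC (s ^ (2 * n)) * / euler_base z0 s ^ (j + n))%C 0 1)%C.

(** Write [1 - (z0 + w) s^2 = (1 - z0 s^2) (1 - v s)]. For [|w| < d] the
    numbers [v s] stay in a disc of radius less than 1, so the binomial series
    converges uniformly in [s] and can be integrated term by term. For [z0 = 0]
    the radius [d = 1] is admissible, and the expansion is Gauss's series on
    the whole unit disc. *)
Lemma hyp_integral_expansion (j : nat) (z0 w : C) (d : R) : 0 < d ->
  (forall s, 0 <= s <= 1 -> d <= Cmod (euler_base z0 s)) -> Cmod w < d ->
  is_pseries (K := C_AbsRing) (V := C_NormedModule) (euler_coeff j z0) w (hyp_integral j (z0 + w)%C).
Proof.
intros Hd Hz0 Hw.
set (rho := (1 + Cmod w / d) / 2).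
assert (Hwd : 0 <= Cmod w / d < 1).
{ split; [ apply Rmult_le_pos; [ apply Cmod_ge_0 | apply Rlt_le, Rinv_0_lt_compat, Hd ] | ].
  apply Rmult_lt_reg_r with d; [ exact Hd | ]. unfold Rdiv; rewrite Rmult_assoc Rinv_l; lra. }
assert (Hrho : 0 < rho < 1) by (unfold rho; lra).
set (q := fun s => (/ euler_base z0 s)%C).
set (v := fun s => (w * RtoC (s ^ 2) * q s)%C).
assert (Hb0 : forall s, 0 <= s <= 1 -> euler_base z0 s <> RtoC 0) by (intros s Hs; apply (Cmod_pos_neq_0 _ d Hd), Hz0, Hs).
assert (Hq : forall s, 0 <= s <= 1 -> Cmod (q s) <= / d).
{ intros s Hs; unfold q. rewrite Cmod_inv; [ | apply Hb0, Hs ]. apply Rinv_le_contravar; [ exact Hd | apply Hz0, Hs ]. }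
assert (Hv : forall s, 0 <= s <= 1 -> Cmod (v s) <= rho).
{ intros s Hs; unfold v. rewrite !Cmod_mult Cmod_R (Rabs_pos_eq (s ^ 2)); [ | apply pow2_ge_0 ].
  apply Rle_trans with (Cmod w * 1 * / d).
  - apply Rmult_le_compat; [ apply Rmult_le_pos; [ apply Cmod_ge_0 | apply pow2_ge_0 ] | apply Cmod_ge_0 | | apply Hq, Hs ].
    apply Rmult_le_compat_l; [ apply Cmod_ge_0 | nra ].
  - rewrite Rmult_1_r. fold (Cmod w / d). unfold rho; lra. }
assert (Hqc : forall s, 0 <= s <= 1 -> C_continuous q s).
{ intros s Hs; apply C_continuous_inv; [ apply Hb0, Hs | apply euler_base_continuous ]. }
assert (Hex : forall f, (forall s, 0 <= s <= 1 -> C_continuous f s) -> is_RInt (V := CR) f 0 1 (RInt (V := CR) f 0 1)).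
{ intros f Hf; apply (RInt_correct (V := CR)), (ex_RInt_continuous (V := CR)).
  intros s; rewrite Rmin_left; [ | lra ]. rewrite Rmax_right; [ | lra ]. intros Hs; apply C_continuous_CR, Hf, Hs. }
assert (Hfac : forall s, 0 <= s <= 1 -> euler_base (z0 + w)%C s = (euler_base z0 s * (1 - v s))%C).
{ intros s Hs; unfold v, q. pose proof (Hb0 s Hs) as Hn.
  replace (euler_base z0 s * (1 - w * RtoC (s ^ 2) * / euler_base z0 s))%C with (euler_base z0 s - w * RtoC (s ^ 2))%C by (field; exact Hn).
  unfold euler_base; ring. }
assert (Hnv : forall s, 0 <= s <= 1 -> (1 - v s)%C <> RtoC 0).
{ intros s Hs; apply (one_minus_neq_0 _ rho); [ lra | apply Hv, Hs ]. }
assert (Hbig : is_RInt (V := CR) (fun s => (q s ^ j * / (1 - v s) ^ j)%C) 0 1 (hyp_integral j (z0 + w)%C)).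
{ apply (is_RInt_ext (V := CR) (fun s => (/ euler_base (z0 + w)%C s ^ j)%C)).
  - intros s; rewrite Rmin_left; [ | lra ]. rewrite Rmax_right; [ | lra ]. intros Hs.
    assert (Hs' : 0 <= s <= 1) by lra.
    rewrite (Hfac s Hs') Cpow_mult_l. unfold q. rewrite Cpow_inv; [ | apply Hb0, Hs' ].
    match goal with |- @eq _ ?a ?b => change (@eq C a b) end.
    field. split; apply Cpow_nz; auto.
  - apply Hex. intros s Hs. apply C_continuous_inv.
    + apply Cpow_nz. rewrite (Hfac s Hs). apply Cmult_neq_0; auto.
    + apply C_continuous_pow, euler_base_continuous. }
assert (Hpart : forall P, is_RInt (V := CR) (fun s => (q s ^ j * binom_sum j P (v s))%C) 0 1
   (sum_n (fun n => scal (pow_n w n) (euler_coeff j z0 n)) P)).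
{ assert (Hterm : forall n, is_RInt (V := CR) (fun s => (q s ^ j * (RtoC (binom_coeff j n) * v s ^ n))%C) 0 1
     (scal (pow_n w n) (euler_coeff j z0 n))).
  { intros n. unfold euler_coeff.
    set (I := RInt (V := CR) (fun s => RtoC (s ^ (2 * n)) * / euler_base z0 s ^ (j + n))%C 0 1).
    assert (HI : is_RInt (V := CR) (fun s => RtoC (s ^ (2 * n)) * / euler_base z0 s ^ (j + n))%C 0 1 I).
    { apply Hex; intros s Hs. apply (C_continuous_mult (fun s => RtoC (s ^ (2 * n)))).
      - apply C_continuous_real, continuous_of_derive; auto_derive; trivial.
      - apply C_continuous_inv; [ apply Cpow_nz, Hb0, Hs | apply C_continuous_pow, euler_base_continuous ]. }
    pose proof (is_RInt_linear (V := CR) (W := CR) _ _ _ _ _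
      (@is_linear_scal_C C_CompleteNormedModule (w ^ n * RtoC (binom_coeff j n))%C) HI) as H.
    assert (Hpw : forall x n, @pow_n C_Ring x n = (x ^ n)%C).
    { clear; intros x n; induction n as [|n IH]; [ reflexivity | simpl; rewrite -IH; reflexivity ]. }
    refine (eq_ind _ (fun l => is_RInt (V := CR) _ 0 1 l) (is_RInt_ext (V := CR) _ _ _ _ _ _ H) _ _).
    - intros s; rewrite Rmin_left; [ | lra ]. rewrite Rmax_right; [ | lra ]. intros Hs.
      assert (Hs' : 0 <= s <= 1) by lra.
      change ((w ^ n * RtoC (binom_coeff j n) * (RtoC (s ^ (2 * n)) * / euler_base z0 s ^ (j + n)))%C =
       (q s ^ j * (RtoC (binom_coeff j n) * v s ^ n))%C).
      unfold v. rewrite !Cpow_mult_l Cpow_add_r pow_mult (RtoC_pow (s ^ 2) n). unfold q.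
      rewrite !Cpow_inv; [ | apply Hb0, Hs' | apply Hb0, Hs' ].
      field. split; apply Cpow_nz, Hb0, Hs'.
    - change ((w ^ n * RtoC (binom_coeff j n) * I)%C = (@pow_n C_Ring w n * (RtoC (binom_coeff j n) * I))%C).
      rewrite Hpw. symmetry; apply Cmult_assoc. }
  induction P as [|P IH].
  - rewrite sum_O. refine (is_RInt_ext (V := CR) _ _ _ _ _ _ (Hterm O)).
    intros s _; unfold binom_sum; rewrite sum_O; reflexivity.
  - rewrite sum_Sn. refine (is_RInt_ext (V := CR) _ _ _ _ _ _ (is_RInt_plus (V := CR) _ _ _ _ _ _ IH (Hterm (S P)))).
    intros s _; rewrite binom_sum_S. symmetry; apply Cmult_plus_distr_l. }
apply C_norm_limit.
apply (is_lim_seq_le_le (fun _ => 0) _ (fun P => (/ d) ^ j * binom_rem j P rho)).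
- intros P; split; [ apply Cmod_ge_0 | ].
  match goal with |- Cmod (?a - ?b)%C <= _ =>
    assert (Eab : Cmod (a - b)%C = Cmod (b - a)%C) by (rewrite -Cmod_opp; f_equal; ring) end.
  rewrite Eab.
  assert (HK : is_RInt (fun _ => (/ d) ^ j * binom_rem j P rho) 0 1 ((/ d) ^ j * binom_rem j P rho)).
  { generalize ((/ d) ^ j * binom_rem j P rho); intros c.
    refine (eq_ind _ (fun l => is_RInt (fun _ => c) 0 1 l) (is_RInt_const (V := RN) 0 1 c) c _).
    change ((1 - 0) * c = c). ring. }
  refine (norm_RInt_le (V := CR) _ _ 0 1 _ _ Rle_0_1 _ (is_RInt_minus (V := CR) _ _ _ _ _ _ Hbig (Hpart P)) HK).
  intros s Hs.
  change (Cmod (q s ^ j * / (1 - v s) ^ j - q s ^ j * binom_sum j P (v s))%C <= (/ d) ^ j * binom_rem j P rho).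
  replace (q s ^ j * / (1 - v s) ^ j - q s ^ j * binom_sum j P (v s))%C with
    (q s ^ j * (/ (1 - v s) ^ j - binom_sum j P (v s)))%C by ring.
  rewrite Cmod_mult Cmod_pow. apply Rmult_le_compat; [ apply pow_le, Cmod_ge_0 | apply Cmod_ge_0 | | ].
  + apply pow_incr; split; [ apply Cmod_ge_0 | apply Hq, Hs ].
  + apply binom_rem_correct; [ lra | apply Hv, Hs ].
- apply is_lim_seq_const.
- replace (Finite 0) with (Rbar_mult ((/ d) ^ j) 0) by (simpl; f_equal; ring).
  apply is_lim_seq_scal_l, binom_rem_limit, Hrho.
Qed.

(** * Identification of the hypergeometric function *)

Lemma pochhammer_rising (a : R) (n : nat) : pochhammer (RtoC a) n = RtoC (rising a n).
Proof.
induction n as [|n IH]; [ reflexivity | ].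
simpl. rewrite IH RtoC_mult RtoC_plus. reflexivity.
Qed.

Lemma rising_pos (a : R) (n : nat) : 0 < a -> 0 < rising a n.
Proof.
intros Ha; induction n as [|n IH]; simpl; [ lra | ].
apply Rmult_lt_0_compat; [ exact IH | pose proof (pos_INR n); lra ].
Qed.

(** [(1/2)_n / (3/2)_n = 1 / (2 n + 1)], which is the integral of
    [s^(2 n)]. *)
Lemma euler_coeff_0 (j n : nat) :
  euler_coeff j (RtoC 0) n = hyp2F1_coeff (RtoC (1 / 2)) (RtoC (INR j)) (RtoC (3 / 2)) n.
Proof.
assert (HI : RInt (V := CR) (fun s => RtoC (s ^ (2 * n)) * / euler_base (RtoC 0) s ^ (j + n))%C 0 1
   = RtoC (/ (INR (2 * n) + 1))).
{ set (k := (2 * n)%nat).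
  assert (Hk : INR k + 1 <> 0) by (pose proof (pos_INR k); lra).
  apply (is_RInt_unique (V := CR)).
  apply (is_RInt_ext (V := CR) (fun s => RtoC (s ^ k))).
  { intros s _. unfold euler_base. replace (1 - 0 * RtoC (s ^ 2))%C with (RtoC 1) by ring.
    rewrite Cpow_1_l. match goal with |- @eq _ ?a ?b => change (@eq C a b) end. field. }
  assert (Hlin : is_linear (U := RN) (V := CR) RtoC).
  { split.
    - intros x y; apply RtoC_plus.
    - intros c x; apply RtoC_mult.
    - exists 1; split; [ lra | ]. intros x. rewrite Rmult_1_l. change (Cmod (RtoC x) <= Rabs x). rewrite Cmod_R; apply Rle_refl. }
  apply (is_RInt_linear (V := RN) (W := CR) RtoC _ _ _ _ Hlin).
  assert (H : is_RInt (fun s => s ^ k) 0 1 (1 ^ S k / (INR k + 1) - 0 ^ S k / (INR k + 1))).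
  { apply (is_RInt_derive (V := RC) (fun s => s ^ S k / (INR k + 1))).
    - intros s _. auto_derive; [ trivial | ].
      change (match k with O => 1 | S _ => INR k + 1 end) with (INR (S k)). rewrite S_INR. field; exact Hk.
    - intros s _; continuous_by_derive. }
  rewrite pow1 pow_i in H; [ | lia ].
  replace (/ (INR k + 1)) with (1 / (INR k + 1) - 0 / (INR k + 1)) by (field; exact Hk). exact H. }
unfold euler_coeff; rewrite HI. unfold hyp2F1_coeff. rewrite !pochhammer_rising.
unfold binom_coeff.
pose proof (INR_fact_neq_0 n) as Hf. pose proof (rising_pos (3 / 2) n ltac:(lra)) as H3.
pose proof (rising_shift (1 / 2) n) as Hs.
change (rising (1 / 2) (S n)) with (rising (1 / 2) n * (1 / 2 + INR n)) in Hs.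
replace (1 / 2 + 1) with (3 / 2) in Hs by field.
pose proof (pos_INR n) as Hn.
rewrite -!RtoC_mult -RtoC_div; [ | apply Rmult_integral_contrapositive; split; [ lra | exact Hf ] ].
f_equal.
rewrite mult_INR; change (INR 2) with 2.
replace (rising (3 / 2) n) with (rising (1 / 2) n * (1 + 2 * INR n)) in H3 |- * by lra.
assert (rising (1 / 2) n <> 0) by (intros E0; rewrite E0 in H3; lra).
field. repeat split; auto; lra.
Qed.

Lemma hyp_integral_is_hyp2F1 (j : nat) :
  is_hyp2F1 (RtoC (1 / 2)) (RtoC (INR j)) (RtoC (3 / 2)) (hyp_integral j).
Proof.
split.
- intros z0 Hz0. destruct (euler_base_bound z0 Hz0) as [d [Hd Hb]].
  exists (euler_coeff j z0), d; split; [ exact Hd | ].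
  intros z Hz. replace z with (z0 + (z - z0))%C at 2 by ring.
  apply (hyp_integral_expansion j z0 (z - z0)%C d); assumption.
- intros z Hz.
  assert (H : is_pseries (K := C_AbsRing) (V := C_NormedModule) (euler_coeff j (RtoC 0)) z (hyp_integral j (0 + z)%C)).
  { apply (hyp_integral_expansion j (RtoC 0) z 1); [ lra | | exact Hz ].
    intros s _. unfold euler_base. replace (1 - 0 * RtoC (s ^ 2))%C with (RtoC 1) by ring. rewrite Cmod_1; lra. }
  rewrite Cplus_0_l in H.
  unfold is_pseries in *. revert H. apply (is_series_ext (V := C_NormedModule)).
  intros n; rewrite euler_coeff_0; reflexivity.
Qed.

Lemma pseries_zero_right_0 (a : nat -> R) (r : R) : 0 < r -> Rbar_le r (CV_radius a) ->
  (forall u, 0 < u < r -> PSeries a u = 0) -> a O = 0.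
Proof.
intros Hr Hcv Hz.
rewrite -(PSeries_0 a).
apply (filterlim_locally_unique (F := at_right 0) (V := RN) (PSeries a)).
- apply (filterlim_filter_le_1 (F := locally 0)); [ apply filter_le_within | ].
  apply continuity_pt_filterlim, PSeries_continuity. rewrite Rabs_R0.
  apply (Rbar_lt_le_trans 0 r); [ exact Hr | exact Hcv ].
- apply (filterlim_ext_loc (fun _ => 0)); [ | apply filterlim_const ].
  exists (mkposreal r Hr); intros u Hu Hu0. symmetry; apply Hz. split; [ exact Hu0 | ].
  apply Rabs_lt_between' in Hu; simpl in Hu; lra.
Qed.

(** The constant coefficient is a limit of values from the right; dividing by
    the variable shifts the other coefficients into its place. *)
Lemma pseries_zero_right (a : nat -> R) (r : R) : 0 < r -> Rbar_le r (CV_radius a) ->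
  (forall u, 0 < u < r -> PSeries a u = 0) -> forall n, a n = 0.
Proof.
intros Hr Hcv Hz n; revert a Hcv Hz; induction n as [|n IH]; intros a Hcv Hz.
- exact (pseries_zero_right_0 a r Hr Hcv Hz).
- pose proof (pseries_zero_right_0 a r Hr Hcv Hz) as a0.
  apply (IH (PS_decr_1 a)).
  + rewrite CV_radius_decr_1; exact Hcv.
  + intros u Hu.
    assert (Hex : ex_pseries a u).
    { apply CV_radius_inside. rewrite Rabs_pos_eq; [ | lra ].
      apply (Rbar_lt_le_trans u r); [ simpl; lra | exact Hcv ]. }
    pose proof (PSeries_decr_1 a u Hex) as E1. rewrite (Hz u Hu) a0 Rplus_0_l in E1.
    symmetry in E1; apply Rmult_integral in E1; destruct E1; lra.
Qed.

Definition real_analytic_at (D : R -> R) (x0 : R) : Prop :=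
  exists (a : nat -> R) (r : R), 0 < r /\ forall x, Rabs (x - x0) < r -> is_pseries a (x - x0) (D x).

(** Along the real axis the real parts of the coefficients form a real power
    series for the real part of the function. *)
Lemma analytic_at_real (G : C -> C) (x0 : R) : analytic_at G (RtoC x0) ->
  real_analytic_at (fun x => Re (G (RtoC x))) x0.
Proof.
intros [p [r [Hr H]]]. exists (fun n => Re (p n)), r; split; [ exact Hr | ].
intros x Hx. specialize (H (RtoC x)). rewrite -RtoC_minus Cmod_R in H. specialize (H Hx).
apply (filterlim_norm_iff (K := R_AbsRing) (V := RN)). intros eps Heps.
destruct (proj1 (filterlim_norm_iff (K := C_AbsRing) (V := C_NormedModule) _ _) H eps Heps) as [N HN].
exists N; intros n Hn. specialize (HN n Hn).
assert (Hpw : forall k, @pow_n C_Ring (RtoC (x - x0)) k = RtoC ((x - x0) ^ k)).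
{ induction k as [|k IH]; [ reflexivity | ]. simpl. rewrite IH RtoC_mult. reflexivity. }
assert (Hsum : forall k, sum_n (fun k => scal (pow_n (x - x0) k) (Re (p k))) k =
   Re (sum_n (fun k => scal (K := C_Ring) (V := C_NormedModule) (@pow_n C_Ring (RtoC (x - x0)) k) (p k)) k)).
{ induction k as [|k IH].
  - rewrite !sum_O. simpl. unfold scal; simpl; unfold mult; simpl. unfold one; simpl. destruct (p O); unfold Re; simpl; ring.
  - rewrite !sum_Sn IH. rewrite Hpw pow_n_pow.
    change (scal (K := C_Ring) (V := C_NormedModule) (RtoC ((x - x0) ^ S k)) (p (S k))) with (RtoC ((x - x0) ^ S k) * p (S k))%C.
    generalize ((x - x0) ^ S k); intros c. destruct (p (S k)) as [pa pb].
    match goal with |- plus ?a ?b = Re (plus ?u ?v) => change (a + b = Re u + Re v) end.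
    f_equal. change (c * pa = c * pa - 0 * pb). ring. }
rewrite Hsum. refine (Rle_lt_trans _ _ _ _ HN).
match goal with |- norm (minus (Re ?a) (Re ?b)) <= norm (minus ?c ?d) =>
  change (Rabs (Re (a - b)%C) <= Cmod (a - b)%C) end.
apply re_le_Cmod.
Qed.

Lemma is_pseries_radius (a : nat -> R) (r : R) : 0 < r ->
  (forall u, Rabs u < r -> ex_pseries a u) -> Rbar_le r (CV_radius a).
Proof.
intros Hr H. apply Rbar_not_lt_le; intros Hlt.
assert (exists u, 0 <= u < r /\ Rbar_lt (CV_radius a) u) as [u [Hu1 Hu2]].
{ pose proof (CV_radius_ge_0 a) as H0. destruct (CV_radius a) as [c| |]; simpl in *; try tauto.
  exists ((c + r) / 2); lra. }
apply (CV_disk_outside a u).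
- rewrite Rabs_pos_eq; [ exact Hu2 | lra ].
- destruct (H u) as [l Hl]; [ rewrite Rabs_pos_eq; lra | ].
  refine (is_lim_seq_ext _ _ _ _ (ex_series_lim_0 _ (ex_intro _ l Hl))).
  intros n. rewrite pow_n_pow. unfold scal; simpl; unfold mult; simpl. ring.
Qed.

(** Otherwise [D] vanishes on a maximal interval [- s < x <= 0]. The power
    series at [- s] vanishes to the right of its centre, hence identically, and
    [D] vanishes beyond [- s]. *)
Lemma identity_principle (D : R -> R) :
  (forall x, x < 1 -> real_analytic_at D x) -> (forall x, Rabs x < 1 -> D x = 0) ->
  forall x, x <= 0 -> D x = 0.
Proof.
intros Han Hz x1 Hx1.
destruct (Req_dec (D x1) 0) as [H|Hne]; [ exact H | exfalso ].
set (S := fun r => 0 <= r /\ forall y, - r <= y <= 0 -> D y = 0).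
assert (Hb : is_upper_bound S (- x1)).
{ intros r [Hr0 Hr]. apply Rnot_lt_le; intros Hlt. apply Hne, Hr; lra. }
(* Any radius below that of the unit disc starts the segment. *)
assert (H0 : S (1 / 2)).
{ split; [ lra | ]. intros y Hy; apply Hz. apply Rabs_lt_between; lra. }
destruct (completeness S (ex_intro _ _ Hb) (ex_intro _ _ H0)) as [s [Hs1 Hs2]].
assert (Hs0 : 1 / 2 <= s) by (apply Hs1, H0).
assert (Hzero : forall y, - s < y <= 0 -> D y = 0).
{ intros y Hy. destruct (classic (exists r, S r /\ - r <= y)) as [[r [[_ Hr] Hry]]|Hno].
  - apply Hr; lra.
  - exfalso. assert (s <= - y); [ | lra ]. apply Hs2. intros r Hr.
    apply Rnot_lt_le; intros Hlt. apply Hno; exists r; split; [ exact Hr | lra ]. }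
destruct (Han (- s) ltac:(lra)) as [a [r [Hr Ha]]].
set (r' := Rmin r s).
assert (Hr' : 0 < r') by (apply Rmin_pos; lra).
pose proof (Rmin_l r s) as Hm1; pose proof (Rmin_r r s) as Hm2; fold r' in Hm1, Hm2.
assert (Hloc : forall u, Rabs u < r -> is_pseries a u (D (- s + u))).
{ intros u Hu. specialize (Ha (- s + u)). replace (- s + u - - s) with u in Ha by ring. auto. }
assert (Hzn : forall n, a n = 0).
{ apply (pseries_zero_right a r' Hr').
  - apply (is_pseries_radius a r' Hr'). intros u Hu; eexists; apply Hloc; lra.
  - intros u Hu. rewrite (is_pseries_unique _ _ _ (Hloc u ltac:(rewrite Rabs_pos_eq; lra))). apply Hzero; lra. }
assert (Hext : S (s + r' / 2)).
{ split; [ lra | ]. intros y Hy.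
  destruct (Rlt_dec (- s) y) as [Hlt|Hge]; [ apply Hzero; lra | ].
  replace y with (- s + (y + s)) by ring.
  rewrite -(is_pseries_unique _ _ _ (Hloc (y + s) ltac:(apply Rabs_lt_between; lra))).
  unfold PSeries. apply is_series_unique.
  apply (is_series_ext (fun _ => 0)).
  - intros n; rewrite Hzn. symmetry; apply Rmult_0_l.
  - apply (filterlim_ext (fun _ => 0)); [ | apply filterlim_const ].
    intros n; induction n as [|n IH]; [ rewrite sum_O; reflexivity | ].
    rewrite sum_Sn -IH. symmetry; apply Rplus_0_l. }
specialize (Hs1 _ Hext). lra.
Qed.

Lemma is_hyp2F1_real_unique (a b c : C) (F1 F2 : C -> C) (x : R) :
  is_hyp2F1 a b c F1 -> is_hyp2F1 a b c F2 -> x <= 0 -> Re (F1 (RtoC x)) = Re (F2 (RtoC x)).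
Proof.
intros [A1 S1] [A2 S2] Hx.
apply Rminus_diag_uniq.
apply (identity_principle (fun x => Re (F1 (RtoC x)) - Re (F2 (RtoC x)))); [ | | exact Hx ].
- intros y Hy. assert (Hy' : ~ (Im (RtoC y) = 0 /\ 1 <= Re (RtoC y))) by (unfold Re; simpl; lra).
  destruct (analytic_at_real F1 y (A1 _ Hy')) as [p [r [Hr H1]]].
  destruct (analytic_at_real F2 y (A2 _ Hy')) as [q [r' [Hr' H2]]].
  exists (PS_minus p q), (Rmin r r'); split; [ apply Rmin_pos; assumption | ].
  intros z Hz. pose proof (Rmin_l r r'); pose proof (Rmin_r r r').
  apply (is_pseries_minus (V := RN)); [ apply H1; lra | apply H2; lra ].
- intros y Hy. rewrite -Cmod_R in Hy.
  pose proof (filterlim_locally_unique (F := eventually) (K := C_AbsRing) (V := C_NormedModule) _ _ _ (S1 _ Hy) (S2 _ Hy)) as E.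
  rewrite E; ring.
Qed.

(** Euler's integral shows that a function as required by [is_hyp2F1] exists,
    so the chosen one is such a function; on the negative axis it has the same
    real part as Euler's integral. *)
Lemma hyp2F1_value (j : nat) (x : R) : 0 < x ->
  x * Re (hyp2F1 (RtoC (1 / 2)) (RtoC (INR j)) (RtoC (3 / 2)) (RtoC (- x ^ 2))) = atan_int j x.
Proof.
intros Hx.
assert (Hspec : is_hyp2F1 (RtoC (1 / 2)) (RtoC (INR j)) (RtoC (3 / 2))
   (hyp2F1 (RtoC (1 / 2)) (RtoC (INR j)) (RtoC (3 / 2)))).
{ unfold hyp2F1. apply epsilon_spec. exists (hyp_integral j); apply hyp_integral_is_hyp2F1. }
rewrite (is_hyp2F1_real_unique _ _ _ _ _ (- x ^ 2) Hspec (hyp_integral_is_hyp2F1 j)).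
2:{ pose proof (pow2_ge_0 x); lra. }
assert (Hre : is_linear (U := CR) (V := RN) Re).
{ split.
  - intros y z; reflexivity.
  - intros c z. change (Re (RtoC c * z)%C = c * Re z). destruct z; unfold Re; simpl; ring.
  - exists 1; split; [ lra | ]. intros z; rewrite Rmult_1_l. apply (re_le_Cmod z). }
assert (Hb : forall s, euler_base (RtoC (- x ^ 2)) s = RtoC (1 + (x * s) ^ 2)).
{ intros s; unfold euler_base. rewrite -RtoC_mult -RtoC_minus. f_equal; ring. }
assert (HI : is_RInt (V := CR) (fun s => (/ euler_base (RtoC (- x ^ 2)) s ^ j)%C) 0 1 (hyp_integral j (RtoC (- x ^ 2)))).
{ apply (RInt_correct (V := CR)), (ex_RInt_continuous (V := CR)); intros s _.
  apply C_continuous_CR, C_continuous_inv; [ | apply C_continuous_pow, euler_base_continuous ].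
  rewrite Hb. apply Cpow_nz. intros E. apply RtoC_inj in E. pose proof (one_plus_sq_pos (x * s)); lra. }
apply (is_RInt_linear (V := CR) (W := RN) Re _ _ _ _ Hre) in HI.
assert (HJ : is_RInt (fun s => scal x (/ (1 + (x * s + 0) ^ 2) ^ j)) 0 1 (atan_int j x - atan_int j 0)).
{ apply (is_RInt_comp_lin (V := RN) (fun u => / (1 + u ^ 2) ^ j) x 0 0 1).
  replace (x * 0 + 0) with 0 by ring. replace (x * 1 + 0) with x by ring. apply atan_int_is_RInt. }
rewrite atan_int_0 Rminus_0_r in HJ. rewrite -(is_RInt_unique _ _ _ _ HJ).
symmetry; apply (is_RInt_unique (V := RC)).
refine (is_RInt_ext _ _ _ _ _ _ (is_RInt_scal (V := RN) _ _ _ x _ HI)).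
intros s _. rewrite Hb -RtoC_pow -RtoC_inv.
- rewrite Rplus_0_r. reflexivity.
- apply pow_nonzero. pose proof (one_plus_sq_pos (x * s)); lra.
Qed.

(** * Stirling ratios and Wallis products *)

(** Correct to second order at [v = 1], unlike [ln v <= v - 1]; the second
    order decides in [stirling_ratio_sq]. *)
Lemma ln_le_half_diff (v : R) : 1 <= v -> ln v <= (v - / v) / 2.
Proof.
intros Hv.
set (f := fun v => (v - / v) / 2 - ln v).
assert (D : forall x, 1 <= x -> is_derive f x ((x - 1) ^ 2 / (2 * x ^ 2))).
{ intros x Hx; unfold f; auto_derive; [ lra | field; lra ]. }
destruct (Req_dec v 1) as [->|Hne]; [ rewrite ln_1; lra | ].
destruct (MVT_gen f 1 v (fun x => (x - 1) ^ 2 / (2 * x ^ 2))) as [c [Hc E]].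
- intros x. rewrite Rmin_left; [ | lra ]. intros Hx; apply D; lra.
- intros x. rewrite Rmin_left; [ | lra ]. intros Hx; apply continuity_pt_of_derive; eexists; apply D; lra.
- rewrite Rmin_left in Hc; [ | lra ].
  assert (0 <= (c - 1) ^ 2 / (2 * c ^ 2)).
  { apply Rmult_le_pos; [ apply pow2_ge_0 | apply Rlt_le, Rinv_0_lt_compat ].
    pose proof (pow_lt c 2 ltac:(lra)); lra. }
  assert (f 1 = 0) by (unfold f; rewrite Rinv_1 ln_1; field).
  assert (0 <= f v) by nra. unfold f in *; lra.
Qed.

(** About [1 / sqrt (2 pi n)], and [peak n c = stirling_ratio n / c^n]. *)
Definition stirling_ratio (n : nat) : R := INR n ^ n * exp (- INR n) / INR (fact n).

Lemma stirling_ratio_pos (n : nat) : (1 <= n)%nat -> 0 < stirling_ratio n.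
Proof.
intros Hn. apply Rdiv_lt_0_compat; [ | apply INR_fact_lt_0 ].
apply Rmult_lt_0_compat; [ apply pow_lt, lt_0_INR; lia | apply exp_pos ].
Qed.

(** The left-hand side does not increase with [n]. The square of
    [stirling_ratio] changes by a factor at most [e^(- 1/(n+1))], by
    [ln_le_half_diff] at [(n+1)/n], and the factor [n + 1] becomes
    [n + 2 <= (n + 1) e^(1/(n+1))]. *)
Lemma stirling_ratio_sq (n : nat) : (1 <= n)%nat ->
  stirling_ratio n ^ 2 * (INR n + 1) <= 2 * exp (- 2).
Proof.
intros Hn; induction Hn as [|n Hn IH].
- assert (E1 : stirling_ratio 1 = exp (- INR 1)) by (unfold stirling_ratio; simpl; field).
  rewrite E1. replace (exp (- 2)) with (exp (- INR 1) * exp (- INR 1)).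
  + change (INR 1) with 1. right; ring.
  + rewrite -exp_plus; f_equal; simpl; ring.
- apply Rle_trans with (2 := IH).
  assert (Hn' : 1 <= INR n) by (apply (le_INR 1), Hn).
  set (v := (INR n + 1) / INR n).
  assert (Hv : 1 < v) by (unfold v; apply Rmult_lt_reg_r with (INR n); [ lra | ]; field_simplify; lra).
  assert (Er : stirling_ratio (S n) = stirling_ratio n * (v ^ n * exp (- 1))).
  { unfold stirling_ratio. rewrite fact_simpl mult_INR S_INR.
    replace (- (INR n + 1)) with (- INR n + - 1) by ring. rewrite exp_plus.
    replace ((INR n + 1) ^ S n) with (INR n ^ n * v ^ n * (INR n + 1)).
    - field. split; [ apply INR_fact_neq_0 | lra ].
    - rewrite -Rpow_mult_distr. replace (INR n * v) with (INR n + 1) by (unfold v; field; lra). simpl; ring. }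
  rewrite Er S_INR Rpow_mult_distr Rmult_assoc.
  apply Rmult_le_compat_l; [ apply pow2_ge_0 | ].
  pose proof (ln_le_half_diff v ltac:(lra)) as L1.
  set (w := (INR n + 1 + 1) / (INR n + 1)).
  assert (Hw : w = 1 + / (INR n + 1)) by (unfold w; field; lra).
  assert (Hip : 0 < / (INR n + 1)) by (apply Rinv_0_lt_compat; lra).
  replace (INR n + 1 + 1) with (w * (INR n + 1)) by (unfold w; field; lra).
  rewrite -Rmult_assoc -{2}(Rmult_1_l (INR n + 1)). apply Rmult_le_compat_r; [ lra | ].
  assert (Hwe : w <= exp (/ (INR n + 1))) by (rewrite Hw; apply exp_ineq1_le).
  assert (Hvn : (v ^ n * exp (- 1)) ^ 2 <= exp (- / (INR n + 1))).
  { replace (v ^ n) with (exp (INR n * ln v)).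
    2:{ rewrite -(Rpower_pow n v); [ reflexivity | lra ]. }
    rewrite -exp_plus. replace (exp (INR n * ln v + - 1) ^ 2) with (exp (2 * (INR n * ln v + - 1))).
    2:{ simpl. rewrite Rmult_1_r -exp_plus. f_equal; ring. }
    assert (Hle : 2 * (INR n * ln v + - 1) <= - / (INR n + 1)).
    { apply Rmult_le_compat_l with (r := 2 * INR n) in L1; [ | lra ].
      replace (2 * INR n * ((v - / v) / 2)) with (2 - / (INR n + 1)) in L1 by (unfold v; field; lra). lra. }
    destruct Hle as [Hlt|Heq]; [ apply Rlt_le, exp_increasing, Hlt | rewrite Heq; apply Rle_refl ]. }
  replace 1 with (exp (- / (INR n + 1)) * exp (/ (INR n + 1))).
  + apply Rmult_le_compat; [ apply pow2_ge_0 | rewrite Hw; lra | exact Hvn | exact Hwe ].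
  + rewrite -exp_plus -exp_0. f_equal; ring.
Qed.

(** About [1 / sqrt (pi i)]; the right-hand side does not decrease with [i]. *)
Lemma wallis_lower (i : nat) : 1 <= wallis i ^ 2 * (4 * INR i + 1).
Proof.
induction i as [|i IH]; [ simpl; lra | ].
change (wallis (S i)) with ((2 * INR i + 1) / (2 * INR i + 2) * wallis i). rewrite S_INR.
pose proof (pos_INR i) as Hi. set (x := INR i) in *.
apply Rle_trans with (1 := IH).
replace (((2 * x + 1) / (2 * x + 2) * wallis i) ^ 2 * (4 * (x + 1) + 1)) with
  (wallis i ^ 2 * (((2 * x + 1) / (2 * x + 2)) ^ 2 * (4 * (x + 1) + 1))) by ring.
apply Rmult_le_compat_l; [ apply pow2_ge_0 | ].
apply Rmult_le_reg_r with ((2 * x + 2) ^ 2); [ apply pow_lt; lra | ].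
replace (((2 * x + 1) / (2 * x + 2)) ^ 2 * (4 * (x + 1) + 1) * (2 * x + 2) ^ 2)
  with ((2 * x + 1) ^ 2 * (4 * (x + 1) + 1)) by (field; lra).
nra.
Qed.

Lemma exp_m2_le : exp (- 2) <= 1 / 4.
Proof.
assert (H2 : 2 <= exp 1) by (pose proof (exp_ineq1_le 1); lra).
replace (exp (- 2)) with (/ exp 1 * / exp 1).
- assert (/ exp 1 <= / 2) by (apply Rinv_le_contravar; lra).
  assert (0 < / exp 1) by (apply Rinv_0_lt_compat; lra). nra.
- rewrite -exp_Ropp -exp_plus; f_equal; ring.
Qed.

Lemma stirling_le_wallis (i : nat) : 2 / 3 * stirling_ratio (2 * i + 1) <= wallis i.
Proof.
pose proof (stirling_ratio_sq (2 * i + 1) ltac:(lia)) as H1.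
pose proof (stirling_ratio_pos (2 * i + 1) ltac:(lia)) as Hp.
pose proof (wallis_lower i) as H2. pose proof (wallis_pos i) as Hw.
pose proof exp_m2_le as He. pose proof (pos_INR i) as Hi.
rewrite plus_INR mult_INR in H1. change (INR 2) with 2 in H1. change (INR 1) with 1 in H1.
set (p := stirling_ratio (2 * i + 1)) in *. set (w := wallis i) in *. set (x := INR i) in *.
apply Rnot_lt_le; intros Hlt.
assert (Hsq : w ^ 2 < 4 / 9 * p ^ 2) by nra.
assert (Hp2 : p ^ 2 * (4 * x + 4) <= 1) by nra.
assert (Hp2' : 0 < p ^ 2) by (apply pow_lt, Hp). nra.
Qed.

(** * Decay of the Fourier coefficients *)

Section Decay.
Context (h : R) (Hh : 0 < h) (delta : R) (Hd : 0 < delta) (i : nat).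
Let m := (2 * S i)%nat.

Definition decay (k : nat) : R := / Cmod (delta, INR k * h)%R ^ (2 * S i).

Lemma decay_pos (k : nat) : 0 < decay k.
Proof. apply Rinv_0_lt_compat, pow_lt, Cmod_gt_0, right_half_plane_neq_0, Hd. Qed.

(** The integral over one step dominates the rectangle under the decreasing
    integrand; the variable is rescaled by [delta]. *)
Lemma decay_atan_int (k : nat) :
  decay (S k) * h <= (atan_int (S i) (INR (S k) * h / delta) - atan_int (S i) (INR k * h / delta)) * delta / delta ^ m.
Proof.
pose proof (pos_INR k) as Hk.
pose proof (atan_int_rectangle (S i) (INR k * h / delta) (INR (S k) * h / delta)) as H.
assert (Hx : 0 <= INR k * h / delta) by (apply Rmult_le_pos; [ nra | apply Rlt_le, Rinv_0_lt_compat, Hd ]).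
assert (Hxy : INR (S k) * h / delta - INR k * h / delta = h / delta) by (rewrite S_INR; field; lra).
assert (Hhd : 0 < h / delta) by (apply Rdiv_lt_0_compat; lra).
specialize (H Hx ltac:(lra)). rewrite Hxy in H.
set (b := INR (S k) * h / delta) in *.
assert (N1 : (1 + b ^ 2) ^ S i <> 0) by (apply pow_nonzero; pose proof (one_plus_sq_pos b); lra).
assert (N2 : (delta ^ 2) ^ S i <> 0) by (apply pow_nonzero, pow_nonzero; lra).
assert (Eb : decay (S k) = / (1 + b ^ 2) ^ (S i) / delta ^ m).
{ unfold decay, m. rewrite pow_mult pow_mult.
  replace (Cmod (delta, INR (S k) * h)%R ^ 2) with ((1 + b ^ 2) * delta ^ 2).
  - rewrite Rpow_mult_distr. field. auto.
  - unfold Cmod. rewrite pow2_sqrt.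
    { change ((1 + b ^ 2) * delta ^ 2 = delta ^ 2 + (INR (S k) * h) ^ 2).
      unfold b; generalize (INR (S k)); intros; field; lra. }
    apply Rplus_le_le_0_compat; apply pow2_ge_0. }
rewrite Eb. unfold Rdiv. rewrite Rmult_assoc (Rmult_comm (/ delta ^ m)) -Rmult_assoc.
apply Rmult_le_compat_r; [ apply Rlt_le, Rinv_0_lt_compat, pow_lt, Hd | ].
apply Rmult_le_compat_r with (r := delta) in H; [ | lra ].
replace (h / delta * / (1 + b ^ 2) ^ S i * delta) with (/ (1 + b ^ 2) ^ S i * h) in H by (field; split; [ exact N1 | lra ]).
exact H.
Qed.

Lemma decay_tail (N p : nat) :
  sum_n (fun k => decay (S (N + k))) p * h
    <= (PI / 2 * wallis i - atan_int (S i) (INR N * h / delta)) * delta / delta ^ m.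
Proof.
assert (H : sum_n (fun k => decay (S (N + k))) p * h
   <= (atan_int (S i) (INR (S (N + p)) * h / delta) - atan_int (S i) (INR N * h / delta)) * delta / delta ^ m).
{ induction p as [|p IH].
  - rewrite sum_O Nat.add_0_r. apply decay_atan_int.
  - rewrite sum_Sn. pose proof (decay_atan_int (N + S p)) as H.
    change (plus ?a ?b) with (a + b). rewrite Rmult_plus_distr_r.
    refine (Rle_trans _ _ _ (Rplus_le_compat _ _ _ _ IH H) _).
    replace (S (N + p)) with (N + S p)%nat by lia. right. unfold Rdiv. ring. }
refine (Rle_trans _ _ _ H _).
unfold Rdiv. apply Rmult_le_compat_r; [ apply Rlt_le, Rinv_0_lt_compat, pow_lt, Hd | ].
apply Rmult_le_compat_r; [ lra | ].
pose proof (atan_int_le_limit i (INR (S (N + p)) * h / delta)). unfold Rdiv in *; lra.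
Qed.

Lemma decay_summable : ex_series decay.
Proof.
apply ex_series_incr_1.
set (B := (PI / 2 * wallis i - atan_int (S i) (INR 0 * h / delta)) * delta / delta ^ m / h).
destruct (ex_finite_lim_seq_incr (sum_n (fun k => decay (S k))) B) as [l Hl].
- intros n. rewrite sum_Sn. change (plus ?a ?b) with (a + b). pose proof (decay_pos (S (S n))); lra.
- intros n. unfold B. apply Rmult_le_reg_r with h; [ exact Hh | ].
  unfold Rdiv at 1; rewrite Rmult_assoc Rinv_l; [ rewrite Rmult_1_r; apply (decay_tail 0 n) | lra ].
- exists l; exact Hl.
Qed.

Lemma sum_n_diff_Rabs_le (a b : nat -> R) (N N' : nat) : (forall k, Rabs (a k) <= b k) -> (N <= N')%nat ->
  Rabs (sum_n a N' - sum_n a N) <= sum_n b N' - sum_n b N.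
Proof.
intros Hab H; induction H as [|N' H IH].
- rewrite !Rminus_eq_0 Rabs_R0; lra.
- rewrite !sum_Sn. change (plus ?u ?v) with (u + v).
  replace (sum_n a N' + a (S N') - sum_n a N) with ((sum_n a N' - sum_n a N) + a (S N')) by ring.
  refine (Rle_trans _ _ _ (Rabs_triang _ _) _). specialize (Hab (S N')). lra.
Qed.

Lemma sym_sum_limit (a b : nat -> R) : (forall k, Rabs (a k) <= b k) -> ex_series b ->
  exists l : R, is_lim_seq (sym_sum a) l /\ forall N, Rabs (l - sym_sum a N) <= 2 * (Series b - sum_n b N).
Proof.
intros Hab Hb.
assert (Ha : ex_series a) by (apply (ex_series_le (V := RC) a b); auto).
assert (E : forall N, sym_sum a N = 2 * sum_n a N - a O).
{ induction N as [|N IH]; [ unfold sym_sum; rewrite sum_O; simpl; ring | ].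
  rewrite sym_sum_S IH sum_Sn. change (plus ?u ?v) with (u + v). ring. }
pose proof (Series_correct a Ha) as La. pose proof (Series_correct b Hb) as Lb.
exists (2 * Series a - a O); split.
- apply (is_lim_seq_ext (fun N => 2 * sum_n a N - a O)); [ intros; symmetry; apply E | ].
  apply is_lim_seq_minus'; [ apply (is_lim_seq_scal_l _ 2 (Series a)); exact La | apply is_lim_seq_const ].
- intros N. rewrite E.
  match goal with |- Rabs ?x <= _ => assert (Ex : x = 2 * (Series a - sum_n a N)) by ring; rewrite Ex end.
  rewrite Rabs_mult (Rabs_pos_eq 2); [ | lra ]. apply Rmult_le_compat_l; [ lra | ].
  assert (L1 : is_lim_seq (fun N' => Rabs (sum_n a N' - sum_n a N)) (Rabs (Series a - sum_n a N))).
  { apply (is_lim_seq_abs _ (Series a - sum_n a N)), is_lim_seq_minus'; [ exact La | apply is_lim_seq_const ]. }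
  assert (L2 : is_lim_seq (fun N' => sum_n b N' - sum_n b N) (Series b - sum_n b N)).
  { apply is_lim_seq_minus'; [ exact Lb | apply is_lim_seq_const ]. }
  refine (is_lim_seq_le_loc _ _ (Rabs _) (Series b - sum_n b N) _ L1 L2).
  exists N; intros N' HN'; apply sum_n_diff_Rabs_le; auto.
Qed.

Lemma fourier_mode_bound (sigma : R) (k : nat) : Rabs (fourier_mode h delta (2 * i + 1) sigma k) <= decay k.
Proof.
unfold fourier_mode, decay. refine (Rle_trans _ _ _ (re_le_Cmod _) _).
pose proof (right_half_plane_neq_0 delta (INR k * h) Hd) as Hnz.
unfold Cdiv; rewrite Cmod_mult Cmod_Cexp Cmod_inv; [ | apply Cpow_nz, Hnz ].
replace (Re (Ci * RtoC (INR k * h * sigma))%C) with 0 by (unfold Re; simpl; ring).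
rewrite exp_0 Rmult_1_l Cmod_pow. right; f_equal; f_equal; lia.
Qed.

(** Both peaks are multiples of [stirling_ratio n], [n = 2 i + 1], the second
    one with an additional factor [3^(-n) <= 1/3]. With [exp (3 * delta * t / 2)]
    in both terms, the left-hand side is at most the right-hand side with
    [2/3 stirling_ratio n <= wallis i] in place of [wallis i]. *)
Lemma alias_constant (t : R) : 0 <= t ->
  peak (2 * i + 1) (delta / 2) * (exp (3 * delta * t / 2) * (2 / (3 * delta)))
  + peak (2 * i + 1) (3 * delta / 2) * (exp (delta * t / 2) * (2 / delta))
  <= exp (3 * delta * t / 2) / delta ^ m * (2 ^ m * wallis i).
Proof.
intros Ht. set (n := (2 * i + 1)%nat).
assert (Em : m = S n) by (unfold m, n; lia).
pose proof (INR_fact_lt_0 n) as Hf.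
assert (P1 : peak n (delta / 2) = 2 ^ n / delta ^ n * stirling_ratio n).
{ unfold peak, stirling_ratio.
  replace (INR n / (delta / 2)) with (2 * / delta * INR n) by (field; lra).
  rewrite !Rpow_mult_distr pow_inv. field. split; [ apply INR_fact_neq_0 | apply pow_nonzero; lra ]. }
assert (P2 : peak n (3 * delta / 2) = 2 ^ n / delta ^ n * stirling_ratio n / 3 ^ n).
{ unfold peak, stirling_ratio.
  replace (INR n / (3 * delta / 2)) with (2 * / delta * / 3 * INR n) by (field; lra).
  rewrite !Rpow_mult_distr !pow_inv. field. repeat split; [ apply INR_fact_neq_0 | apply pow_nonzero; lra | apply pow_nonzero; lra ]. }
rewrite P1 P2 Em.
set (q := exp (3 * delta * t / 2)).
assert (Hq : exp (delta * t / 2) <= q).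
{ unfold q. destruct (Req_dec t 0) as [->|Hne].
  - right; f_equal; field.
  - apply Rlt_le, exp_increasing. assert (0 < delta * t) by (apply Rmult_lt_0_compat; lra). lra. }
assert (H3 : 3 <= 3 ^ n) by (rewrite -{1}(pow_1 3); apply Rle_pow; [ lra | unfold n; lia ]).
pose proof (stirling_ratio_pos n ltac:(unfold n; lia)) as Hs.
pose proof (stirling_le_wallis i) as Hw. fold n in Hw.
pose proof (exp_pos (delta * t / 2)) as Hq0.
assert (N1 : delta ^ n <> 0) by (apply pow_nonzero; lra).
assert (N2 : 3 ^ n <> 0) by (apply pow_nonzero; lra).
assert (N3 : delta <> 0) by lra.
set (c := 2 ^ S n / delta ^ S n).
assert (Hc : 0 < c) by (unfold c; apply Rdiv_lt_0_compat; apply pow_lt; lra).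
replace (2 ^ n / delta ^ n * stirling_ratio n * (q * (2 / (3 * delta)))) with (c * (stirling_ratio n / 3) * q).
2:{ unfold c; simpl; field. auto. }
replace (2 ^ n / delta ^ n * stirling_ratio n / 3 ^ n * (exp (delta * t / 2) * (2 / delta))) with
  (c * (stirling_ratio n / 3 ^ n) * exp (delta * t / 2)).
2:{ unfold c; simpl; field. auto. }
replace (q / delta ^ S n * (2 ^ S n * wallis i)) with (c * wallis i * q).
2:{ unfold c; field. apply pow_nonzero; lra. }
apply Rle_trans with (c * (stirling_ratio n / 3) * q + c * (stirling_ratio n / 3) * q).
- apply Rplus_le_compat_l, Rmult_le_compat; [ | lra | | exact Hq ].
  + apply Rmult_le_pos; [ lra | apply Rlt_le, Rdiv_lt_0_compat; lra ].
  + apply Rmult_le_compat_l; [ lra | ]. unfold Rdiv; apply Rmult_le_compat_l; [ lra | ]. apply Rinv_le_contravar; lra.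
- replace (c * (stirling_ratio n / 3) * q + c * (stirling_ratio n / 3) * q) with (c * (2 / 3 * stirling_ratio n) * q) by field.
  apply Rmult_le_compat_r; [ lra | ]. apply Rmult_le_compat_l; lra.
Qed.

End Decay.

(** * Bilateral series *)

Lemma plus_interchange {G : AbelianGroup} (u v a b : G) :
  plus (plus u v) (plus a b) = plus (plus u a) (plus v b).
Proof.
rewrite -!plus_assoc; f_equal. rewrite !plus_assoc; f_equal. apply plus_comm.
Qed.

Lemma minus_plus_comm {G : AbelianGroup} (u v w : G) : minus (plus u v) w = plus (minus u w) v.
Proof. unfold minus. rewrite -!plus_assoc; f_equal. apply plus_comm. Qed.

Section ZSums.
Context {X : CompleteNormedModule C_AbsRing}.

Lemma zsum_0 (a : Z -> X) : zsum a 0 = a 0%Z.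
Proof. unfold zsum; simpl. rewrite sum_O. reflexivity. Qed.

Lemma zsum_S (a : Z -> X) (N : nat) :
  zsum a (S N) = plus (zsum a N) (plus (a (Z.of_nat (S N))) (a (- Z.of_nat (S N))%Z)).
Proof.
unfold zsum. set (f := fun j => a (Z.of_nat j - Z.of_nat (S N))%Z).
replace (2 * S N)%nat with (S (S (2 * N))) by lia.
unfold sum_n. rewrite sum_Sn_m; [ | lia ]. rewrite -sum_n_m_S.
rewrite sum_n_Sm; [ | lia ].
replace (sum_n_m (fun j => f (S j)) 0 (2 * N)) with (sum_n_m (fun j => a (Z.of_nat j - Z.of_nat N)%Z) 0 (2 * N)).
2:{ apply sum_n_m_ext; intros k. unfold f; f_equal; lia. }
rewrite plus_comm -plus_assoc; f_equal. unfold f. f_equal; f_equal; lia.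
Qed.

Lemma zsum_split (a : Z -> X) (N : nat) :
  zsum a (S N) = plus (sum_n (fun n => a (Z.of_nat n)) (S N)) (sum_n (fun n => a (- Z.of_nat (S n))%Z) N).
Proof.
induction N as [|N IH].
- rewrite zsum_S zsum_0 sum_Sn !sum_O plus_assoc. reflexivity.
- rewrite zsum_S IH (sum_Sn (fun n => a (Z.of_nat n)) (S N)) (sum_Sn (fun n => a (- Z.of_nat (S n))%Z) N).
  exact (plus_interchange (G := X) _ _ _ _).
Qed.

(** Symmetric partial sums converge to the sum of the two one-sided series;
    this also gives the uniqueness of the bilateral sum. *)
Lemma zsum_is_zseries (a : Z -> X) (l : X) : is_zseries a l -> filterlim (zsum a) eventually (locally l).
Proof.
intros [l1 [l2 [H1 [H2 ->]]]].
assert (H : filterlim (fun N => zsum a (S N)) eventually (locally (plus l1 l2))).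
{ apply (filterlim_ext (fun N => plus (sum_n (fun n => a (Z.of_nat n)) (S N)) (sum_n (fun n => a (- Z.of_nat (S n))%Z) N))).
  - intros N; symmetry; apply zsum_split.
  - refine (filterlim_comp_2 (G := locally l1) (H := locally l2) (fun N => sum_n (fun n => a (Z.of_nat n)) (S N)) _ plus _ H2 _).
    + apply (filterlim_comp _ _ _ S (sum_n (fun n => a (Z.of_nat n))) _ eventually); [ | exact H1 ].
      intros P [N HN]; exists N; intros n Hn; apply HN; lia.
    + apply (filterlim_plus (V := X)). }
intros P HP. destruct (H P HP) as [N HN]. exists (S N). intros [|n] Hn; [ lia | ]. apply HN; lia.
Qed.

Lemma zseries_correct (a : Z -> X) (l : X) : is_zseries a l -> zseries a = l.
Proof.
intros Hl. apply (iota_unique (K := C_AbsRing)); [ | exact Hl ].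
intros l' Hl'.
exact (filterlim_locally_unique (F := eventually) (zsum a) l' l (zsum_is_zseries a l' Hl') (zsum_is_zseries a l Hl)).
Qed.

End ZSums.

(** * The trapezoidal sum as an integral against the semigroup *)

Section Trapezoid.
Context {X : CompleteNormedModule C_AbsRing}.
Context (A : operator X) (HAlin : linear_operator A).
Context (K : R -> X -> X) (HA : generates A K).
Context (M : R) (HM : 1 <= M).
Context (HK : forall s : R, 0 <= s -> Rbar_le (op_norm (K s)) (Finite M)).
Context (i : nat) (delta h t : R) (Hdelta : 0 < delta) (Hh : 0 < h) (Ht : 0 < t).

Notation XR := (real_space X).
Notation m := (2 * S i)%nat.
Notation n := (2 * i + 1)%nat.
Notation L := (2 * PI / h).

Lemma node_pair (k : Z) : node h delta k = (delta, h * IZR k).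
Proof. unfold node, Ci, RtoC, Cplus, Cmult; simpl. f_equal; ring. Qed.

Lemma node_Re (k : Z) : 0 < Re (node h delta k).
Proof. rewrite node_pair; exact Hdelta. Qed.

Definition complex_mode (k : nat) (sigma : R) : C :=
  (Cexp (Ci * RtoC (INR k * h * sigma)) / (delta, (INR k * h)%R) ^ m)%C.

Lemma Re_complex_mode (k : nat) (sigma : R) : Re (complex_mode k sigma) = fourier_mode h delta n sigma k.
Proof. unfold complex_mode, fourier_mode. replace (S n) with m by lia. reflexivity. Qed.

(** Multiplied by the factor [e^(- z s)] of the Laplace transform, a weight
    depends on [s] and [t] through [s - t] only. *)
Lemma weight_neg (k : nat) (s : R) :
  (weight m h delta t (- Z.of_nat k) * Cexp (- (node h delta (- Z.of_nat k) * RtoC s)))%C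
  = (RtoC (exp (- delta * (s - t))) * complex_mode k (s - t))%C.
Proof.
unfold weight, complex_mode.
replace (RtoC delta - Ci * RtoC h * RtoC (IZR (- Z.of_nat k)))%C with ((delta, (INR k * h)%R) : C).
2:{ rewrite opp_IZR -INR_IZR_INZ. unfold Ci, RtoC, Cminus, Cplus, Copp, Cmult; simpl. f_equal; ring. }
unfold Cdiv. rewrite -Cmult_assoc (Cmult_comm (/ _)) Cmult_assoc -Cexp_plus Cmult_assoc.
f_equal. rewrite node_pair opp_IZR -INR_IZR_INZ.
unfold Cexp, Ci, RtoC, Cminus, Cplus, Copp, Cmult, Re, Im; simpl.
replace (0 * (INR k * h * (s - t)) - 1 * 0) with 0 by ring. rewrite exp_0.
replace (delta * t - h * - INR k * 0 + - (delta * s - h * - INR k * 0)) with (- delta * (s - t)) by ring.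
replace (delta * 0 + h * - INR k * t + - (delta * 0 + h * - INR k * s)) with (0 * 0 + 1 * (INR k * h * (s - t))) by ring.
f_equal; ring.
Qed.

Lemma Cexp_conj (z : C) : Cconj (Cexp z) = Cexp (Cconj z).
Proof.
destruct z as [a b]; unfold Cexp, Cconj, Re, Im; simpl. rewrite cos_neg sin_neg; f_equal; ring.
Qed.

Lemma weight_conj (k : Z) : weight m h delta t k = Cconj (weight m h delta t (- k)).
Proof.
unfold weight. rewrite Cdiv_conj.
- rewrite Cexp_conj Cpow_conj !node_pair opp_IZR. f_equal.
  + f_equal. unfold Cconj, RtoC, Cmult; simpl; f_equal; ring.
  + f_equal. unfold Ci, Cconj, RtoC, Cminus, Cplus, Copp, Cmult; simpl; f_equal; ring.
- apply Cpow_nz. intros E. injection E; intros _ E1. ring_simplify in E1. lra.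
Qed.

Lemma weight_pos (k : nat) (s : R) :
  (weight m h delta t (Z.of_nat k) * Cexp (- (node h delta (Z.of_nat k) * RtoC s)))%C
  = (RtoC (exp (- delta * (s - t))) * Cconj (complex_mode k (s - t)))%C.
Proof.
rewrite weight_conj.
replace (Cexp (- (node h delta (Z.of_nat k) * RtoC s)))%C with (Cconj (Cexp (- (node h delta (- Z.of_nat k) * RtoC s))))%C.
2:{ rewrite Cexp_conj !node_pair opp_IZR. f_equal. unfold Cconj, RtoC, Copp, Cmult; simpl; f_equal; ring. }
rewrite -Cmult_conj weight_neg Cmult_conj. f_equal.
unfold Cconj, RtoC; simpl; f_equal; ring.
Qed.

Lemma weight_Cmod (k : Z) : Cmod (weight m h delta t k) = exp (delta * t) * decay h delta i (Z.abs_nat k).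
Proof.
assert (W : forall k : nat, Cmod (weight m h delta t (- Z.of_nat k)) = exp (delta * t) * decay h delta i k).
{ intros k'. pose proof (weight_neg k' 0) as E.
  replace (Cexp (- (node h delta (- Z.of_nat k') * RtoC 0)))%C with (RtoC 1) in E.
  2:{ replace (- (node h delta (- Z.of_nat k') * RtoC 0))%C with (RtoC 0) by ring. symmetry; apply Cexp_0. }
  rewrite Cmult_1_r in E. rewrite E.
  pose proof (right_half_plane_neq_0 delta (INR k' * h) Hdelta) as Hnz.
  unfold complex_mode, Cdiv. rewrite !Cmod_mult Cmod_Cexp Cmod_R Cmod_inv; [ | apply Cpow_nz, Hnz ].
  replace (Re (Ci * RtoC (INR k' * h * (0 - t)))%C) with 0 by (unfold Re; simpl; ring).
  rewrite exp_0 Cmod_pow Rabs_pos_eq; [ | apply Rlt_le, exp_pos ]. unfold decay.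
  replace (- delta * (0 - t)) with (delta * t) by ring. ring. }
destruct (Z_le_dec 0 k) as [Hk|Hk].
- rewrite weight_conj Cmod_conj. rewrite -(W (Z.abs_nat k)). do 2 f_equal. lia.
- rewrite -(W (Z.abs_nat k)). do 2 f_equal. lia.
Qed.

Context (y : X).

Notation term := (bracket_term A m h delta t y).

Lemma bracket_term_laplace (k : Z) :
  term k = scal (weight m h delta t k) (laplace K (node h delta k) y).
Proof. unfold bracket_term. rewrite (resolvent_laplace A K HA M HM HK); [ reflexivity | apply node_Re ]. Qed.

Lemma bracket_term_norm (k : Z) :
  norm (term k) <= exp (delta * t) * (M / delta) * norm y * decay h delta i (Z.abs_nat k).
Proof.
rewrite bracket_term_laplace. refine (Rle_trans _ _ _ (norm_scal _ _) _).
change (abs ?c) with (Cmod c). rewrite weight_Cmod.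
pose proof (proj2 (laplace_correct A K HA M HM HK (node h delta k) y (node_Re k))) as H.
replace (Re (node h delta k)) with delta in H by (rewrite node_pair; reflexivity).
pose proof (decay_pos h delta Hdelta i (Z.abs_nat k)) as Hp. pose proof (exp_pos (delta * t)) as He.
apply Rle_trans with (exp (delta * t) * decay h delta i (Z.abs_nat k) * (M / delta * norm y)).
- apply Rmult_le_compat_l; [ apply Rmult_le_pos; lra | exact H ].
- right; ring.
Qed.

Lemma bracket_zseries : exists l, is_zseries term l.
Proof.
set (C := exp (delta * t) * (M / delta) * norm y).
pose proof (decay_summable h Hh delta Hdelta i) as Hs.
assert (Hs' : ex_series (fun k => C * decay h delta i k)).
{ exact (ex_series_scal (V := RN) C _ Hs). }
destruct (ex_series_le (V := X) (fun k => term (Z.of_nat k)) (fun k => C * decay h delta i k)) as [l1 H1].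
{ intros k. refine (Rle_trans _ _ _ (bracket_term_norm _) _). rewrite Zabs2Nat.id. apply Rle_refl. }
{ exact Hs'. }
destruct (ex_series_le (V := X) (fun k => term (- Z.of_nat (S k))%Z) (fun k => C * decay h delta i (S k))) as [l2 H2].
{ intros k. refine (Rle_trans _ _ _ (bracket_term_norm _) _).
  replace (Z.abs_nat (- Z.of_nat (S k))) with (S k) by lia. apply Rle_refl. }
{ apply (ex_series_incr_1 (fun k => C * decay h delta i k)), Hs'. }
exists (plus l1 l2), l1, l2; auto.
Qed.

Definition kernel_sum (N : nat) (sigma : R) : R := sym_sum (fourier_mode h delta n sigma) N.

Lemma complex_mode_0 (sigma : R) : complex_mode 0 sigma = RtoC (fourier_mode h delta n sigma 0).
Proof.
rewrite -Re_complex_mode. unfold complex_mode; simpl INR. rewrite !Rmult_0_l.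
replace (Ci * RtoC 0)%C with (RtoC 0) by ring. rewrite Cexp_0.
change ((delta, 0) : C) with (RtoC delta). rewrite -RtoC_pow -RtoC_div.
- reflexivity.
- apply pow_nonzero; lra.
Qed.

(** The indices [k] and [- k] contribute conjugate kernels, so the truncated
    sum has a real kernel. *)
Lemma zsum_integral (N : nat) :
  is_int_from (V := XR) 0
    (fun s => scal (RtoC (exp (- delta * (s - t)) * kernel_sum N (s - t))) (K (Rabs s) y))
    (zsum term N).
Proof.
assert (T : forall k, is_int_from (V := XR) 0
   (fun s => scal (weight m h delta t k * Cexp (- (node h delta k * RtoC s)))%C (K (Rabs s) y)) (term k)).
{ intros k. rewrite bracket_term_laplace.
  refine (is_int_from_ext (V := XR) 0 _ _ _ _ (is_int_from_linear (V := XR) (W := XR) _ _ _ _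
    (is_linear_scal_C (weight m h delta t k)) (proj1 (laplace_correct A K HA M HM HK (node h delta k) y (node_Re k))))).
  intros s _; unfold laplace_integrand. exact (scal_C_assoc (X := X) _ _ _). }
induction N as [|N IH].
- rewrite zsum_0. refine (is_int_from_ext (V := XR) 0 _ _ _ _ (T 0%Z)).
  intros s _. f_equal. rewrite (weight_neg 0 s) complex_mode_0 -RtoC_mult. reflexivity.
- rewrite zsum_S.
  refine (is_int_from_ext (V := XR) 0 _ _ _ _ (is_int_from_plus (V := XR) _ _ _ _ _ IH
    (is_int_from_plus (V := XR) _ _ _ _ _ (T (Z.of_nat (S N))) (T (- Z.of_nat (S N))%Z)))).
  intros s _. rewrite weight_pos weight_neg.
  set (u := K (Rabs s) y).
  assert (E : forall a b : C, plus (scal a u) (scal b u) = scal (a + b)%C u).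
  { intros a b; symmetry; exact (scal_distr_r (V := X) a b u). }
  etransitivity; [ apply (f_equal (plus _)), E | ]. etransitivity; [ apply E | ].
  f_equal. unfold kernel_sum. rewrite sym_sum_S -Re_complex_mode.
  destruct (complex_mode (S N) (s - t)) as [p q]. unfold Cconj, RtoC, Cplus, Cmult, Re; simpl. f_equal; ring.
Qed.

Lemma bracket_N_integral (N : nat) :
  is_int_from (V := XR) 0
    (fun s => scal (RtoC (exp (- delta * (s - t)) * (kernel_sum N (s - t) / L))) (K (Rabs s) y))
    (bracket_N A m h delta t N y).
Proof.
unfold bracket_N.
refine (is_int_from_ext (V := XR) 0 _ _ _ _ (is_int_from_linear (V := XR) (W := XR) _ _ _ _
  (is_linear_scal_C (RtoC (h / (2 * PI)))) (zsum_integral N))).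
intros s _. rewrite scal_C_assoc -RtoC_mult. do 2 f_equal. pose proof PI_RGT_0. field. lra.
Qed.

(** The integral over [s >= 0] of [e^(- delta (s - t))] times [alias_bound] at
    [s - t]. *)
Definition aliasing_integral : R :=
  (peak n (delta / 2) * (exp (3 * delta * t / 2) * (2 / (3 * delta)))
  + peak n (3 * delta / 2) * (exp (delta * t / 2) * (2 / delta))) / (exp (delta * PI / h) - 1).

Lemma alias_bound_integral (eta : R) :
  is_int_from (V := RN) 0
    (fun s => M * norm y * (exp (- delta * (s - t)) * (alias_bound h delta n (s - t) + eta)))
    (M * norm y * (aliasing_integral + eta * (exp (delta * t) / delta))).
Proof.
pose proof (alias_ratio_pos h Hh delta Hdelta) as Hr.
set (D := exp (delta * PI / h) - 1) in *.
assert (I : forall c, 0 < c -> is_int_from (V := RN) 0 (fun s => exp (- c * (s - t))) (exp (c * t) / c)).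
{ intros c Hc.
  refine (eq_ind _ (is_int_from (V := RN) 0 _) (is_int_from_ext (V := RC) 0 _ _ _ _
    (is_int_from_scal (V := RC) _ (exp (c * t)) _ _ (is_int_from_exp 0 c Hc))) _ _).
  - intros s _. change (exp (c * t) * exp (- c * s) = exp (- c * (s - t))). rewrite -exp_plus. f_equal; ring.
  - change (exp (c * t) * (exp (- c * 0) / c) = exp (c * t) / c). rewrite Rmult_0_r exp_0. field; lra. }
pose proof (I (3 * delta / 2) ltac:(lra)) as I1. pose proof (I (delta / 2) ltac:(lra)) as I2. pose proof (I delta Hdelta) as I3.
refine (eq_ind _ (is_int_from (V := RN) 0 _) (is_int_from_ext (V := RC) 0 _ _ _ _
  (is_RInt_gen_scal (V := RN) _ (M * norm y) _
   (is_int_from_plus (V := RC) _ _ _ _ _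
     (is_int_from_plus (V := RC) _ _ _ _ _
        (is_int_from_scal (V := RC) _ (peak n (delta / 2) / D) _ _ I1)
        (is_int_from_scal (V := RC) _ (peak n (3 * delta / 2) / D) _ _ I2))
     (is_int_from_scal (V := RC) _ eta _ _ I3)))) _ _).
- intros s _.
  change (M * norm y * (peak n (delta / 2) / D * exp (- (3 * delta / 2) * (s - t)) +
     peak n (3 * delta / 2) / D * exp (- (delta / 2) * (s - t)) + eta * exp (- delta * (s - t))) =
     M * norm y * (exp (- delta * (s - t)) * (alias_bound h delta n (s - t) + eta))).
  f_equal. unfold alias_bound. fold D.
  replace (- (3 * delta / 2) * (s - t)) with (- delta * (s - t) + - (delta / 2) * (s - t)) by field.
  replace (- (delta / 2) * (s - t)) with (- delta * (s - t) + delta / 2 * (s - t)) at 2 by field.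
  rewrite !exp_plus. field. lra.
- change (M * norm y * (peak n (delta / 2) / D * (exp (3 * delta / 2 * t) / (3 * delta / 2)) +
     peak n (3 * delta / 2) / D * (exp (delta / 2 * t) / (delta / 2)) + eta * (exp (delta * t) / delta)) =
     M * norm y * (aliasing_integral + eta * (exp (delta * t) / delta))).
  unfold aliasing_integral; fold D.
  replace (3 * delta / 2 * t) with (3 * delta * t / 2) by field.
  replace (delta / 2 * t) with (delta * t / 2) by field.
  f_equal. field. lra.
Qed.

Section Errors.
Context (x : X) (Hx : dom (reg_op A m delta) x) (Hy : y = reg_op A m delta x).

(** The gamma kernel vanishes for [s <= t]. *)
Lemma semigroup_kernel :
  is_int_from (V := XR) 0
    (fun s => scal (RtoC (exp (- delta * (s - t)) * gamma_kernel n delta (s - t))) (K (Rabs s) y))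
    (K t x).
Proof.
set (f := fun s => scal (RtoC (exp (- delta * (s - t)) * gamma_kernel n delta (s - t))) (K (Rabs s) y)).
rewrite -(plus_zero_l (G := XR) (K t x)).
apply (is_RInt_gen_Chasles (V := XR) f t).
- apply (is_RInt_gen_at_point (V := XR)).
  refine (eq_ind _ (is_RInt (V := XR) f 0 t) (is_RInt_ext (V := XR) _ _ _ _ _ _ (is_RInt_const (V := XR) 0 t zero)) _ _).
  + intros s. rewrite Rmin_left; [ | lra ]. rewrite Rmax_right; [ | lra ]. intros Hs.
    unfold f. rewrite gamma_kernel_nonpos; [ | lia | lra ]. rewrite Rmult_0_r.
    symmetry; exact (scal_zero_l (V := X) _).
  + exact (scal_zero_r (V := XR) _).
- pose proof (semigroup_representation A K HA M HM HK delta t n x Hdelta (Rlt_le _ _ Ht)) as H.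
  replace (S n) with m in H by lia. specialize (H Hx).
  refine (is_int_from_ext (V := XR) t _ _ _ _ H).
  intros s Hs. unfold f. rewrite Hy. unfold reg_op. do 2 f_equal.
  unfold gamma_kernel. rewrite Rmax_right; [ | lra ].
  replace (- (2 * delta) * (s - t)) with (- delta * (s - t) + - delta * (s - t)) by ring.
  rewrite exp_plus; ring.
Qed.

Definition decay_remainder (N : nat) : R :=
  2 * (Series (decay h delta i) - sum_n (decay h delta i) N) / L.

Lemma decay_remainder_limit : is_lim_seq decay_remainder 0.
Proof.
pose proof (Series_correct _ (decay_summable h Hh delta Hdelta i)) as H.
apply (is_lim_seq_ext (fun N => 2 / L * (Series (decay h delta i) - sum_n (decay h delta i) N))).
{ intros N. unfold decay_remainder, Rdiv. ring. }
replace (Finite 0) with (Rbar_mult (2 / L) (Series (decay h delta i) - Series (decay h delta i))) by (simpl; f_equal; ring).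
apply is_lim_seq_scal_l, is_lim_seq_minus'; [ apply is_lim_seq_const | exact H ].
Qed.

(** The distance splits into the aliases, which do not depend on [N], and the
    remainder of an absolutely convergent Fourier series, which tends to 0
    uniformly in [sigma]. *)
Lemma kernel_sum_close (N : nat) (sigma : R) :
  Rabs (gamma_kernel n delta sigma - kernel_sum N sigma / L) <= alias_bound h delta n sigma + decay_remainder N.
Proof.
pose proof (period_pos h Hh) as HL.
destruct (sym_sum_limit (fourier_mode h delta n sigma) (decay h delta i)
  (fourier_mode_bound h delta Hdelta i sigma) (decay_summable h Hh delta Hdelta i)) as [l [Hl Hr]].
assert (H1 : Rabs (l / L - gamma_kernel n delta sigma) <= alias_bound h delta n sigma).
{ apply (aliasing h Hh delta Hdelta n ltac:(lia)).
  apply (is_lim_seq_scal_r _ (/ L) l), Hl. }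
assert (H2 : Rabs (l / L - kernel_sum N sigma / L) <= decay_remainder N).
{ unfold Rdiv at 1 3. rewrite -Rmult_minus_distr_r Rabs_mult (Rabs_pos_eq (/ L)); [ | apply Rlt_le, Rinv_0_lt_compat, HL ].
  unfold decay_remainder. apply Rmult_le_compat_r; [ apply Rlt_le, Rinv_0_lt_compat, HL | apply Hr ]. }
replace (gamma_kernel n delta sigma - kernel_sum N sigma / L) with
  (- (l / L - gamma_kernel n delta sigma) + (l / L - kernel_sum N sigma / L)) by ring.
refine (Rle_trans _ _ _ (Rabs_triang _ _) _). rewrite Rabs_Ropp. lra.
Qed.

Lemma bracket_N_error (N : nat) :
  norm (minus (K t x) (bracket_N A m h delta t N y))
    <= M * norm y * (aliasing_integral + decay_remainder N * (exp (delta * t) / delta)).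
Proof.
refine (is_int_from_norm (V := XR) 0 _ _ _ _ _ (is_RInt_gen_minus (V := XR) _ _ _ _ semigroup_kernel (bracket_N_integral N))
   (alias_bound_integral (decay_remainder N))).
intros s Hs.
set (e := exp (- delta * (s - t))).
set (u := K (Rabs s) y).
assert (E : minus (scal (RtoC (e * gamma_kernel n delta (s - t))) u) (scal (RtoC (e * (kernel_sum N (s - t) / L))) u)
   = scal (RtoC (e * (gamma_kernel n delta (s - t) - kernel_sum N (s - t) / L))) u).
{ rewrite Rmult_minus_distr_l RtoC_minus. symmetry; exact (scal_minus_distr_r (V := X) _ _ u). }
refine (Rle_trans _ _ _ (Req_le _ _ (f_equal norm E)) _).
refine (Rle_trans _ _ _ (norm_scal _ _) _).
change (abs ?c) with (Cmod c). rewrite Cmod_R Rabs_mult (Rabs_pos_eq e); [ | apply Rlt_le, exp_pos ].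
assert (Hu : norm u <= M * norm y).
{ unfold u. apply (semigroup_norm A K HA M HK), Rabs_pos. }
rewrite (Rmult_comm (M * norm y)). apply Rmult_le_compat; [ | apply norm_ge_0 | | exact Hu ].
- apply Rmult_le_pos; [ apply Rlt_le, exp_pos | apply Rabs_pos ].
- apply Rmult_le_compat_l; [ apply Rlt_le, exp_pos | apply kernel_sum_close ].
Qed.

Lemma bracket_limit :
  filterlim (fun N => bracket_N A m h delta t N y) eventually (locally (bracket A m h delta t y)).
Proof.
destruct bracket_zseries as [l Hl].
unfold bracket, bracket_N. rewrite (zseries_correct _ l Hl).
apply (filterlim_comp _ _ _ (zsum term) (fun v => scal (RtoC (h / (2 * PI))) v) _ (locally l)).
- apply zsum_is_zseries, Hl.
- apply (filterlim_scal_r (K := C_AbsRing) (V := X)).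
Qed.

(** Let [N] tend to infinity in [bracket_N_error]. *)
Lemma discretization_error :
  norm (minus (K t x) (bracket A m h delta t y)) <= M * norm y * aliasing_integral.
Proof.
assert (L1 : is_lim_seq (fun N => norm (minus (K t x) (bracket_N A m h delta t N y)))
   (norm (minus (K t x) (bracket A m h delta t y)))).
{ apply (filterlim_comp _ _ _ (fun N => minus (K t x) (bracket_N A m h delta t N y)) norm _
    (locally (minus (K t x) (bracket A m h delta t y)))); [ | exact (filterlim_norm (V := X) _) ].
  apply (filterlim_comp_2 (G := locally (K t x)) (H := locally (opp (bracket A m h delta t y)))
    (fun _ => K t x) (fun N => opp (bracket_N A m h delta t N y)) plus).
  - apply filterlim_const.
  - apply (filterlim_comp _ _ _ _ opp _ _ _ bracket_limit). apply (filterlim_opp (V := X)).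
  - apply (filterlim_plus (V := X)). }
assert (L2 : is_lim_seq (fun N => M * norm y * (aliasing_integral + decay_remainder N * (exp (delta * t) / delta)))
   (M * norm y * (aliasing_integral + 0 * (exp (delta * t) / delta)))).
{ apply (is_lim_seq_scal_l _ (M * norm y) (aliasing_integral + 0 * (exp (delta * t) / delta))).
  apply is_lim_seq_plus'; [ apply is_lim_seq_const | ].
  apply (is_lim_seq_scal_r _ (exp (delta * t) / delta) 0), decay_remainder_limit. }
rewrite Rmult_0_l Rplus_0_r in L2.
exact (is_lim_seq_le _ _ (norm (minus (K t x) (bracket A m h delta t y))) (M * norm y * aliasing_integral) bracket_N_error L1 L2).
Qed.

End Errors.

Lemma zsum_gap (N p : nat) :
  norm (minus (zsum term (S (N + p))) (zsum term N))
    <= 2 * (exp (delta * t) * (M / delta) * norm y) * sum_n (fun k => decay h delta i (S (N + k))) p.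
Proof.
set (C := exp (delta * t) * (M / delta) * norm y).
assert (Hterm : forall k, norm (plus (term (Z.of_nat (S k))) (term (- Z.of_nat (S k))%Z)) <= 2 * C * decay h delta i (S k)).
{ intros k. refine (Rle_trans _ _ _ (norm_triangle _ _) _).
  pose proof (bracket_term_norm (Z.of_nat (S k))) as H1. pose proof (bracket_term_norm (- Z.of_nat (S k))) as H2.
  replace (Z.abs_nat (Z.of_nat (S k))) with (S k) in H1 by lia.
  replace (Z.abs_nat (- Z.of_nat (S k))) with (S k) in H2 by lia.
  replace (2 * C * decay h delta i (S k)) with (C * decay h delta i (S k) + C * decay h delta i (S k)) by ring.
  apply Rplus_le_compat; assumption. }
induction p as [|p IH].
- rewrite sum_O Nat.add_0_r zsum_S.
  refine (Rle_trans _ _ _ (Req_le _ _ (f_equal norm (minus_plus_l (G := X) _ _))) (Hterm N)).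
- rewrite sum_Sn zsum_S. replace (N + S p)%nat with (S (N + p)) by lia.
  change (plus ?a ?b) with (a + b) at 3. rewrite Rmult_plus_distr_l.
  refine (Rle_trans _ _ _ _ (Rplus_le_compat _ _ _ _ IH (Hterm (S (N + p))))).
  refine (Rle_trans _ _ _ (Req_le _ _ (f_equal norm _)) (norm_triangle _ _)).
  exact (minus_plus_comm (G := X) _ _ _).
Qed.

(** The terms of index [k] and [- k] have norm at most
    [e^(delta t) (M / delta) |y|] times [decay k], and [decay_tail] sums them. *)
Lemma truncation_error (N : nat) :
  norm (minus (bracket A m h delta t y) (bracket_N A m h delta t N y))
    <= M * exp (delta * t) / delta ^ m
       * ((PI / 2 * wallis i - atan_int (S i) (INR N * h / delta)) / PI) * norm y.
Proof.
destruct bracket_zseries as [l Hl].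
unfold bracket, bracket_N. rewrite (zseries_correct _ l Hl).
pose proof PI_RGT_0 as Hpi.
assert (Hc : 0 < h / (2 * PI)) by (apply Rdiv_lt_0_compat; lra).
rewrite -(scal_minus_distr_l (V := X)).
refine (Rle_trans _ _ _ (norm_scal _ _) _).
change (abs ?c) with (Cmod c). rewrite Cmod_R Rabs_pos_eq; [ | lra ].
set (B := (PI / 2 * wallis i - atan_int (S i) (INR N * h / delta)) * delta / delta ^ m / h).
set (C := exp (delta * t) * (M / delta) * norm y).
assert (HC : 0 <= C).
{ unfold C. apply Rmult_le_pos; [ | apply norm_ge_0 ]. apply Rmult_le_pos; [ apply Rlt_le, exp_pos | apply Rlt_le, Rdiv_lt_0_compat; lra ]. }
assert (HB : norm (minus l (zsum term N)) <= 2 * C * B).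
{ assert (Hb : forall p, norm (minus (zsum term (S (N + p))) (zsum term N)) <= 2 * C * B).
  { intros p. refine (Rle_trans _ _ _ (zsum_gap N p) _). fold C. apply Rmult_le_compat_l; [ lra | ].
    unfold B. apply Rmult_le_reg_r with h; [ exact Hh | ].
    unfold Rdiv at 1; rewrite Rmult_assoc Rinv_l; [ rewrite Rmult_1_r; apply (decay_tail h Hh delta Hdelta i N p) | lra ]. }
  assert (L1 : is_lim_seq (fun p => norm (minus (zsum term (S (N + p))) (zsum term N))) (norm (minus l (zsum term N)))).
  { apply (filterlim_comp _ _ _ (fun p => minus (zsum term (S (N + p))) (zsum term N)) norm _
      (locally (minus l (zsum term N)))); [ | exact (filterlim_norm (V := X) _) ].
    apply (filterlim_comp_2 (G := locally l) (H := locally (opp (zsum term N)))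
      (fun p => zsum term (S (N + p))) (fun _ => opp (zsum term N)) plus).
    - apply (filterlim_comp _ _ _ (fun p => S (N + p)) (zsum term) _ eventually); [ | apply zsum_is_zseries, Hl ].
      intros P [k Hk]; exists k; intros p Hp; apply Hk; lia.
    - apply filterlim_const.
    - apply (filterlim_plus (V := X)). }
  exact (is_lim_seq_le _ _ (norm (minus l (zsum term N))) (2 * C * B) Hb L1 (is_lim_seq_const _)). }
apply Rle_trans with (h / (2 * PI) * (2 * C * B)).
- apply Rmult_le_compat_l; [ lra | exact HB ].
- assert (delta ^ m <> 0) by (apply pow_nonzero; lra).
  assert (PI <> 0) by lra. assert (delta <> 0) by lra. assert (h <> 0) by lra.
  right; unfold B, C. field. auto.
Qed.

End Trapezoid.

(** * The error bounds *)

(** Resolvents commute with [A], so the power of [2 delta - A] may be applied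
    before or after the truncated sum. This is what makes the total error a
    sum of the two partial errors. *)
Lemma bracket_N_op_pow {X : CompleteNormedModule C_AbsRing}
  (A : operator X) (HAlin : linear_operator A) (K : R -> X -> X) (HA : generates A K)
  (M : R) (HM : 1 <= M) (HK : forall s : R, 0 <= s -> Rbar_le (op_norm (K s)) (Finite M))
  (m : nat) (h delta t : R) (Hdelta : 0 < delta) (N : nat) (x : X) :
  dom (reg_op A m delta) x ->
  dom (reg_op A m delta) (bracket_N A m h delta t N x) /\
  reg_op A m delta (bracket_N A m h delta t N x) = bracket_N A m h delta t N (reg_op A m delta x).
Proof.
intros Hx. unfold reg_op in *. set (B := scalar_minus (RtoC (2 * delta)) A) in *.
assert (HP : linear_operator (op_pow B m)) by apply linear_operator_pow, linear_operator_scalar_minus, HAlin.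
assert (Hre : forall k, 0 < Re (node h delta k)) by (intros; rewrite node_pair; exact Hdelta).
assert (Ht : forall k, dom (op_pow B m) (bracket_term A m h delta t x k) /\
   op_pow B m (bracket_term A m h delta t x k) = bracket_term A m h delta t (op_pow B m x) k).
{ intros k. unfold bracket_term.
  rewrite !(resolvent_laplace A K HA M HM HK _ _ (Hre k)).
  destruct (laplace_op_pow A K HA M HM HK (node h delta k) (RtoC (2 * delta)) m x (Hre k) Hx) as [H1 H2].
  fold B in H1, H2.
  destruct (linear_operator_scal (op_pow B m) (weight m h delta t k) _ HP H1) as [H3 H4].
  rewrite H4 H2. auto. }
unfold bracket_N.
set (f := fun j => bracket_term A m h delta t x (Z.of_nat j - Z.of_nat N)%Z).
destruct (linear_operator_sum_n (op_pow B m) f (2 * N) HP) as [H1 H2].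
{ intros j; apply Ht. }
destruct (linear_operator_scal (op_pow B m) (RtoC (h / (2 * PI))) _ HP H1) as [H3 H4].
split; [ exact H3 | ].
refine (eq_trans H4 _). rewrite H2. unfold zsum. f_equal. apply sum_n_ext. intros j; apply Ht.
Qed.

Theorem theorem3
  (X : CompleteNormedModule C_AbsRing) (HX : separable_space X)
  (A : operator X) (HAlin : linear_operator A)
  (K : R -> X -> X) (HA : generates A K)
  (M : R) (HM : 1 <= M)
  (HK : forall s : R, 0 <= s -> Rbar_le (op_norm (K s)) (Finite M))
  (m : nat) (Hm2 : (2 <= m)%nat) (Hmeven : Nat.Even m)
  (delta h t : R) (Hdelta : 0 < delta) (Hh : 0 < h) (Ht : 0 < t)
  (N : nat) (HN : (1 <= N)%nat)
  (x : X) (Hx : dom (op_pow A m) x) :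
  (* well-definedness of the expressions in the bounds *)
  (forall z : C, 0 < Re z -> in_resolvent_set A z) /\
  dom (reg_op A m delta) x /\
  dom (reg_op A m delta) (bracket_N A m h delta t N x) /\
  (exists l : X,
     is_zseries (bracket_term A m h delta t (reg_op A m delta x)) l) /\
  (* the error bounds *)
  norm (error_hN A m h delta t K N x)
    <= E_D A m h delta t K x + E_T A m h delta t N x /\
  E_D A m h delta t K x
    <= M * exp (3 * delta * t / 2) / (delta ^ m * (exp (delta * PI / h) - 1))
       * (2 ^ (m + 1) * Gamma (3 / 2) * Gamma ((INR m - 1) / 2)
          / (PI * Gamma (INR m / 2)))
       * norm (reg_op A m delta x) /\
  E_T A m h delta t N x
    <= M * exp (delta * t) / delta ^ m
       * (Gamma (3 / 2) * Gamma ((INR m - 1) / 2) / (PI * Gamma (INR m / 2))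
          - h * INR N / (PI * delta)
            * Re (hyp2F1 (RtoC (1 / 2)) (RtoC (INR m / 2)) (RtoC (3 / 2))
                    (RtoC (- (h * INR N / delta) ^ 2))))
       * norm (reg_op A m delta x).
Proof.
destruct Hmeven as [j Hj]. destruct j as [|i]; [ lia | ]. subst m.
assert (Hreg : dom (reg_op A (2 * S i) delta) x) by (apply op_pow_scalar_minus_dom; assumption).
destruct (bracket_N_op_pow A HAlin K HA M HM HK (2 * S i) h delta t Hdelta N x Hreg) as [HbN EbN].
pose proof PI_RGT_0 as Hpi.
assert (HG0 : Gamma (INR (2 * S i) / 2) <> 0).
{ intros E0. pose proof (Gamma_ratio i) as H. rewrite E0 in H. unfold Rdiv in H.
  rewrite Rinv_0 Rmult_0_r in H. pose proof (wallis_pos i). nra. }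
assert (HG : Gamma (3 / 2) * Gamma ((INR (2 * S i) - 1) / 2) / (PI * Gamma (INR (2 * S i) / 2)) = wallis i / 2).
{ replace (Gamma (3 / 2) * Gamma ((INR (2 * S i) - 1) / 2) / (PI * Gamma (INR (2 * S i) / 2))) with
    (Gamma (3 / 2) * Gamma ((INR (2 * S i) - 1) / 2) / Gamma (INR (2 * S i) / 2) / PI) by (field; split; [ exact HG0 | lra ]).
  rewrite Gamma_ratio. field; lra. }
set (y := reg_op A (2 * S i) delta x) in *.
split; [ exact (right_half_plane_in_resolvent_set A K HA M HM HK) | ].
split; [ exact Hreg | ]. split; [ exact HbN | ].
split; [ exact (bracket_zseries A K HA M HM HK i delta h t Hdelta Hh y) | ].
split; [ | split ].
- unfold error_hN, E_D, E_T, S_h, S_hN. rewrite EbN. fold y.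
  rewrite (minus_trans (bracket A (2 * S i) h delta t y) (K t x)).
  exact (norm_triangle (V := X) _ _).
- unfold E_D, S_h. fold y.
  refine (Rle_trans _ _ _ (discretization_error A K HA M HM HK i delta h t Hdelta Hh Ht y x Hreg eq_refl) _).
  pose proof (alias_ratio_pos h Hh delta Hdelta) as Hr.
  pose proof (alias_constant delta Hdelta i t (Rlt_le _ _ Ht)) as Hc.
  replace (2 ^ (2 * S i + 1) * Gamma (3 / 2) * Gamma ((INR (2 * S i) - 1) / 2) / (PI * Gamma (INR (2 * S i) / 2)))
    with (2 ^ (2 * S i + 1) * (wallis i / 2)) by (rewrite -HG; field; split; [ exact HG0 | lra ]).
  rewrite pow_add pow_1.
  unfold aliasing_integral.
  assert (Hdm : delta ^ (2 * S i) <> 0) by (apply pow_nonzero; lra).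
  replace (M * exp (3 * delta * t / 2) / (delta ^ (2 * S i) * (exp (delta * PI / h) - 1)) * (2 ^ (2 * S i) * 2 * (wallis i / 2)) * norm y)
    with (M * norm y * (exp (3 * delta * t / 2) / delta ^ (2 * S i) * (2 ^ (2 * S i) * wallis i) / (exp (delta * PI / h) - 1)))
    by (field; split; [ lra | exact Hdm ]).
  apply Rmult_le_compat_l; [ apply Rmult_le_pos; [ lra | apply norm_ge_0 ] | ].
  apply Rmult_le_compat_r; [ apply Rlt_le, Rinv_0_lt_compat, Hr | exact Hc ].
- unfold E_T, S_h, S_hN. fold y.
  refine (Rle_trans _ _ _ (truncation_error A K HA M HM HK i delta h t Hdelta Hh y N) (Req_le _ _ _)).
  do 2 f_equal. rewrite HG.
  assert (HNp : 0 < INR N) by (apply lt_0_INR; lia).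
  replace (INR (2 * S i) / 2) with (INR (S i)) by (rewrite mult_INR; change (INR 2) with 2; field).
  set (X0 := h * INR N / delta).
  assert (HX0 : 0 < X0) by (apply Rdiv_lt_0_compat; [ apply Rmult_lt_0_compat; lra | lra ]).
  replace (INR N * h / delta) with X0 by (unfold X0; field; lra).
  rewrite -(hyp2F1_value (S i) X0 HX0).
  unfold X0 at 1. field. lra.
Qed.
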